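(* Let $\Sigma_M$ be a control system on a regular manifold $M\subset\mathbb{R}^n$, with extension $\tilde\Sigma_{\mathbb{R}^n}:\ \dot x=\tilde X_e(x,u),\ y=h(x)$ to $\mathbb{R}^n$, and let $(x_0(t),u_0(t))$, $t\ge0$, be a bounded reference trajectory on $M$ with its control signal, with linearization matrices $A(t),B(t),C(t)$ (all as described in the context). Let $z_{\rm o}\in\mathbb{R}^n$ be the state of the observer $$\dot z_{\rm o}=A(t)z_{\rm o}+B(t)\Delta u-L(t)(C(t)z_{\rm o}-\Delta y),\qquad L(t)=P(t)C^T(t)R^{-1}(t),$$ where $P(t)$ is the solution to $$\dot P=PA^T(t)+A(t)P-PC^T(t)R^{-1}(t)C(t)P+Q(t),$$ with $R(t)=R^T(t)>0$ and $Q(t)=Q^T(t)\ge0$, and let the control be $u=u_0(t)-K(t)z_{\rm o}$. Put $e_{\rm o}=\Delta x-z_{\rm o}$; the tracking error and observation error dynamics are together written as $$\begin{bmatrix}\Delta\dot x\\ \dot e_{\rm o}\end{bmatrix}=\begin{bmatrix}A(t)-B(t)K(t)&B(t)K(t)\\0&A(t)-L(t)C(t)\end{bmatrix}\begin{bmatrix}\Delta x\\ e_{\rm o}\end{bmatrix}+O(\|\Delta x\|^2,\|e_{\rm o}\|^2).\quad( * )$$ Suppose that: (i) $K(t)$ is chosen such that the linear time-varying system $\dot z=(A(t)-B(t)K(t))z$ is exponentially stable; (ii) $B(t)K(t)$ is bounded; (iii) the pair $(A(t),C(t))$ is uniformly completely observable; (iv) for some matrices $D(t)$ and $\tilde Q(t)=\tilde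 Q^T(t)$ such that $Q(t)=D(t)\tilde Q(t)D^T(t)$, the pair $(A(t),D(t))$ is uniformly completely controllable and there are positive numbers $\gamma_1,\gamma_2$ with $\gamma_1I\le\tilde Q(t)\le\gamma_2I$ for all $t$; (v) there are positive numbers $\gamma_3,\gamma_4$ with $\gamma_3I\le R(t)\le\gamma_4I$ for all $t$. Then $(\Delta x,e_{\rm o})=(0,0)$ is an exponentially stable equilibrium point for $( * )$. In consequence, the trajectory $x(t)$ of the system $\Sigma_M$ on $M$ exponentially tracks the reference $x_0(t)$ with this observer-based controller.
   Context: Setting. $M\subset\mathbb{R}^n$ is a regular manifold; $\Sigma_M$ is the control system $\dot x=X(x,u)$, $y=h(x)\in\mathbb{R}^p$, $x\in M$, $u\in\mathbb{R}^k$, with $X(x,u)\in T_xM$, and $h$ is defined on $\mathbb{R}^n$. $X_e:\mathbb{R}^n\times\mathbb{R}^k\to\mathbb{R}^n$ satisfies $X_e=X$ on $M\times\mathbb{R}^k$. $\tilde V$ is a non-negative function on $\mathbb{R}^n$ with $M=\tilde V^{-1}(0)$ and $\nabla\tilde V(x)\cdot X_e(x,u)=0$ for all $(x,u)\in\mathbb{R}^n\times\mathbb{R}^k$. Put $\tilde X_e(x,u)=X_e(x,u)-\nabla\tilde V(x)$; this coincides with $X$ on $M$, so $\tilde\Sigma_{\mathbb{R}^n}$ restricts to $\Sigma_M$ on $M$. Reference. $x_0:[0,\infty)\to M$ and $u_0:[0,\infty)\to\mathbb{R}^k$ are bounded and $\dot x_0(t)=X(x_0(t),u_0(t))$ for all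 $t\ge0$. Write $\Delta x=x-x_0(t)$, $\Delta u=u-u_0(t)$, $\Delta y=y-h(x_0(t))$, where $x$ and $y$ are the state and output of $\tilde\Sigma_{\mathbb{R}^n}$, and $$A(t)=\frac{\partial\tilde X_e}{\partial x}(x_0(t),u_0(t)),\quad B(t)=\frac{\partial\tilde X_e}{\partial u}(x_0(t),u_0(t)),\quad C(t)=\frac{\partial h}{\partial x}(x_0(t)),$$ which are continuous in $t$. The term $O(\cdot)$ in $( * )$ is the second-order remainder of the linearization; it is understood that it also depends explicitly on $t$. Uniform complete controllability/observability. Let $\Phi(t,\tau)$ be the transition matrix of $\dot x=A(t)x$: $\partial_t\Phi(t,\tau)=A(t)\Phi(t,\tau)$, $\Phi(\tau,\tau)=I$. The pair $(A(t),B(t))$ is uniformly completely controllable if there are $\sigma>0$ and $\alpha_1,\dots,\alpha_4>0$ depending on $\sigma$ such that for all $t$: $\alpha_1I\le W(t,t+\sigma)\le\alpha_2I$ and $\alpha_3I\le\Phi(t+\sigma,t)W(t,t+\sigma)\Phi^T(t+\sigma,t)\le\alpha_4I$, where $W(t,\bar t)=\int_t^{\bar t}\Phi(t,\tau)B(\tau)B^T(\tau)\Phi^T(t,\tau)\,d\tau$ (for $(A,D)$, replace $B$ by $D$). The pair $(A(t),C(t))$ is uniformly completely observable if there are $\sigma>0$ and $\alpha_1,\dots,\alpha_4>0$ depending on $\sigma$ such that for all $t$: $\alpha_1I\le V(t,t+\sigma)\le\alpha_2I$ and $\alpha_3I\le\Phi^T(t,t+\sigma)V(t,t+\sigma)\Phi(t,t+\sigma)\le\alpha_4I$,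 where $V(t,\bar t)=\int_t^{\bar t}\Phi^T(\tau,t)C^T(\tau)C(\tau)\Phi(\tau,t)\,d\tau$.
   Formalization: P(0) is assumed symmetric and positive semidefinite (a negative constant solution P violates the claim), and the O-term in ( * ) is bounded uniformly in t (false otherwise for unbounded K); u_0, K, R, Q, D are taken continuous, X_e and h of class C^1, V~ of class C^2. *)

(* Defs.v *)
From HB Require Import structures.
From mathcomp Require Import all_boot all_order all_algebra.
From mathcomp Require Import all_classical all_reals all_analysis.
Set Implicit Arguments.
Unset Strict Implicit.
Unset Printing Implicit Defensive.
Import Order.TTheory GRing.Theory Num.Theory.
Import numFieldNormedType.Exports.
Local Open Scope classical_set_scope.
Local Open Scope ring_scope.

(* Vectors are columns.  `|_| is the library (max) norm; every use of it below
   is under existentially quantified constants, so the Euclidean norm would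
   give the same notions. *)

Section Calculus.
Context {R : realType}.

(* In finite dimension, continuity of all directional derivatives is
   continuity of the differential. *)
Definition C1_on {V W : normedModType R} (U : set V) (f : V -> W) : Prop :=
  forall x, U x ->
    differentiable f x /\ forall v, {for x, continuous (fun y => 'D_v f y)}.

Definition jac {n m : nat} (f : 'cV[R]_n -> 'cV[R]_m) (x : 'cV[R]_n) :
    'M[R]_(m, n) :=
  \matrix_(i < m, j < n) ('D_(delta_mx j 0) f x) i 0.

Definition grad {n : nat} (V : 'cV[R]_n -> R) (x : 'cV[R]_n) : 'cV[R]_n :=
  \col_(j < n) 'D_(delta_mx j 0) V x.

(* The difference quotient is restricted to D, so that the derivative is the
   right derivative at the left endpoint of D = [t0, T[. *)
Definition deriv_within {V : normedModType R} (D : set R) (f : R -> V)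
    (t : R) (l : V) : Prop :=
  (s - t)^-1 *: (f s - f t) @[s --> within D t^'] --> l.

Definition is_solution {V : normedModType R} (f : R -> V -> V) (D : set R)
    (x : R -> V) : Prop :=
  forall t, D t -> deriv_within D x t (f t (x t)).

Definition bounded_from0 {V : normedModType R} (f : R -> V) : Prop :=
  exists b : R, forall t, 0 <= t -> `|f t| <= b.

Definition continuous_from0 {V : normedModType R} (f : R -> V) : Prop :=
  {within `[0, +oo[, continuous f}.

Definition mx_integral {n m : nat} (F : R -> 'M[R]_(n, m)) (a b : R) :
    'M[R]_(n, m) :=
  \matrix_(i < n, j < m) Rintegral lebesgue_measure `[a, b] (fun t => F t i j).

End Calculus.

Section Manifolds.
Context {R : realType}.

(* Adapted (slice) charts of class C^1: in the chart, M is the locus where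
   the coordinates of index >= m vanish. *)
Definition regular_manifold {n : nat} (m : nat) (M : set 'cV[R]_n) : Prop :=
  (m <= n)%N /\
  forall p, M p ->
    exists (U U' : set 'cV[R]_n) (phi psi : 'cV[R]_n -> 'cV[R]_n),
      [/\ open U, open U' & U p] /\
      [/\ C1_on U phi,
          C1_on U' psi,
          forall x, U x -> U' (phi x) /\ psi (phi x) = x &
          forall y, U' y -> U (psi y) /\ phi (psi y) = y] /\
      forall x, U x ->
        (M x <-> forall i : 'I_n, (m <= i)%N -> phi x i 0 = 0).

Definition tangent {n : nat} (M : set 'cV[R]_n) (p v : 'cV[R]_n) : Prop :=
  exists gamma : R -> 'cV[R]_n,
    [/\ gamma 0 = p, \forall s \near 0, M (gamma s) &
        deriv_within setT gamma 0 v].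

End Manifolds.

Section LinearSystems.
Context {R : realType}.

Definition qform {n : nat} (S : 'M[R]_n) (v : 'cV[R]_n) : R :=
  (v^T *m S *m v) 0 0.

Definition posdef {n : nat} (S : 'M[R]_n) : Prop :=
  forall v, v != 0 -> 0 < qform S v.

Definition loewner_le {n : nat} (S S' : 'M[R]_n) : Prop :=
  forall v, qform S v <= qform S' v.

Definition transition_matrix {n : nat} (A : R -> 'M[R]_n)
    (Phi : R -> R -> 'M[R]_n) : Prop :=
  forall tau, 0 <= tau ->
    Phi tau tau = 1%:M /\
    is_solution (fun t (Z : 'M[R]_n) => A t *m Z) `[0, +oo[
      (fun t => Phi t tau).

Definition ctrl_gramian {n k : nat} (Phi : R -> R -> 'M[R]_n)
    (B : R -> 'M[R]_(n, k)) (t t' : R) : 'M[R]_n :=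
  mx_integral (fun tau => Phi t tau *m B tau *m (B tau)^T *m (Phi t tau)^T)
    t t'.

Definition obs_gramian {n p : nat} (Phi : R -> R -> 'M[R]_n)
    (C : R -> 'M[R]_(p, n)) (t t' : R) : 'M[R]_n :=
  mx_integral (fun tau => (Phi tau t)^T *m (C tau)^T *m C tau *m Phi tau t)
    t t'.

(* In the next two definitions Phi is the transition matrix of x' = A(t) x. *)
Definition unif_compl_controllable {n k : nat} (Phi : R -> R -> 'M[R]_n)
    (B : R -> 'M[R]_(n, k)) : Prop :=
  exists s a1 a2 a3 a4 : R,
    [/\ 0 < s, 0 < a1, 0 < a2, 0 < a3 & 0 < a4] /\
    forall t, 0 <= t ->
      let W := ctrl_gramian Phi B t (t + s) in
      let W' := Phi (t + s) t *m W *m (Phi (t + s) t)^T in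
      [/\ loewner_le a1%:M W, loewner_le W a2%:M,
          loewner_le a3%:M W' & loewner_le W' a4%:M].

Definition unif_compl_observable {n p : nat} (Phi : R -> R -> 'M[R]_n)
    (C : R -> 'M[R]_(p, n)) : Prop :=
  exists s a1 a2 a3 a4 : R,
    [/\ 0 < s, 0 < a1, 0 < a2, 0 < a3 & 0 < a4] /\
    forall t, 0 <= t ->
      let V := obs_gramian Phi C t (t + s) in
      let V' := (Phi t (t + s))^T *m V *m Phi t (t + s) in
      [/\ loewner_le a1%:M V, loewner_le V a2%:M,
          loewner_le a3%:M V' & loewner_le V' a4%:M].

End LinearSystems.

Section Stability.
Context {R : realType}.

(* The decay estimate is required of every solution on every interval [t0, T[,
   and a solution on all of [t0, +oo[ is required to exist. *)
Definition exponentially_stable {n : nat}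
    (f : R -> 'cV[R]_n -> 'cV[R]_n) : Prop :=
  (forall t, 0 <= t -> f t 0 = 0) /\
  exists c lambda delta : R,
    [/\ 0 < c, 0 < lambda & 0 < delta] /\
    forall t0 xi0, 0 <= t0 -> `|xi0| < delta ->
      (exists xi, xi t0 = xi0 /\ is_solution f `[t0, +oo[ xi) /\
      forall T xi, xi t0 = xi0 -> is_solution f `[t0, T[ xi ->
        forall t, t0 <= t < T ->
          `|xi t| <= c * `|xi0| * expR (- lambda * (t - t0)).

End Stability.

Section ObserverBasedTracking.
Context {R : realType} {n k p : nat}.

Definition ext_field (Xe : 'cV[R]_n -> 'cV[R]_k -> 'cV[R]_n)
    (V : 'cV[R]_n -> R) (x : 'cV[R]_n) (u : 'cV[R]_k) : 'cV[R]_n :=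
  Xe x u - grad V x.

Variables (h : 'cV[R]_n -> 'cV[R]_p).
Variables (x0 : R -> 'cV[R]_n) (u0 : R -> 'cV[R]_k).
Variables (A : R -> 'M[R]_n) (B : R -> 'M[R]_(n, k)) (C : R -> 'M[R]_(p, n)).
Variables (L : R -> 'M[R]_(n, p)) (K : R -> 'M[R]_(k, n)).

Definition observer_field (t : R) (z : 'cV[R]_n) (du : 'cV[R]_k)
    (dy : 'cV[R]_p) : 'cV[R]_n :=
  A t *m z + B t *m du - L t *m (C t *m z - dy).

Definition feedback (t : R) (z : 'cV[R]_n) : 'cV[R]_k := u0 t - K t *m z.

(* The exact dynamics of xi = (dx, e) with dx = x - x0(t) and e = dx - z, for
   the plant x' = X(x, u), y = h(x), driven by the observer-based feedback;
   x0' = X(x0, u0). *)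
Definition error_field (X : 'cV[R]_n -> 'cV[R]_k -> 'cV[R]_n) (t : R)
    (xi : 'cV[R]_(n + n)) : 'cV[R]_(n + n) :=
  let dx := usubmx xi in
  let e := dsubmx xi in
  let z := dx - e in
  let x := x0 t + dx in
  let u := feedback t z in
  let ddx := X x u - X (x0 t) (u0 t) in
  col_mx ddx
    (ddx - observer_field t z (u - u0 t) (h x - h (x0 t))).

Definition error_matrix (t : R) : 'M[R]_(n + n) :=
  block_mx (A t - B t *m K t) (B t *m K t) 0 (A t - L t *m C t).

(* The bound is uniform in t. *)
Definition second_order_remainder
    (X : 'cV[R]_n -> 'cV[R]_k -> 'cV[R]_n) : Prop :=
  exists c r : R, [/\ 0 < c, 0 < r &
    forall t xi, 0 <= t -> `|xi| < r ->
      `|error_field X t xi - error_matrix t *m xi|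
        <= c * (`|usubmx xi| ^+ 2 + `|dsubmx xi| ^+ 2)].

Definition closed_loop_on (M : set 'cV[R]_n)
    (X : 'cV[R]_n -> 'cV[R]_k -> 'cV[R]_n) (D : set R)
    (x z : R -> 'cV[R]_n) : Prop :=
  forall t, D t ->
    let u := feedback t (z t) in
    [/\ M (x t), deriv_within D x t (X (x t) u) &
        deriv_within D z t
          (observer_field t (z t) (u - u0 t) (h (x t) - h (x0 t)))].

Definition exponentially_tracks (M : set 'cV[R]_n)
    (X : 'cV[R]_n -> 'cV[R]_k -> 'cV[R]_n) : Prop :=
  exists c lambda delta : R,
    [/\ 0 < c, 0 < lambda & 0 < delta] /\
    forall t0 q z0, 0 <= t0 -> M q -> `|q - x0 t0| < delta -> `|z0| < delta ->
      (exists x z, [/\ x t0 = q, z t0 = z0 &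
                       closed_loop_on M X `[t0, +oo[ x z]) /\
      forall T x z, x t0 = q -> z t0 = z0 -> closed_loop_on M X `[t0, T[ x z ->
        forall t, t0 <= t < T ->
          `|x t - x0 t|
            <= c * (`|q - x0 t0| + `|z0|) * expR (- lambda * (t - t0)).

End ObserverBasedTracking.

(* Main.v *)
(* Along the adjoint x' = - (A - P C^T R^-1 C)^T x of the observation error
   equation, x^T P x increases at the rate x^T (P C^T R^-1 C P + Q) x.  By
   uniform controllability of (A, D) the increase over one window dominates
   |x|^2 at its left end, and P is bounded above: x^T P x is at most the cost of
   any control steering the dual system x' = - A^T x + C^T w from 0 to x, and
   uniform observability provides a cheap one in a single window.  Hence
   x^T P x grows geometrically from window to window, and as x . e is constant
   the error e contracts by any prescribed factor over long enough windows.
   The block-triangular linear part then contracts the weighted norm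
   |dx| + mu |e| over such windows, and for small data the quadratic remainder
   does not spoil this contraction, which gives exponential decay.
   On M, Vtilde decreases along the extended field, so M is invariant and the
   extended closed loop restricts to the one on M. *)
Require Import Defs.
From HB Require Import structures.
From mathcomp Require Import all_boot all_order all_algebra.
From mathcomp Require Import all_classical all_reals all_analysis.
From mathcomp Require Import ring lra.
Set Implicit Arguments.
Unset Strict Implicit.
Unset Printing Implicit Defensive.
Import Order.TTheory GRing.Theory Num.Theory.
Import numFieldNormedType.Exports.
Local Open Scope classical_set_scope.
Local Open Scope ring_scope.

(** * Limits and derivatives of matrix-valued functions *)

(** The usual Lyapunov function e^T P^-1 e is not at hand: P(0) is only positive semidefinite, so P
    need not be invertible at early times. Passing to the adjoint equation avoids inverting P. Nor
    is D bounded. It is only continuous, and the upper bound on its Gramian controls the integral of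
    |D|^2 over windows, not its values; the effect of Q is therefore always measured by that
    integral. Likewise only the product B K is bounded, not K. Differential inequalities are stated
    for functions with given derivatives on closed intervals and proved by the mean value theorem,
    so that derivatives need not be integrable; integrals serve only to construct primitives and in
    the Gramians, which are at once rewritten as increments of primitives. The error field is only
    locally Lipschitz and solutions must exist for all time. They are obtained from a clamped,
    globally Lipschitz field, and the decay estimate shows that the clamp never acts. That estimate
    is first proved for solutions assumed to stay small; a continuity argument then removes the
    assumption. *)

Section MatrixLimits.
Context {R : realType}.

Lemma cvg_mxP {T : Type} (F : set_system T) {FF : Filter F} m n
    (f : T -> 'M[R]_(m, n)) (l : 'M[R]_(m, n)) :
  f x @[x --> F] --> l <->
  forall i j, f x i j @[x --> F] --> l i j.
Proof.
split=> [fl i j|fl].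
  exact: (cvg_comp _ _ fl (@coord_continuous R m n i j l)).
move=> A [P nP PA].
have H : \forall x \near F, forall i j, P i j (f x i j).
  have H1 : forall i, \forall x \near F, forall j, P i j (f x i j).
    move=> i; apply: filter_forall => j; exact: (fl i j _ (nP i j)).
  exact: filter_forall.
by apply: filterS H => x Hx; apply: PA.
Qed.

Lemma cvg_sumr {T : Type} (F : set_system T) {FF : Filter F} {V : normedModType R}
    (I : Type) (r : seq I) (P : pred I) (f : I -> T -> V) (l : I -> V) :
  (forall i, f i x @[x --> F] --> l i) ->
  \sum_(i <- r | P i) f i x @[x --> F] --> \sum_(i <- r | P i) l i.
Proof.
move=> fl; elim: r => [|i r IH].
  by rewrite big_nil; under eq_cvg do rewrite big_nil; exact: cvg_cst.
rewrite big_cons; under eq_cvg do rewrite big_cons.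
by case: (P i) => //; apply: cvgD => //; exact: fl.
Qed.

Lemma cvg_mulmx {T : Type} (F : set_system T) {FF : Filter F} m n p
    (f : T -> 'M[R]_(m, n)) (g : T -> 'M[R]_(n, p)) (a : 'M[R]_(m, n)) (b : 'M[R]_(n, p)) :
  f x @[x --> F] --> a -> g x @[x --> F] --> b ->
  f x *m g x @[x --> F] --> a *m b.
Proof.
move=> /cvg_mxP fa /cvg_mxP gb; apply/cvg_mxP => i j.
rewrite mxE; under eq_cvg do rewrite mxE.
by apply: cvg_sumr => k; apply: cvgM; [exact: fa|exact: gb].
Qed.

Lemma cvg_trmx {T : Type} (F : set_system T) {FF : Filter F} m n
    (f : T -> 'M[R]_(m, n)) (a : 'M[R]_(m, n)) :
  f x @[x --> F] --> a -> (f x)^T @[x --> F] --> a^T.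
Proof.
move=> /cvg_mxP fa; apply/cvg_mxP => i j.
by rewrite mxE; under eq_cvg do rewrite mxE; exact: fa.
Qed.

Lemma cvg_col_mx {T : Type} (F : set_system T) {FF : Filter F} m1 m2 n
    (f : T -> 'M[R]_(m1, n)) (g : T -> 'M[R]_(m2, n)) (a : 'M[R]_(m1, n)) (b : 'M[R]_(m2, n)) :
  f x @[x --> F] --> a -> g x @[x --> F] --> b ->
  col_mx (f x) (g x) @[x --> F] --> col_mx a b.
Proof.
move=> /cvg_mxP fa /cvg_mxP gb; apply/cvg_mxP => i j.
rewrite mxE; under eq_cvg do rewrite mxE.
by case: (fintype.split i) => k; [exact: fa|exact: gb].
Qed.

Lemma cvg_usubmx {T : Type} (F : set_system T) {FF : Filter F} m1 m2 n
    (f : T -> 'M[R]_(m1 + m2, n)) (a : 'M[R]_(m1 + m2, n)) :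
  f x @[x --> F] --> a -> usubmx (f x) @[x --> F] --> usubmx a.
Proof.
move=> /cvg_mxP fa; apply/cvg_mxP => i j.
by rewrite mxE; under eq_cvg do rewrite mxE; exact: fa.
Qed.

Lemma cvg_dsubmx {T : Type} (F : set_system T) {FF : Filter F} m1 m2 n
    (f : T -> 'M[R]_(m1 + m2, n)) (a : 'M[R]_(m1 + m2, n)) :
  f x @[x --> F] --> a -> dsubmx (f x) @[x --> F] --> dsubmx a.
Proof.
move=> /cvg_mxP fa; apply/cvg_mxP => i j.
by rewrite mxE; under eq_cvg do rewrite mxE; exact: fa.
Qed.

Lemma cvg_det {T : Type} (F : set_system T) {FF : Filter F} n
    (f : T -> 'M[R]_n) (a : 'M[R]_n) :
  f x @[x --> F] --> a -> \det (f x) @[x --> F] --> \det a.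
Proof.
move=> /cvg_mxP fa; apply: cvg_sumr => s; apply: cvgM; first exact: cvg_cst.
elim: (index_enum _) => [|i r IH].
  by rewrite big_nil; under eq_cvg do rewrite big_nil; exact: cvg_cst.
rewrite big_cons; under eq_cvg do rewrite big_cons.
by apply: cvgM => //; exact: fa.
Qed.

Lemma cvg_invmx {T : Type} (F : set_system T) {FF : Filter F} n
    (f : T -> 'M[R]_n) (a : 'M[R]_n) : a \in unitmx ->
  (\forall x \near F, f x \in unitmx) ->
  f x @[x --> F] --> a -> invmx (f x) @[x --> F] --> invmx a.
Proof.
move=> ua uf fa.
(* [invmx] returns its argument on singular matrices, so the adjugate formula holds only where [f x]
   is invertible, hence the hypothesis [uf]. *)
have E : {near F, (fun x => (\det (f x))^-1 *: \adj (f x)) =1 (fun x => invmx (f x))}.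
  by apply: filterS uf => x; rewrite /invmx => ->.
apply: cvg_trans (near_eq_cvg E) _.
rewrite /invmx ua.
have da : \det a != 0 by move: ua; rewrite unitmxE unitfE.
apply: cvgZ; first by apply: cvgV => //; exact: cvg_det.
apply/cvg_mxP => i j; rewrite mxE; under eq_cvg do rewrite mxE.
apply: cvgM; first exact: cvg_cst.
apply: cvg_det; apply/cvg_mxP => i' j'.
rewrite !mxE; under eq_cvg do rewrite !mxE.
by move/cvg_mxP : fa => fa; exact: fa.
Qed.

End MatrixLimits.

(** * Derivatives relative to a set *)

Section WithinDerivative.
Context {R : realType}.
Implicit Types (D : set R) (t : R).

(** Not a proper filter in general: [t] may be isolated in [D], as in a one-point interval, and then
    every limit holds trivially. *)
#[local] Instance within_dnbhs_filter D t : Filter (within D t^').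
Proof. exact: within_filter. Qed.

Lemma near_within_dnbhs D t (P : set R) :
  (forall s, D s -> s != t -> P s) -> \forall s \near within D t^', P s.
Proof.
move=> H; have : \forall s \near nbhs t, s != t -> D s -> P s.
  by apply: nearW => s st Ds; exact: H.
exact.
Qed.

Lemma cvg_near_eq {T : Type} (F : set_system T) {FF : Filter F} {U : topologicalType}
    (f g : T -> U) (l : U) :
  {near F, f =1 g} -> f x @[x --> F] --> l -> g x @[x --> F] --> l.
Proof. by move=> fg fl; apply: cvg_trans (near_eq_cvg fg) _. Qed.

Lemma cvg_eq {T : Type} (F : set_system T) {U : topologicalType}
    (f g : T -> U) (l : U) :
  f =1 g -> f x @[x --> F] --> l -> g x @[x --> F] --> l.
Proof. by move=> /funext ->. Qed.

Lemma deriv_within_sub {V : normedModType R} D D' (f : R -> V) t l :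
  D' `<=` D -> deriv_within D f t l -> deriv_within D' f t l.
Proof.
move=> DD fl; apply: cvg_trans fl; apply: cvg_app.
exact: within_subset.
Qed.

Lemma deriv_within_mxP D m n (f : R -> 'M[R]_(m, n)) t l :
  deriv_within D f t l <->
  forall i j, deriv_within D (fun s => f s i j) t (l i j).
Proof.
rewrite /deriv_within cvg_mxP.
have E i j : (fun s => ((s - t)^-1 *: (f s - f t)) i j) =
    (fun s => (s - t)^-1 *: (f s i j - f t i j)).
  by apply/funext => s; rewrite !mxE.
by split=> H i j; move: (H i j); rewrite E.
Qed.

Lemma deriv_within_cst {V : normedModType R} D (a : V) t :
  deriv_within D (fun=> a) t 0.
Proof.
by rewrite /deriv_within; under eq_cvg do rewrite subrr scaler0; exact: cvg_cst.
Qed.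

Lemma deriv_withinD {V : normedModType R} D (f g : R -> V) t a b :
  deriv_within D f t a -> deriv_within D g t b ->
  deriv_within D (fun s => f s + g s) t (a + b).
Proof.
move=> fa gb; apply: (cvg_eq _ (cvgD fa gb)) => s.
by rewrite /= -scalerDr opprD addrACA.
Qed.

Lemma deriv_withinN {V : normedModType R} D (f : R -> V) t a :
  deriv_within D f t a -> deriv_within D (fun s => - f s) t (- a).
Proof.
move=> fa; apply: (cvg_eq _ (cvgN fa)) => s.
by rewrite /= -scalerN opprD.
Qed.

Lemma deriv_withinB {V : normedModType R} D (f g : R -> V) t a b :
  deriv_within D f t a -> deriv_within D g t b ->
  deriv_within D (fun s => f s - g s) t (a - b).
Proof. by move=> fa gb; apply: deriv_withinD => //; exact: deriv_withinN. Qed.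

Lemma deriv_within_cvg {V : normedModType R} D (f : R -> V) t l :
  deriv_within D f t l -> f s @[s --> within D t^'] --> f t.
Proof.
move=> fl.
have st : (s - t) @[s --> within D t^'] --> (0 : R).
  rewrite -(subrr t); apply: cvgB; last exact: cvg_cst.
  apply: cvg_trans (@cvg_id R (nbhs t)).
  by apply: cvg_trans (@cvg_within _ (nbhs t) _ _); exact: cvg_within.
(* For s different from t, f s is (s - t) times the difference quotient plus f t; the limit of this
   expression is computed. *)
have E : f t = 0 *: l + f t by rewrite scale0r add0r.
rewrite [X in _ --> X]E.
apply: (cvg_near_eq _ (cvgD (cvgZ st fl) (cvg_cst (f t)))).
apply: near_within_dnbhs => s _ st' /=.
by rewrite [LHS]/= scalerA mulfV ?subr_eq0// scale1r subrK.
Qed.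

Lemma deriv_within_continuous {V : normedModType R} D (f f' : R -> V) :
  (forall t, D t -> deriv_within D f t (f' t)) -> {within D, continuous f}.
Proof.
move=> H; apply/subspace_continuousP => t Dt A nA.
have H1 : \forall s \near nbhs t, s != t -> D s -> A (f s).
  exact: (deriv_within_cvg (H t Dt) nA).
have : \forall s \near nbhs t, D s -> A (f s).
  apply: filterS H1 => s H1 Ds.
  by have [->|st] := eqVneq s t; [exact: nbhs_singleton|exact: H1].
exact.
Qed.

Lemma deriv_withinM D (f g : R -> R) t a b :
  deriv_within D f t a -> deriv_within D g t b ->
  deriv_within D (fun s => f s * g s) t (a * g t + f t * b).
Proof.
move=> fa gb.
apply: (cvg_eq _ (cvgD (cvgM fa (deriv_within_cvg gb)) (cvgM (cvg_cst (f t)) gb))).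
by move=> s; rewrite /= /GRing.scale /=; ring.
Qed.

Lemma deriv_within_sum {V : normedModType R} D (I : Type) (r : seq I)
    (P : pred I) (f : I -> R -> V) t (l : I -> V) :
  (forall i, deriv_within D (f i) t (l i)) ->
  deriv_within D (fun s => \sum_(i <- r | P i) f i s) t (\sum_(i <- r | P i) l i).
Proof.
move=> fl; apply: (cvg_eq _ (@cvg_sumr _ _ _ _ _ _ r P _ l fl)) => s.
by rewrite -scaler_sumr -sumrB.
Qed.

Lemma deriv_within_mulmx D m n p (f : R -> 'M[R]_(m, n)) (g : R -> 'M[R]_(n, p))
    t a b : deriv_within D f t a -> deriv_within D g t b ->
  deriv_within D (fun s => f s *m g s) t (a *m g t + f t *m b).
Proof.
move=> /deriv_within_mxP fa /deriv_within_mxP gb; apply/deriv_within_mxP => i j.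
have := @deriv_within_sum _ D _ (index_enum 'I_n) predT _ t _
  (fun k => deriv_withinM (fa i k) (gb k j)).
rewrite !mxE -big_split; congr (deriv_within D _ t _).
by apply/funext => s; rewrite mxE.
Qed.

Lemma deriv_within_mulmxl D m n p (c : 'M[R]_(m, n)) (g : R -> 'M[R]_(n, p)) t b :
  deriv_within D g t b -> deriv_within D (fun s => c *m g s) t (c *m b).
Proof.
move=> gb; have := deriv_within_mulmx (@deriv_within_cst _ D c t) gb.
by rewrite mul0mx add0r.
Qed.

Lemma deriv_within_mulmxr D m n p (f : R -> 'M[R]_(m, n)) (c : 'M[R]_(n, p)) t a :
  deriv_within D f t a -> deriv_within D (fun s => f s *m c) t (a *m c).
Proof.
move=> fa; have := deriv_within_mulmx fa (@deriv_within_cst _ D c t).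
by rewrite mulmx0 addr0.
Qed.

Lemma deriv_within_trmx D m n (f : R -> 'M[R]_(m, n)) t a :
  deriv_within D f t a -> deriv_within D (fun s => (f s)^T) t a^T.
Proof.
move=> /deriv_within_mxP fa; apply/deriv_within_mxP => i j; rewrite mxE.
have -> : (fun s => (f s)^T i j) = (fun s => f s j i) by apply/funext => s; rewrite mxE.
exact: fa.
Qed.

Lemma deriv_within_usubmx D m1 m2 n (f : R -> 'M[R]_(m1 + m2, n)) t a :
  deriv_within D f t a -> deriv_within D (fun s => usubmx (f s)) t (usubmx a).
Proof.
move=> /deriv_within_mxP fa; apply/deriv_within_mxP => i j; rewrite mxE.
have := fa (lshift m2 i) j; congr (deriv_within D _ t _).
by apply/funext => s; rewrite mxE.
Qed.

Lemma deriv_within_dsubmx D m1 m2 n (f : R -> 'M[R]_(m1 + m2, n)) t a :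
  deriv_within D f t a -> deriv_within D (fun s => dsubmx (f s)) t (dsubmx a).
Proof.
move=> /deriv_within_mxP fa; apply/deriv_within_mxP => i j; rewrite mxE.
have := fa (rshift m1 i) j; congr (deriv_within D _ t _).
by apply/funext => s; rewrite mxE.
Qed.

Lemma deriv_within_col_mx D m1 m2 n (f : R -> 'M[R]_(m1, n))
    (g : R -> 'M[R]_(m2, n)) t a b :
  deriv_within D f t a -> deriv_within D g t b ->
  deriv_within D (fun s => col_mx (f s) (g s)) t (col_mx a b).
Proof.
move=> fa gb; apply: (cvg_eq _ (cvg_col_mx fa gb)) => s.
by rewrite opp_col_mx add_col_mx scale_col_mx.
Qed.

Lemma near_dnbhs_shift t (P : set R) :
  (\forall s \near t^', P s) <-> (\forall h \near 0^', P (h + t)).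
Proof.
have E : nbhs t [set s | s != t -> P s] =
    \forall h \near 0, (h + t != t -> P (h + t)).
  by have := near_shift 0 t [set s | s != t -> P s]; rewrite subr0.
have E0 h : (h + t != t) = (h != 0) by rewrite -subr_eq0 addrK.
split=> H.
  suff : nbhs (0 : R) [set h | h != 0 -> P (h + t)] by [].
  have : \forall h \near 0, (h + t != t -> P (h + t)) by rewrite -E.
  by apply: filterS => h /=; rewrite E0.
suff : nbhs t [set s | s != t -> P s] by [].
rewrite E; have : nbhs (0 : R) [set h | h != 0 -> P (h + t)] by exact: H.
by apply: filterS => h /=; rewrite E0.
Qed.

(** Links the increment form of [is_derive] with quotients in [s], so that the mean value theorem
    and the fundamental theorem of calculus apply to [deriv_within]. *)
Lemma is_deriveP {V : normedModType R} (f : R -> V) t l :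
  is_derive t 1 f l <-> (s - t)^-1 *: (f s - f t) @[s --> t^'] --> l.
Proof.
have E : (fun h : R => h^-1 *: ((f \o shift t) (h *: (1 : R)) - f t)) =
         (fun h => ((h + t) - t)^-1 *: (f (h + t) - f t)).
  by apply/funext => h /=; rewrite addrK /shift /= [h *: _]mulr1.
split=> [[df <-] A nA|H].
  by apply/near_dnbhs_shift; move: (df A nA); rewrite E.
have H0 : h^-1 *: ((f \o shift t) (h *: (1 : R)) - f t) @[h --> 0^'] --> l.
  by rewrite E => A nA; apply/(near_dnbhs_shift t (fun s => A ((s - t)^-1 *: (f s - f t))))/H.
split; first by apply/cvg_ex; exists l.
exact: cvg_lim H0.
Qed.

Lemma is_derive_deriv_within {V : normedModType R} D (f : R -> V) t l :
  is_derive t 1 f l -> deriv_within D f t l.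
Proof.
move/is_deriveP => H A nA.
suff : \forall s \near nbhs t, s != t -> D s -> A ((s - t)^-1 *: (f s - f t)) by [].
have : \forall s \near nbhs t, s != t -> A ((s - t)^-1 *: (f s - f t)) := H A nA.
by apply: filterS => s H1 /H1.
Qed.

Lemma deriv_within_is_derive {V : normedModType R} (a b : R) (f : R -> V) t l :
  a < t < b -> deriv_within `[a, b] f t l -> is_derive t 1 f l.
Proof.
move=> /andP[at_ tb] H; apply/is_deriveP => A nA.
have H1 : \forall s \near nbhs t, s != t -> `[a, b]%classic s -> A ((s - t)^-1 *: (f s - f t)).
  exact: (H A nA).
have H2 : \forall s \near nbhs t, `]a, b[%classic s.
  apply: filterS (near_in_itvoo (_ : t \in `]a, b[)) => //.
  by rewrite in_itv /= at_ tb.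
have : \forall s \near nbhs t, s != t -> A ((s - t)^-1 *: (f s - f t)).
  apply: filterS2 H1 H2 => s H1 H2 st; apply: H1 => //.
  by move: H2; rewrite /= !in_itv /= => /andP[/ltW -> /ltW ->].
exact.
Qed.

Lemma deriv_withinZ D (f : R -> R) {V : normedModType R} (c : V) t a :
  deriv_within D f t a -> deriv_within D (fun s => f s *: c) t (a *: c).
Proof.
move=> fa; apply: (cvg_eq _ (cvgZ fa (cvg_cst c))) => s.
by rewrite -scalerBl scalerA.
Qed.

Lemma deriv_within_id D t : deriv_within D id t 1.
Proof. apply: is_derive_deriv_within; exact: is_derive_id. Qed.

Lemma deriv_within_expR D k a t :
  deriv_within D (fun s => expR (k * (s - a))) t (k * expR (k * (t - a))).
Proof.
apply: is_derive_deriv_within.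
have H : is_derive t (1 : R) (fun s => k * (s - a)) k.
  apply/is_deriveP; apply: (cvg_near_eq _ (cvg_cst k)).
  have : \forall s \near nbhs t, s != t -> k = (s - t)^-1 *: (k * (s - a) - k * (t - a)).
    apply: nearW => s st; 
    have st0 : s - t != 0 by rewrite subr_eq0.
    by rewrite /GRing.scale /=; field.
  exact.
have := @is_derive1_comp R expR (fun s => k * (s - a)) t _ _ (is_derive_expR _) H.
by rewrite mulrC.
Qed.

Lemma deriv_within_itv_sub (a b c d : R) {V : normedModType R} (f : R -> V) t l :
  c <= a -> b <= d -> deriv_within `[c, d] f t l -> deriv_within `[a, b] f t l.
Proof.
move=> ca bd; apply: deriv_within_sub => s /=; rewrite !in_itv/= => /andP[a_s s_b].
by rewrite (le_trans ca a_s) (le_trans s_b bd).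
Qed.

Lemma deriv_within_itvy_sub (a b c : R) {V : normedModType R} (f : R -> V) t l :
  c <= a -> deriv_within `[c, +oo[ f t l -> deriv_within `[a, b] f t l.
Proof.
move=> ca; apply: deriv_within_sub => s /=; rewrite !in_itv/= => /andP[a_s s_b].
by rewrite (le_trans ca a_s).
Qed.

End WithinDerivative.

(** * Mean value inequalities and Gronwall's lemma *)

Section MeanValue.
Context {R : realType}.

Lemma deriv_within_ge0_le (a b : R) (f f' : R -> R) : a <= b ->
  (forall t, a <= t <= b -> deriv_within `[a, b] f t (f' t)) ->
  (forall t, a <= t <= b -> 0 <= f' t) -> f a <= f b.
Proof.
move=> ab df f'0.
have H t : t \in `]a, b[ -> is_derive t 1 f (f' t).
  rewrite in_itv /= => /[dup]/andP[/ltW at_ /ltW tb] atb.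
  by apply: (deriv_within_is_derive atb); apply: df; rewrite at_ tb.
have [|c] := MVT_segment ab H.
  by apply: (@deriv_within_continuous R R _ f f') => t /=; rewrite in_itv /=; exact: df.
rewrite in_itv /= => /f'0 f'c E; rewrite -subr_ge0 E.
by rewrite mulr_ge0 // subr_ge0.
Qed.

(** Stands in for the monotonicity of the integral throughout: pointwise comparison of derivatives
    gives comparison of increments. *)
Lemma deriv_within_le (a b : R) (f f' g g' : R -> R) : a <= b ->
  (forall t, a <= t <= b -> deriv_within `[a, b] f t (f' t)) ->
  (forall t, a <= t <= b -> deriv_within `[a, b] g t (g' t)) ->
  (forall t, a <= t <= b -> f' t <= g' t) -> f b - f a <= g b - g a.
Proof.
move=> ab df dg fg.
suff : g a - f a <= g b - f b by lra.
apply: (@deriv_within_ge0_le a b (fun t => g t - f t) (fun t => g' t - f' t) ab).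
- by move=> t abt; apply: deriv_withinB; [exact: dg|exact: df].
- by move=> t abt; rewrite subr_ge0 fg.
Qed.

Lemma mx_norm_leP m n (x : 'M[R]_(m, n)) e : 0 <= e ->
  reflect (forall i j, `|x i j| <= e) (`|x| <= e).
Proof.
move=> e0; apply: (iffP idP) => [xe i j|H].
  apply: le_trans xe; rewrite [leRHS]/Num.norm /= mx_normrE.
  by apply/bigmax_geP; right; exists (i, j).
rewrite [leLHS]/Num.norm /= mx_normrE; by apply/bigmax_leP; split.
Qed.

Lemma mx_entry_le_norm m n (x : 'M[R]_(m, n)) i j : `|x i j| <= `|x|.
Proof. by move: i j; apply/mx_norm_leP. Qed.

(** The maximum norm allows an entrywise proof without loss: each entry is compared with [g] and
    with [- g]. *)
Lemma deriv_within_norm_le m n (a b : R) (f f' : R -> 'M[R]_(m, n)) (g g' : R -> R) :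
  a <= b ->
  (forall t, a <= t <= b -> deriv_within `[a, b] f t (f' t)) ->
  (forall t, a <= t <= b -> deriv_within `[a, b] g t (g' t)) ->
  (forall t, a <= t <= b -> `|f' t| <= g' t) -> `|f b - f a| <= g b - g a.
Proof.
move=> ab df dg fg.
have g0 : 0 <= g b - g a.
  rewrite subr_ge0; apply: (deriv_within_ge0_le ab dg) => t /fg; exact: le_trans.
apply/mx_norm_leP => // i j; rewrite !mxE ler_norml.
have dfij t : a <= t <= b -> deriv_within `[a, b] (fun s => f s i j) t (f' t i j).
  by move=> /df/deriv_within_mxP.
have fgij t : a <= t <= b -> `|f' t i j| <= g' t.
  by move=> /fg; apply: le_trans; exact: mx_entry_le_norm.
apply/andP; split.
  have := @deriv_within_le a b (fun s => - f s i j) (fun s => - f' s i j) g g' ab.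
  move=> H; rewrite lerNl; have : - f b i j - - f a i j <= g b - g a.
    apply: H => // t abt; first by apply: deriv_withinN; exact: dfij.
    by have := fgij t abt; rewrite ler_norml lerNl => /andP[].
  by lra.
apply: (deriv_within_le ab dfij dg) => t abt.
by have := fgij t abt; rewrite ler_norml => /andP[].
Qed.

Lemma deriv_within_eq0 m n (a b : R) (f : R -> 'M[R]_(m, n)) : a <= b ->
  (forall t, a <= t <= b -> deriv_within `[a, b] f t 0) -> f b = f a.
Proof.
move=> ab df.
have := @deriv_within_norm_le m n a b f (fun=> 0) (fun=> 0) (fun=> 0) ab df.
move=> H; have : `|f b - f a| <= 0 - 0.
  by apply: H => [t _|t _]; [exact: deriv_within_cst|rewrite normr0].
by rewrite subrr normr_le0 subr_eq0 => /eqP.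
Qed.

(** [w] is a primitive of the forcing term. Multiplying by expR (- k (t - a)), which is at most 1,
    only diminishes the nonnegative w', so the undamped increment of [w] suffices. *)
Lemma gronwall (a b k : R) (f f' w w' : R -> R) : a <= b -> 0 <= k ->
  (forall t, a <= t <= b -> deriv_within `[a, b] f t (f' t)) ->
  (forall t, a <= t <= b -> deriv_within `[a, b] w t (w' t)) ->
  (forall t, a <= t <= b -> 0 <= w' t) ->
  (forall t, a <= t <= b -> f' t <= k * f t + w' t) ->
  f b <= expR (k * (b - a)) * (f a + (w b - w a)).
Proof.
move=> ab k0 df dw w0 fw.
have H : expR (- k * (b - a)) * f b - expR (- k * (a - a)) * f a <= w b - w a.
  apply: (@deriv_within_le a b (fun t => expR (- k * (t - a)) * f t)
    (fun t => - k * expR (- k * (t - a)) * f t + expR (- k * (t - a)) * f' t) w w' ab _ dw).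
    by move=> t abt; apply: deriv_withinM; [exact: deriv_within_expR|exact: df].
  move=> t abt; set E := expR _.
  have E1 : E <= 1.
    rewrite -expR0 ler_expR mulNr oppr_le0 mulr_ge0 // subr_ge0.
    by case/andP: abt.
  have E0 : 0 <= E by exact: expR_ge0.
  have -> : - k * E * f t + E * f' t = E * (f' t - k * f t) by ring.
  apply: (@le_trans _ _ (E * w' t)).
    by apply: ler_wpM2l => //; rewrite lerBlDl fw.
  by rewrite ler_piMl // w0.
move: H; rewrite subrr mulr0 expR0 mul1r => H.
rewrite -ler_pdivrMl ?expR_gt0 // -expRN -mulNr; lra.
Qed.

End MeanValue.

(** * Primitives of continuous functions *)

Section Primitive.
Context {R : realType}.

(** Composing with a retraction onto [D] turns continuity on [D] into continuity on the line. The
    retractions used are [Num.max c] onto a half-line and the clamp onto a segment. *)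
Lemma continuous_within_comp {V : normedModType R} (D : set R) (f : R -> V) (r : R -> R) :
  continuous r -> (forall x, D (r x)) -> {within D, continuous f} ->
  continuous (f \o r).
Proof.
move=> cr Dr /subspace_continuousP cf x A nA.
have H : \forall y \near nbhs (r x), D y -> A (f y) := cf _ (Dr x) A nA.
have H1 : \forall y \near nbhs x, D (r y) -> A (f (r y)) := cr x _ H.
by apply: filterS H1 => y H1; apply: H1; exact: Dr.
Qed.

Lemma continuous_deriv_within (a : R) (f : R -> R) : continuous f ->
  exists F, forall t, a <= t -> is_derive t 1 F (f t).
Proof.
move=> cf; pose F x := (\int[@lebesgue_measure R]_(t in `[a - 1, x]) f t)%R.
exists F => t at_.
have [] := @continuous_FTC1_closed R f (a - 1) t (t + 1) _ _ _ (cf t).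
- by rewrite ltrDl.
- apply: continuous_compact_integrable; first exact: segment_compact.
  exact: continuous_subspaceT.
- lra.
- by move=> dF F'; split; [exact: dF|rewrite -derive1E; exact: F'].
Qed.

Lemma continuous_maxr (a : R) : continuous (Num.max a).
Proof.
have -> : Num.max a = fun x => (a + x + `|a - x|) / 2.
  by apply/funext => x; rewrite maxr_absE.
move=> x; apply: cvgMr_tmp; apply: cvgD; first by apply: cvgD; [exact: cvg_cst|exact: cvg_id].
by apply: cvg_norm; apply: cvgB; [exact: cvg_cst|exact: cvg_id].
Qed.

Lemma continuous_clamp (a b : R) :
  continuous (fun x : R => Num.min b (Num.max a x)).
Proof.
have -> : (fun x => Num.min b (Num.max a x)) =
    fun x => (b + Num.max a x - `|b - Num.max a x|) / 2.
  by apply/funext => x; rewrite minr_absE.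
move=> x; apply: cvgMr_tmp; apply: cvgB.
  by apply: cvgD; [exact: cvg_cst|exact: continuous_maxr].
by apply: cvg_norm; apply: cvgB; [exact: cvg_cst|exact: continuous_maxr].
Qed.

Lemma within_itvy_primitive (c : R) (f : R -> R) :
  {within `[c, +oo[, continuous f} ->
  exists F, forall t, c <= t -> deriv_within `[c, +oo[ F t (f t).
Proof.
move=> cf; have [|F HF] := @continuous_deriv_within c (f \o Num.max c).
  apply: (continuous_within_comp _ _ cf); first exact: continuous_maxr.
  by move=> x; rewrite /= in_itv /= andbT le_max lexx.
exists F => t ct; have := HF t ct; rewrite /= max_r //.
exact: is_derive_deriv_within.
Qed.

Lemma within_itvcc_primitive (a b : R) (f : R -> R) : a <= b ->
  {within `[a, b], continuous f} ->
  exists F, forall t, a <= t <= b -> deriv_within `[a, b] F t (f t).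
Proof.
move=> ab cf.
have [|F HF] := @continuous_deriv_within a (f \o (fun x => Num.min b (Num.max a x))).
  apply: (continuous_within_comp _ _ cf); first exact: continuous_clamp.
  by move=> x; rewrite /= in_itv /= le_min ab le_max lexx /= ge_min lexx.
exists F => t /andP[at_ tb]; have := HF t at_; rewrite /= max_r // min_r //.
exact: is_derive_deriv_within.
Qed.

Lemma within_itvy_primitive_mx m n (c : R) (f : R -> 'M[R]_(m, n)) :
  {within `[c, +oo[, continuous f} ->
  exists F, forall t, c <= t -> deriv_within `[c, +oo[ F t (f t).
Proof.
move=> /subspace_continuousP cf.
have H (ij : 'I_m * 'I_n) : exists F, forall t, c <= t ->
    deriv_within `[c, +oo[ F t (f t ij.1 ij.2).
  apply: within_itvy_primitive; apply/subspace_continuousP => x cx.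
  by have /cvg_mxP := cf x cx; apply.
have [F HF] := choice H.
exists (fun t => \matrix_(i, j) F (i, j) t) => t ct.
apply/deriv_within_mxP => i j.
have -> : (fun s => (\matrix_(i, j) F (i, j) s) i j) = F (i, j).
  by apply/funext => s; rewrite mxE.
exact: HF (i, j) t ct.
Qed.

Lemma Rintegral_primitive (a b : R) (f F : R -> R) : a <= b ->
  {within `[a, b], continuous f} ->
  (forall t, a <= t <= b -> deriv_within `[a, b] F t (f t)) ->
  Rintegral lebesgue_measure `[a, b] f = F b - F a.
Proof.
rewrite le_eqVlt => /predU1P[<-|ab] cf dF.
  by rewrite set_itv1 /Rintegral integral_set1 subrr.
rewrite /Rintegral (@continuous_FTC2 R f F a b) //.
  have cF : {within `[a, b], continuous F}.
    by apply: (@deriv_within_continuous _ _ _ F f) => t /=; rewrite in_itv; exact: dF.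
  have [_ Fa Fb] := (continuous_within_itvP F ab).1 cF.
  split => // x; rewrite in_itv /= => /[dup] abx /andP[/ltW ax /ltW xb].
  have axb : a <= x <= b by rewrite ax.
  by have [] := deriv_within_is_derive abx (dF x axb).
move=> x; rewrite in_itv /= => /[dup] abx /andP[/ltW ax /ltW xb].
have axb : a <= x <= b by rewrite ax.
by rewrite derive1E; have [] := deriv_within_is_derive abx (dF x axb).
Qed.

End Primitive.

(** * Growth estimates in the maximum norm *)

Section Gronwall.
Context {R : realType}.

Lemma mx_integral_primitive m n (F G : R -> 'M[R]_(m, n)) (a b : R) :
  0 <= a <= b -> continuous_from0 F ->
  (forall t, 0 <= t -> deriv_within `[0, +oo[ G t (F t)) ->
  mx_integral F a b = G b - G a.
Proof.
move=> /andP[a0 ab] /subspace_continuousP cF dG; apply/matrixP => i j; rewrite !mxE.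
apply: (@Rintegral_primitive _ _ _ _ (fun t => G t i j)) => //.
  apply/subspace_continuousP => x; rewrite /= in_itv /= => /andP[ax xb].
  have x0 : `[0, +oo[%classic x by rewrite /= in_itv /= andbT (le_trans a0).
  have /cvg_mxP/(_ i j) := cF x x0; apply: cvg_trans; apply: cvg_app.
  apply: within_subset => y /=; rewrite !in_itv /= => /andP[ay _].
  by rewrite (le_trans a0).
move=> t /andP[at_ tb]; apply: (deriv_within_itvy_sub _ a0).
by have /deriv_within_mxP := dG t (le_trans a0 at_); apply.
Qed.

(** The norm of [f] need not be differentiable, so Gronwall's lemma is applied to [U], which is |f
    a| plus the integral of k |f| plus the increment of [w]; the mean value inequality gives |f| <=
    U. *)
Lemma norm_deriv_within_bound m n (a b k : R) (f f' : R -> 'M[R]_(m, n)) (w w' : R -> R) :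
  a <= b -> 0 <= k ->
  (forall t, a <= t <= b -> deriv_within `[a, b] f t (f' t)) ->
  (forall t, a <= t <= b -> deriv_within `[a, b] w t (w' t)) ->
  (forall t, a <= t <= b -> 0 <= w' t) ->
  (forall t, a <= t <= b -> `|f' t| <= k * `|f t| + w' t) ->
  `|f b| <= expR (k * (b - a)) * (`|f a| + (w b - w a)).
Proof.
move=> ab k0 df dw w0 fw.
have cf : {within `[a, b], continuous (fun t => `|f t|)}.
  have cf : {within `[a, b], continuous f}.
    by apply: (@deriv_within_continuous _ _ _ f f') => t; rewrite /= in_itv; exact: df.
  by move=> x; apply: cvg_norm; exact: cf.
have [N dN] := within_itvcc_primitive ab cf.
pose U t := `|f a| + (k * (N t - N a) + (w t - w a)).
have dU c d : a <= c -> d <= b -> forall t, c <= t <= d ->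
    deriv_within `[c, d] U t (k * `|f t| + w' t).
  move=> ac db t /andP[ct td].
  have atb : a <= t <= b by rewrite (le_trans ac ct) (le_trans td db).
  apply: (deriv_within_itv_sub ac db).
  rewrite -[k * _ + _]add0r; apply: deriv_withinD; first exact: deriv_within_cst.
  apply: deriv_withinD; last first.
    rewrite -[w' t]subr0; apply: deriv_withinB; [exact: dw|exact: deriv_within_cst].
  have := deriv_withinM (@deriv_within_cst _ _ `[a, b] k t)
    (deriv_withinB (dN t atb) (@deriv_within_cst _ _ `[a, b] (N a) t)).
  by rewrite mul0r add0r subr0.
have fU t : a <= t <= b -> `|f t| <= U t.
  move=> /andP[at_ tb].
  have H : `|f t - f a| <= U t - U a.
    apply: (@deriv_within_norm_le _ _ _ a t f f' U (fun t => k * `|f t| + w' t)) => //.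
    - move=> s /andP[as_ st]; apply: (deriv_within_itv_sub (lexx a) tb).
      by apply: df; rewrite as_ (le_trans st).
    - exact: dU.
    - by move=> s /andP[as_ st]; apply: fw; rewrite as_ (le_trans st).
  have : `|f t| <= `|f t - f a| + `|f a| by rewrite -{1}[f t](subrK (f a)) ler_normD.
  move: H; rewrite /U !subrr mulr0 !addr0; lra.
have -> : `|f a| = U a by rewrite /U !subrr mulr0 !addr0.
apply: le_trans (fU b _) _; first by rewrite ab lexx.
apply: (gronwall ab k0 _ dw w0) => [t abt|t abt]; first exact: (dU a b).
by rewrite lerD2r ler_wpM2l // fU.
Qed.

(** The maximum norm is not submultiplicative; the inner dimension appears as a factor here, and
    hence in most constants below. *)
Lemma norm_mulmx_le m n p (A : 'M[R]_(m, n)) (B : 'M[R]_(n, p)) :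
  `|A *m B| <= n%:R * `|A| * `|B|.
Proof.
apply/mx_norm_leP => [|i j]; first by rewrite !mulr_ge0.
rewrite mxE; apply: le_trans (ler_norm_sum _ _ _) _.
have -> : n%:R * `|A| * `|B| = \sum_(k < n) (`|A| * `|B|).
  by rewrite sumr_const card_ord -mulrA mulr_natl.
by apply: ler_sum => k _; rewrite normrM ler_pM // mx_entry_le_norm.
Qed.

Lemma norm_trmx m n (A : 'M[R]_(m, n)) : `|A^T| = `|A|.
Proof.
apply/eqP; rewrite eq_le; apply/andP; split.
  by apply/mx_norm_leP => // i j; rewrite mxE mx_entry_le_norm.
by apply/mx_norm_leP => // i j; rewrite -[A]trmxK mxE trmxK mx_entry_le_norm.
Qed.

Lemma norm_usubmx_le m1 m2 n (A : 'M[R]_(m1 + m2, n)) : `|usubmx A| <= `|A|.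
Proof. by apply/mx_norm_leP => // i j; rewrite mxE mx_entry_le_norm. Qed.

Lemma norm_dsubmx_le m1 m2 n (A : 'M[R]_(m1 + m2, n)) : `|dsubmx A| <= `|A|.
Proof. by apply/mx_norm_leP => // i j; rewrite mxE mx_entry_le_norm. Qed.

Lemma norm_col_mx m1 m2 n (A : 'M[R]_(m1, n)) (B : 'M[R]_(m2, n)) :
  `|col_mx A B| = Num.max `|A| `|B|.
Proof.
apply/eqP; rewrite eq_le; apply/andP; split.
  apply/mx_norm_leP => [|i j]; first by rewrite le_max normr_ge0.
  by rewrite mxE; case: (fintype.split i) => k; rewrite le_max mx_entry_le_norm ?orbT.
rewrite ge_max; apply/andP; split.
  by have := norm_usubmx_le (col_mx A B); rewrite col_mxKu.
by have := norm_dsubmx_le (col_mx A B); rewrite col_mxKd.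
Qed.

Lemma norm_col_mx_le m1 m2 n (A : 'M[R]_(m1, n)) (B : 'M[R]_(m2, n)) :
  `|col_mx A B| <= `|A| + `|B|.
Proof. by rewrite norm_col_mx ge_max lerDl lerDr !normr_ge0. Qed.

End Gronwall.

(** * The Euclidean scalar product against the maximum norm *)

Section Dot.
Context {R : realType}.

Definition dot {n} (u v : 'cV[R]_n) : R := (u^T *m v) 0 0.

Lemma dotE n (u v : 'cV[R]_n) : dot u v = \sum_i u i 0 * v i 0.
Proof. by rewrite /dot mxE; apply: eq_bigr => i _; rewrite mxE. Qed.

Lemma dotC n (u v : 'cV[R]_n) : dot u v = dot v u.
Proof. by rewrite !dotE; apply: eq_bigr => i _; rewrite mulrC. Qed.

Lemma dotDr n (u v w : 'cV[R]_n) : dot u (v + w) = dot u v + dot u w.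
Proof. by rewrite /dot mulmxDr mxE. Qed.

Lemma dotDl n (u v w : 'cV[R]_n) : dot (u + v) w = dot u w + dot v w.
Proof. by rewrite !(dotC _ w) dotDr. Qed.

Lemma dotNr n (u v : 'cV[R]_n) : dot u (- v) = - dot u v.
Proof. by rewrite /dot mulmxN mxE. Qed.

Lemma dotNl n (u v : 'cV[R]_n) : dot (- u) v = - dot u v.
Proof. by rewrite !(dotC _ v) dotNr. Qed.

Lemma dotZr n a (u v : 'cV[R]_n) : dot u (a *: v) = a * dot u v.
Proof. by rewrite /dot -scalemxAr mxE. Qed.

Lemma dot0r n (u : 'cV[R]_n) : dot u 0 = 0.
Proof. by rewrite /dot mulmx0 mxE. Qed.

Lemma dot_mulmx m n (A : 'M[R]_(m, n)) u v : dot u (A *m v) = dot (A^T *m u) v.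
Proof. by rewrite /dot trmx_mul trmxK mulmxA. Qed.

Lemma dot_ge0 n (u : 'cV[R]_n) : 0 <= dot u u.
Proof. by rewrite dotE sumr_ge0 // => i _; rewrite -expr2 sqr_ge0. Qed.

Lemma dot_AMGM n (u v : 'cV[R]_n) : 2 * dot u v <= dot u u + dot v v.
Proof.
have := dot_ge0 (u - v).
by rewrite dotDl !dotDr !dotNl !dotNr (dotC v u); lra.
Qed.

Lemma dotD_le n (u v : 'cV[R]_n) : dot (u + v) (u + v) <= 2 * dot u u + 2 * dot v v.
Proof.
by have := dot_AMGM u v; rewrite dotDl !dotDr (dotC v u); lra.
Qed.

Lemma dot_le n (u v : 'cV[R]_n) : `|dot u v| <= n%:R * `|u| * `|v|.
Proof.
apply: le_trans (mx_entry_le_norm (u^T *m v) 0 0) _.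
by apply: le_trans (norm_mulmx_le _ _) _; rewrite norm_trmx.
Qed.

Lemma dot_le_norm n (u : 'cV[R]_n) : dot u u <= n%:R * `|u| ^+ 2.
Proof. by apply: le_trans (ler_norm _) _; rewrite expr2 mulrA dot_le. Qed.

Lemma norm_le_dot n (u : 'cV[R]_n) : `|u| ^+ 2 <= dot u u.
Proof.
have d0 := dot_ge0 u.
rewrite -[leRHS]sqr_sqrtr // lerXn2r ?nnegrE ?sqrtr_ge0 //.
apply/mx_norm_leP => [|i j]; first exact: sqrtr_ge0.
rewrite (ord1 j) -(@ler_sqr R) ?nnegrE ?sqrtr_ge0 // sqr_sqrtr // dotE (bigD1 i) //=.
rewrite -normrX ger0_norm ?sqr_ge0 // expr2 lerDl sumr_ge0 // => k _.
by rewrite -expr2 sqr_ge0.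
Qed.

Lemma qformE n (S : 'M[R]_n) v : qform S v = dot v (S *m v).
Proof. by rewrite /qform /dot mulmxA. Qed.

Lemma qform_scalar n a (v : 'cV[R]_n) : qform a%:M v = a * dot v v.
Proof. by rewrite qformE mul_scalar_mx dotZr. Qed.

Lemma qform0 n (v : 'cV[R]_n) : qform 0 v = 0.
Proof. by rewrite qformE mul0mx dot0r. Qed.

Lemma deriv_within_dot n D (u v : R -> 'cV[R]_n) t u' v' :
  deriv_within D u t u' -> deriv_within D v t v' ->
  deriv_within D (fun s => dot (u s) (v s)) t (dot u' (v t) + dot (u t) v').
Proof.
move=> du dv; have := deriv_within_mulmx (deriv_within_trmx du) dv.
by move=> /deriv_within_mxP/(_ 0 0); rewrite mxE.
Qed.

End Dot.

(** * Ordinary differential equations *)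

Section GeometricLimits.
Context {R : realType}.

Lemma geometric_small (D e : R) : 0 < e -> exists k : nat, D / 2 ^+ k < e.
Proof.
move=> e0; exists (Num.truncn `|D / e|).+1.
have H : `|D / e| < 2 ^+ (Num.truncn `|D / e|).+1.
  apply: lt_trans (truncnS_gt _) _.
  by rewrite -natrX ltr_nat ltn_expl.
rewrite ltr_pdivrMr ?exprn_gt0 // mulrC -ltr_pdivrMr //.
exact: le_lt_trans (ler_norm _) H.
Qed.

Lemma geometric_limit_unique m n (u : nat -> 'M[R]_(m, n)) l l' (D D' : R) :
  (forall k, `|l - u k| <= D / 2 ^+ k) -> (forall k, `|l' - u k| <= D' / 2 ^+ k) ->
  l = l'.
Proof.
move=> H H'; apply/eqP; rewrite -subr_eq0 -normr_le0; apply/ler_addgt0Pr => e e0.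
have [k Hk] := geometric_small (D + D') e0.
rewrite add0r; apply: le_trans (ltW Hk).
rewrite -(subrKA (u k)) mulrDl; apply: le_trans (ler_normD _ _) _.
by rewrite lerD // distrC H'.
Qed.

(** The intervals of radius 2 B / 2^k around u k are nested; a common point is a limit that comes
    with its rate. *)
Lemma geometric_limit_scalar (u : nat -> R) (B : R) :
  (forall k, `|u k.+1 - u k| <= B / 2 ^+ k) ->
  exists l, forall k, `|l - u k| <= 2 * B / 2 ^+ k.
Proof.
move=> H.
have half k : 2 * B / 2 ^+ k.+1 = B / 2 ^+ k :> R.
  by rewrite exprS; field; rewrite expf_neq0.
have two k : 2 * B / 2 ^+ k = B / 2 ^+ k + B / 2 ^+ k :> R by ring.
pose a k := u k - 2 * B / 2 ^+ k; pose b k := u k + 2 * B / 2 ^+ k.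
have aS k : a k <= a k.+1.
  by rewrite /a half two; have := H k; rewrite ler_norml => /andP[]; lra.
have bS k : b k.+1 <= b k.
  by rewrite /b half two; have := H k; rewrite ler_norml => /andP[]; lra.
have B0 k : 0 <= B / 2 ^+ k by apply: le_trans (H k).
have ab k : a k <= b k by rewrite /a /b two; have := B0 k; lra.
have am : {homo a : i j / (i <= j)%N >-> i <= j} by apply: homo_leq => // y x z /le_trans; apply.
have bm : {homo b : i j / (i <= j)%N >-> j <= i}.
  by apply: homo_leq => // y x z xy yz; exact: le_trans yz xy.
have abij i j : a i <= b j.
  have /orP[ij|ji] := leq_total i j.
    apply: le_trans (am _ _ ij) (ab j).
  exact: le_trans (ab i) (bm _ _ ji).
have ubb j : ubound (range a) (b j) by move=> _ [i _ <-].
exists (sup (range a)) => k.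
have Hb : sup (range a) <= b k by apply: ge_sup => //; exists (a 0%N); exists 0%N.
have Ha : a k <= sup (range a).
  by apply: ub_le_sup; [exists (b 0%N)|exists k].
by move: Ha Hb; rewrite /a /b ler_norml; lra.
Qed.

Lemma geometric_limit m n (u : nat -> 'M[R]_(m, n)) (B : R) :
  (forall k, `|u k.+1 - u k| <= B / 2 ^+ k) ->
  exists l, forall k, `|l - u k| <= 2 * B / 2 ^+ k.
Proof.
move=> H.
have H1 (ij : 'I_m * 'I_n) :
    exists l, forall k, `|l - u k ij.1 ij.2| <= 2 * B / 2 ^+ k.
  apply: geometric_limit_scalar => k; apply: le_trans (H k).
  by have := mx_entry_le_norm (u k.+1 - u k) ij.1 ij.2; rewrite !mxE.
have [l Hl] := choice H1.
exists (\matrix_(i, j) l (i, j)) => k; apply/mx_norm_leP => [|i j].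
  rewrite -mulrA mulr_ge0 //; exact: le_trans (H k).
by rewrite !mxE; exact: Hl (i, j) k.
Qed.

End GeometricLimits.

(** * Global existence for globally Lipschitz fields *)

Section Picard.
Context {R : realType} {m n : nat}.

Lemma continuous_segment_norm_bound (a b : R) (g : R -> 'M[R]_(m, n)) :
  a <= b -> {within `[a, b], continuous g} ->
  exists C, forall t, a <= t <= b -> `|g t| <= C.
Proof.
move=> ab cg.
have [|c _ Hc] := @EVT_max R (fun t => `|g t|) a b ab.
  by move=> x; apply: cvg_norm; exact: cg.
by exists `|g c| => t abt; apply: Hc; rewrite in_itv.
Qed.

Theorem picard (f : R -> 'M[R]_(m, n) -> 'M[R]_(m, n)) (t0 : R) (xi0 : 'M[R]_(m, n)) :
  (forall x, {within `[t0, +oo[, continuous x} ->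
     {within `[t0, +oo[, continuous (fun t => f t (x t))}) ->
  (forall T, t0 <= T -> exists2 Lam, 0 <= Lam & forall t, t0 <= t <= T ->
     forall x y, `|f t x - f t y| <= Lam * `|x - y|) ->
  exists x, x t0 = xi0 /\ is_solution f `[t0, +oo[ x.
Proof.
move=> fc fL.
(* The Picard operator, made total by an arbitrary value on discontinuous functions so that it can
   be iterated. *)
have Hstep (x : R -> 'M[R]_(m, n)) : exists y : R -> 'M[R]_(m, n),
    {within `[t0, +oo[, continuous x} ->
    y t0 = xi0 /\ forall t, t0 <= t -> deriv_within `[t0, +oo[ y t (f t (x t)).
  have [cx|ncx] := pselect {within `[t0, +oo[, continuous x}; last by exists x.
  have [F dF] := within_itvy_primitive_mx (fc x cx).
  exists (fun t => xi0 + (F t - F t0)) => _; split; first by rewrite subrr addr0.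
  move=> t t0t; rewrite -[f t (x t)]add0r; apply: deriv_withinD.
    exact: deriv_within_cst.
  rewrite -[f t (x t)]subr0; apply: deriv_withinB; first exact: dF.
  exact: deriv_within_cst.
have [S HS] := choice Hstep.
have contS x : {within `[t0, +oo[, continuous x} -> {within `[t0, +oo[, continuous (S x)}.
  move=> /HS [_ dS]; apply: (@deriv_within_continuous _ _ _ _ (fun t => f t (x t))) => t.
  by rewrite /= in_itv /= andbT; exact: dS.
pose X k := iter k S (fun=> xi0).
have cX k : {within `[t0, +oo[, continuous (X k)}.
  elim: k => [|k IH]; last exact: contS.
  by move=> t; exact: cvg_cst.
have X0 k : X k t0 = xi0 by case: k => // k; exact: (HS _ (cX k)).1.
have dX k t : t0 <= t -> deriv_within `[t0, +oo[ (X k.+1) t (f t (X k t)).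
  exact: (HS _ (cX k)).2.
have bound T : t0 <= T -> exists B, forall k t, t0 <= t <= T ->
    `|X k.+1 t - X k t| <= B / 2 ^+ k.
  move=> t0T; have [Lam L0 HL] := fL T t0T.
  have [C HC] : exists C, forall t, t0 <= t <= T -> `|X 1%N t - X 0%N t| <= C.
    apply: continuous_segment_norm_bound => //.
    have c : {within `[t0, +oo[, continuous (X 1%N - X 0%N)}.
      by apply: within_continuousB; exact: cX.
    apply: continuous_subspaceW c => t /=; rewrite !in_itv /= => /andP[->].
    by [].
  have C0 : 0 <= C by apply: le_trans (HC T _); rewrite ?t0T ?lexx.
  (* The weight expR (2 Lam (t - t0)) makes the iteration contract by 1/2 on all of [t0, T] at once:
     integrating Lam times the weight returns at most half of the weight. Thus no short intervals
     have to be glued. *)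
  have HX k t : t0 <= t <= T ->
      `|X k.+1 t - X k t| <= C / 2 ^+ k * expR (2 * Lam * (t - t0)).
    elim: k t => [|k IH] t /andP[t0t tT].
      rewrite expr0 divr1; apply: (@le_trans _ _ C); first by apply: HC; rewrite t0t.
      rewrite ler_peMr // -expR0 ler_expR !mulr_ge0 // subr_ge0 //.
    pose g t := expR (2 * Lam * (t - t0)) * (C / 2 ^+ k.+1).
    have H : `|(X k.+2 t - X k.+1 t) - (X k.+2 t0 - X k.+1 t0)| <= g t - g t0.
      apply: (@deriv_within_norm_le _ _ _ t0 t (fun t => X k.+2 t - X k.+1 t)
        (fun t => f t (X k.+1 t) - f t (X k t)) g
        (fun t => 2 * Lam * expR (2 * Lam * (t - t0)) * (C / 2 ^+ k.+1))) => //.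
      - move=> s /andP[t0s st]; apply: (deriv_within_itvy_sub t (lexx t0)).
        by apply: deriv_withinB; exact: dX.
      - by move=> s _; apply: (@deriv_withinZ _ _ _ R^o); exact: deriv_within_expR.
      - move=> s /andP[t0s st]; have sT : t0 <= s <= T by rewrite t0s (le_trans st).
        apply: le_trans (HL s sT _ _) _.
        have -> : 2 * Lam * expR (2 * Lam * (s - t0)) * (C / 2 ^+ k.+1) =
            Lam * (C / 2 ^+ k * expR (2 * Lam * (s - t0))).
          by rewrite exprS; field; rewrite expf_neq0.
        by rewrite ler_wpM2l // IH.
    have E : X k.+2 t0 - X k.+1 t0 = 0.
      by rewrite !X0 subrr.
    rewrite E subr0 in H; apply: le_trans H _.
    by rewrite [leRHS]mulrC lerBlDr lerDl mulr_ge0 ?expR_ge0 // divr_ge0 // exprn_ge0.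
  exists (C * expR (2 * Lam * (T - t0))) => k t /andP[t0t tT].
  apply: le_trans (HX k t _) _; first by rewrite t0t.
  rewrite -mulrA -[leRHS]mulrA ler_wpM2l // mulrC ler_wpM2r ?invr_ge0 ?exprn_ge0 //.
  by rewrite ler_expR ler_wpM2l ?mulr_ge0 // lerB.
have Hx t : exists l, t0 <= t -> exists D, forall k, `|l - X k t| <= D / 2 ^+ k.
  have [t0t|_] := boolP (t0 <= t); last by exists xi0.
  have [B HB] := bound t t0t.
  have tt : t0 <= t <= t by rewrite t0t lexx.
  have [l Hl] := @geometric_limit _ _ _ (fun k => X k t) B (fun k => HB k t tt).
  by exists l => _; exists (2 * B).
have [x {}Hx] := choice Hx.
have xbound T : t0 <= T -> exists D, forall k t, t0 <= t <= T ->
    `|x t - X k t| <= D / 2 ^+ k.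
  move=> t0T; have [B HB] := bound T t0T; exists (2 * B) => k t tT.
  have [l Hl] := @geometric_limit _ _ _ (fun k => X k t) B (fun k => HB k t tT).
  have [D HD] := Hx t (proj1 (andP tT)).
  by rewrite (geometric_limit_unique HD Hl).
have cx : {within `[t0, +oo[, continuous x}.
  apply/subspace_continuousP => s; rewrite /= in_itv /= andbT => t0s.
  have [|D HD] := xbound (s + 1); first by rewrite (le_trans t0s) // lerDl.
  apply/cvgrPdist_lt => e e0.
  have [k Hk] := @geometric_small _ D (e / 3) (divr_gt0 e0 (ltr0Sn _ 2)).
  have cXk : \forall t \near nbhs s, t0 <= t -> `|X k s - X k t| < e / 3.
    have /subspace_continuousP/(_ s) := cX k; rewrite /= in_itv /= andbT => /(_ t0s).
    move=> /cvgrPdist_lt/(_ (e / 3) (divr_gt0 e0 (ltr0Sn _ 2))) H.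
    have : \forall t \near nbhs s, `[t0, +oo[%classic t -> `|X k s - X k t| < e / 3 by exact: H.
    by apply: filterS => t H1 t0t; apply: H1; rewrite /= in_itv /= andbT.
  have : \forall t \near nbhs s, `[t0, +oo[%classic t -> `|x s - x t| < e.
    have s1 : \forall t \near nbhs s, t < s + 1.
      by apply: lt_nbhsl; rewrite ltrDl.
    apply: filterS2 cXk s1 => t cXt ts1; rewrite /= in_itv /= andbT => t0t.
    have -> : x s - x t = (x s - X k s) + (X k s - X k t) - (x t - X k t).
      by apply/matrixP => i j; rewrite !mxE; ring.
    apply: le_lt_trans (ler_normB _ _) _.
    have := HD k s; have := HD k t.
    rewrite t0s t0t lerDl ler01 (ltW ts1) => /(_ isT) h1 /(_ isT) h2.
    have h3 := ler_normD (x s - X k s) (X k s - X k t).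
    have h4 := cXt t0t.
    lra.
  exact.
have [Sx0 dSx] := HS x cx.
(* Both [S x] and [x] are geometric limits of the iterates X k.+1: the first by the Lipschitz bound
   applied to x - X k, the second by construction. *)
have xS t : t0 <= t -> S x t = x t.
  move=> t0t; have [D HD] := xbound t t0t; have [Lam L0 HL] := fL t t0t.
  apply: (@geometric_limit_unique _ _ _ (fun k => X k.+1 t) _ _ (Lam * D * (t - t0)) D).
    move=> k.
    have H : `|(S x t - X k.+1 t) - (S x t0 - X k.+1 t0)| <=
        (t - t0) * (Lam * D / 2 ^+ k) - (t0 - t0) * (Lam * D / 2 ^+ k).
      apply: (@deriv_within_norm_le _ _ _ t0 t (fun t => S x t - X k.+1 t)
        (fun t => f t (x t) - f t (X k t)) (fun t => (t - t0) * (Lam * D / 2 ^+ k))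
        (fun t => (Lam * D / 2 ^+ k))) => //.
      - move=> s /andP[t0s st]; apply: (deriv_within_itvy_sub t (lexx t0)).
        by apply: deriv_withinB; [exact: dSx|exact: dX].
      - move=> s _; rewrite -[X in deriv_within _ _ _ X]mul1r.
        apply: (@deriv_withinZ _ _ _ R^o); rewrite -[X in deriv_within _ _ _ X]subr0.
        by apply: deriv_withinB; [exact: deriv_within_id|exact: deriv_within_cst].
      - move=> s /andP[t0s st]; apply: le_trans (HL s _ _ _) _; first by rewrite t0s.
        by rewrite -mulrA ler_wpM2l // HD // t0s.
    move: H; rewrite Sx0 X0 subrr subr0 subrr mul0r subr0.
    by rewrite mulrA [_ * (Lam * D)]mulrC.
  move=> k; apply: le_trans (HD k.+1 t _) _; first by rewrite t0t lexx.
  have D0 : 0 <= D / 2 ^+ k by apply: le_trans (HD k t _); rewrite ?t0t ?lexx.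
  have -> : D / 2 ^+ k.+1 = D / 2 ^+ k / 2 by rewrite exprS; field; rewrite expf_neq0.
  by rewrite ler_pdivrMr // ler_peMr //; lra.
(* [S x] is the function whose derivative is known, namely f t (x t), and [xS] replaces [x] by [S x]
   in it. *)
exists (S x); split => // t; rewrite /= in_itv /= andbT => t0t.
by rewrite xS //; exact: dSx.
Qed.

End Picard.

(** * Linear equations and transition matrices *)

Section LinearODE.
Context {R : realType}.

Lemma continuous_from0_mulmx m n p (f : R -> 'M[R]_(m, n)) (g : R -> 'M[R]_(n, p)) :
  continuous_from0 f -> continuous_from0 g -> continuous_from0 (fun t => f t *m g t).
Proof. by move=> cf cg t; apply: cvg_mulmx; [exact: cf|exact: cg]. Qed.

Lemma continuous_from0_trmx m n (f : R -> 'M[R]_(m, n)) :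
  continuous_from0 f -> continuous_from0 (fun t => (f t)^T).
Proof. by move=> cf t; apply: cvg_trmx; exact: cf. Qed.

Lemma continuous_from0N (V : normedModType R) (f : R -> V) :
  continuous_from0 f -> continuous_from0 (fun t => - f t).
Proof. by move=> cf t; apply: cvgN; exact: cf. Qed.

Lemma continuous_from0B (V : normedModType R) (f g : R -> V) :
  continuous_from0 f -> continuous_from0 g -> continuous_from0 (fun t => f t - g t).
Proof. by move=> cf cg t; apply: cvgB; [exact: cf|exact: cg]. Qed.

Lemma continuous_from0_cst (V : normedModType R) (a : V) : continuous_from0 (fun _ : R => a).
Proof. by move=> t; exact: cvg_cst. Qed.

Lemma continuous_from0_norm (V : normedModType R) (f : R -> V) :
  continuous_from0 f -> continuous_from0 (fun t => `|f t| : R).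
Proof. by move=> cf t; apply: cvg_norm; exact: cf. Qed.

Lemma continuous_from0_invmx n (f : R -> 'M[R]_n) :
  (forall t, 0 <= t -> f t \in unitmx) ->
  continuous_from0 f -> continuous_from0 (fun t => invmx (f t)).
Proof.
move=> uf /subspace_continuousP cf; apply/subspace_continuousP => t Dt.
have t0 : 0 <= t by move: Dt; rewrite /= in_itv /= andbT.
apply: cvg_invmx (cf t Dt); first exact: uf.
have : \forall s \near nbhs t, `[0, +oo[%classic s -> f s \in unitmx.
  by apply: nearW => s; rewrite /= in_itv /= andbT; exact: uf.
exact.
Qed.

Lemma deriv_within_from0 (V : normedModType R) (f f' : R -> V) :
  (forall t, 0 <= t -> deriv_within `[0, +oo[ f t (f' t)) -> continuous_from0 f.
Proof.
move=> df; apply: (@deriv_within_continuous _ _ _ f f') => t.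
by rewrite /= in_itv /= andbT; exact: df.
Qed.

Lemma continuous_from0_bound m n (g : R -> 'M[R]_(m, n)) T :
  continuous_from0 g -> exists2 C, 0 <= C & forall t, 0 <= t <= T -> `|g t| <= C.
Proof.
move=> cg; have [T0|/ltW T0] := leP T 0.
  exists `|g 0| => // t /andP[t0 tT].
  by have -> : t = 0 by apply/eqP; rewrite eq_le t0 (le_trans tT).
have [C HC] : exists C, forall t, 0 <= t <= T -> `|g t| <= C.
  apply: continuous_segment_norm_bound => //.
  by apply: continuous_subspaceW cg => t /=; rewrite !in_itv /= => /andP[->].
by exists C => //; apply: le_trans (HC T _); rewrite ?T0 ?lexx.
Qed.

Lemma norm_growth m n (a b k : R) (f f' : R -> 'M[R]_(m, n)) : a <= b -> 0 <= k ->
  (forall t, a <= t <= b -> deriv_within `[a, b] f t (f' t)) ->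
  (forall t, a <= t <= b -> `|f' t| <= k * `|f t|) ->
  `|f b| <= expR (k * (b - a)) * `|f a|.
Proof.
move=> ab k0 df fk.
have := @norm_deriv_within_bound R m n a b k f f' (fun=> 0) (fun=> 0) ab k0 df.
rewrite subrr addr0; apply => t abt //; first exact: deriv_within_cst.
by rewrite addr0 fk.
Qed.

Lemma norm_growth_le m n (a b T k : R) (f f' : R -> 'M[R]_(m, n)) :
  a <= b -> b - a <= T -> 0 <= k ->
  (forall t, a <= t <= b -> deriv_within `[a, b] f t (f' t)) ->
  (forall t, a <= t <= b -> `|f' t| <= k * `|f t|) ->
  `|f b| <= expR (k * T) * `|f a|.
Proof.
move=> ab abT k0 df fk; apply: le_trans (norm_growth ab k0 df fk) _.
by rewrite ler_wpM2r // ler_expR ler_wpM2l.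
Qed.

(** The inverse of [Y] is produced as the solution of Z' = - Z F: the product Z Y has derivative 0,
    so invertibility needs no determinant formula. *)
Lemma fundamental_matrix n (F : R -> 'M[R]_n) : continuous_from0 F ->
  exists Y Z : R -> 'M[R]_n,
  [/\ forall t, 0 <= t -> deriv_within `[0, +oo[ Y t (F t *m Y t),
      forall t, 0 <= t -> deriv_within `[0, +oo[ Z t (- (Z t *m F t)),
      Y 0 = 1%:M,
      forall t, 0 <= t -> Z t *m Y t = 1%:M &
      forall t, 0 <= t -> Y t *m Z t = 1%:M].
Proof.
move=> cF.
have FL T : 0 <= T -> exists2 C, 0 <= C & forall t, 0 <= t <= T -> `|F t| <= C.
  by move=> T0; exact: continuous_from0_bound.
have [||Y [Y0 dY]] := @picard R n n (fun t Y => F t *m Y) 0 1%:M.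
- by move=> x cx; exact: continuous_from0_mulmx.
- move=> T T0; have [C C0 HC] := FL T T0; exists (n%:R * C).
    by rewrite mulr_ge0.
  move=> t tT x y; rewrite -mulmxBr; apply: le_trans (norm_mulmx_le _ _) _.
  by rewrite ler_wpM2r // ler_wpM2l // HC.
have [||Z [Z0 dZ]] := @picard R n n (fun t Z => - (Z *m F t)) 0 1%:M.
- by move=> x cx; apply: continuous_from0N; exact: continuous_from0_mulmx.
- move=> T T0; have [C C0 HC] := FL T T0; exists (n%:R * C).
    by rewrite mulr_ge0.
  move=> t tT x y; rewrite -opprD normrN -mulmxBl; apply: le_trans (norm_mulmx_le _ _) _.
  by rewrite -!mulrA ler_wpM2l // mulrC ler_wpM2r // HC.
have {}dY t : 0 <= t -> deriv_within `[0, +oo[ Y t (F t *m Y t).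
  by move=> t0; apply: dY; rewrite /= in_itv /= andbT.
have {}dZ t : 0 <= t -> deriv_within `[0, +oo[ Z t (- (Z t *m F t)).
  by move=> t0; apply: dZ; rewrite /= in_itv /= andbT.
have ZY t : 0 <= t -> Z t *m Y t = 1%:M.
  move=> t0; have -> : 1%:M = Z 0 *m Y 0 by rewrite Z0 Y0 mulmx1.
  apply: (@deriv_within_eq0 _ _ _ 0 t (fun t => Z t *m Y t) t0) => s /andP[s0 st].
  apply: (deriv_within_itvy_sub _ (lexx 0)).
  have := deriv_within_mulmx (dZ s s0) (dY s s0).
  by rewrite mulNmx mulmxA addNr.
exists Y, Z; split => // t t0; exact/mulmx1C/ZY.
Qed.

(** Z t Phi(t, tau) is constant in t. The factorization makes Phi differentiable in its second
    argument as well, which the Gramians require. *)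
Lemma transition_matrixE n (A Y Z : R -> 'M[R]_n) Phi :
  (forall t, 0 <= t -> deriv_within `[0, +oo[ Z t (- (Z t *m A t))) ->
  (forall t, 0 <= t -> Y t *m Z t = 1%:M) ->
  transition_matrix A Phi ->
  forall t tau, 0 <= t -> 0 <= tau -> Phi t tau = Y t *m Z tau.
Proof.
move=> dZ YZ HPhi t tau t0 tau0; have [P1 dP] := HPhi tau tau0.
have cst s : 0 <= s -> Z s *m Phi s tau = Z 0 *m Phi 0 tau.
  move=> s0; apply: (@deriv_within_eq0 _ _ _ 0 s (fun t => Z t *m Phi t tau) s0).
  move=> u /andP[u0 us]; apply: (deriv_within_itvy_sub _ (lexx 0)).
  have Du : `[0, +oo[%classic u by rewrite /= in_itv /= andbT.
  have := deriv_within_mulmx (dZ u u0) (dP u Du).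
  by rewrite mulNmx mulmxA addNr.
have := cst tau tau0; rewrite P1 mulmx1 -(cst t t0) => ->.
by rewrite mulmxA YZ // mul1mx.
Qed.

Lemma norm_scalar1_le n : `|1%:M : 'M[R]_n| <= 1.
Proof. by apply/mx_norm_leP => // i j; rewrite mxE; case: (i == j); rewrite ?normr1 ?normr0. Qed.

End LinearODE.

(** * Positive quadratic forms *)

Section PositiveForms.
Context {R : realType} {n : nat}.
Implicit Types (S : 'M[R]_n) (u v : 'cV[R]_n).

Lemma dot_sym S u v : S^T = S -> dot u (S *m v) = dot v (S *m u).
Proof. by move=> HS; rewrite dot_mulmx HS dotC. Qed.

Lemma dot_eq0 u : dot u u = 0 -> u = 0.
Proof.
move=> H; apply/eqP; rewrite -normr_le0 -(@ler_sqr R) ?nnegrE // expr0n.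
by have := norm_le_dot u; rewrite H.
Qed.

Lemma dot_mulmx_le S v : dot v (S *m v) <= n%:R ^+ 2 * `|S| * dot v v.
Proof.
apply: le_trans (ler_norm _) _; apply: le_trans (dot_le _ _) _.
have -> : n%:R ^+ 2 * `|S| * dot v v = n%:R * (n%:R * `|S| * dot v v) by ring.
rewrite -mulrA ler_wpM2l //.
apply: (@le_trans _ _ (n%:R * `|S| * `|v| ^+ 2)); last first.
  by rewrite ler_wpM2l ?mulr_ge0 // norm_le_dot.
have := norm_mulmx_le S v; move=> /(ler_wpM2l (normr_ge0 v)) /le_trans; apply.
by rewrite expr2 mulrCA mulrA.
Qed.

Lemma posdef_unitmx S : posdef S -> S \in unitmx.
Proof.
move=> H; rewrite -unitmx_tr unitmxE unitfE; apply/det0P => -[v v0 vS].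
have Sv : S *m v^T = 0 by rewrite -[LHS]trmxK trmx_mul trmxK vS trmx0.
have : 0 < qform S v^T by apply: H; rewrite -(inj_eq trmx_inj) trmxK trmx0.
by rewrite qformE Sv dot0r ltxx.
Qed.

Lemma loewner_unitmx S a : 0 < a -> loewner_le a%:M S -> S \in unitmx.
Proof.
move=> a0 H; apply: posdef_unitmx => v v0; apply: lt_le_trans (H v).
rewrite qform_scalar mulr_gt0 // lt_neqAle dot_ge0 andbT eq_sym.
by apply: contraNneq v0 => /dot_eq0 ->.
Qed.

(** With z = S^-1 y one has a |z|^2 <= z . S z = z . y <= n |z| |y|. *)
Lemma loewner_inv_bound S a (y : 'cV[R]_n) : 0 < a -> loewner_le a%:M S ->
  a * `|invmx S *m y| <= n%:R * `|y|.
Proof.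
move=> a0 H; have uS := loewner_unitmx a0 H; set z := invmx S *m y.
have Sz : S *m z = y by rewrite mulmxA mulmxV // mul1mx.
have := H z; rewrite qform_scalar qformE Sz => H1.
have H2 : a * `|z| ^+ 2 <= n%:R * `|z| * `|y|.
  apply: le_trans (ler_wpM2l (ltW a0) (norm_le_dot z)) _.
  by apply: le_trans H1 _; apply: le_trans (ler_norm _) (dot_le _ _).
have [z0|z0] := eqVneq `|z| 0; first by rewrite z0 mulr0 mulr_ge0.
have zp : 0 < `|z| by rewrite lt_neqAle eq_sym z0 normr_ge0.
by rewrite -(ler_pM2r zp) -mulrA -expr2 mulrAC.
Qed.

End PositiveForms.

(** * The Riccati equation and the Kalman filter *)

Section Riccati.
Context {R : realType} {n p : nat}.
Context (A : R -> 'M[R]_n) (C : R -> 'M[R]_(p, n)) (Rt : R -> 'M[R]_p).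
Context (Qt P : R -> 'M[R]_n).
Context (cA : continuous_from0 A) (cC : continuous_from0 C) (cR : continuous_from0 Rt).
Context (Rsym : forall t : R, 0 <= t -> (Rt t)^T = Rt t).
Context (Rpos : forall t : R, 0 <= t -> posdef (Rt t)).
Context (Qpsd : forall t : R, 0 <= t -> (Qt t)^T = Qt t /\ loewner_le 0 (Qt t)).
Context (P0 : (P 0)^T = P 0 /\ loewner_le 0 (P 0)).
Context (dP : forall t : R, 0 <= t -> deriv_within `[0, +oo[ P t
  (P t *m (A t)^T + A t *m P t
   - P t *m (C t)^T *m invmx (Rt t) *m C t *m P t + Qt t)).

Let uR t : 0 <= t -> Rt t \in unitmx.
Proof. by move=> t0; exact: posdef_unitmx (Rpos t0). Qed.

Let RVsym t : 0 <= t -> (invmx (Rt t))^T = invmx (Rt t).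
Proof. by move=> t0; rewrite trmx_inv Rsym. Qed.

Let cP : continuous_from0 P.
Proof. exact: deriv_within_from0 dP. Qed.

Let cRV : continuous_from0 (fun t => invmx (Rt t)).
Proof. by apply: continuous_from0_invmx => // t; exact: uR. Qed.

(* P - P^T solves a linear equation with zero initial value. *)
Lemma riccati_sym t : 0 <= t -> (P t)^T = P t.
Proof.
move=> t0.
pose G t := (C t)^T *m invmx (Rt t) *m C t.
have GT s : 0 <= s -> (G s)^T = G s.
  by move=> s0; rewrite /G !trmx_mul trmxK RVsym // mulmxA.
have cG : continuous_from0 G.
  apply: continuous_from0_mulmx => //; apply: continuous_from0_mulmx => //.
  exact: continuous_from0_trmx.
have PGP s : P s *m (C s)^T *m invmx (Rt s) *m C s *m P s = P s *m (G s *m P s).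
  by rewrite /G !mulmxA.
clearbody G.
have [bA bA0 HA] := continuous_from0_bound t cA.
have [bG bG0 HG] := continuous_from0_bound t cG.
have [bP bP0 HP] := continuous_from0_bound t cP.
pose k := 2 * (n%:R * bA) + 2 * (n%:R * n%:R * bP * bG).
have k0 : 0 <= k by rewrite addr_ge0 // !mulr_ge0.
pose S t := P t - (P t)^T.
have E s : 0 <= s -> (P s *m (A s)^T + A s *m P s
   - P s *m (C s)^T *m invmx (Rt s) *m C s *m P s + Qt s)
  - (P s *m (A s)^T + A s *m P s
   - P s *m (C s)^T *m invmx (Rt s) *m C s *m P s + Qt s)^T =
  S s *m (A s)^T + A s *m S s - S s *m (G s *m P s) - (P s)^T *m (G s *m S s).
  move=> s0.
  have trD (U W : 'M[R]_n) : (U + W)^T = U^T + W^T by apply/matrixP => i j; rewrite !mxE.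
  have trN (U : 'M[R]_n) : (- U)^T = - U^T by apply/matrixP => i j; rewrite !mxE.
  rewrite PGP /S !trD trN !trmx_mul trmxK (GT s s0) (Qpsd s0).1.
  rewrite !(mulmxBl, mulmxBr) -!mulmxA.
  move: (P s *m (A s)^T) (A s *m P s) (A s *m (P s)^T) ((P s)^T *m (A s)^T).
  move: (P s *m (G s *m P s)) ((P s)^T *m (G s *m (P s)^T)) ((P s)^T *m (G s *m P s)).
  move=> X1 X2 X3 X4 X5 X6 X7.
  by apply/matrixP => i j; rewrite !mxE; ring.
have := @norm_growth R n n 0 t k S (fun s => (P s *m (A s)^T + A s *m P s
   - P s *m (C s)^T *m invmx (Rt s) *m C s *m P s + Qt s)
  - (P s *m (A s)^T + A s *m P s
   - P s *m (C s)^T *m invmx (Rt s) *m C s *m P s + Qt s)^T) t0 k0.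
have -> : S 0 = 0 by rewrite /S P0.1 subrr.
rewrite normr0 mulr0 => H.
suff : `|S t| <= 0 by rewrite normr_le0 subr_eq0 eq_sym => /eqP.
apply: H => s /andP[s0 st].
  apply: (deriv_within_itvy_sub _ (lexx 0)); apply: deriv_withinB; first exact: dP.
  by apply: deriv_within_trmx; exact: dP.
rewrite E //.
have hA : `|A s| <= bA by apply: HA; rewrite s0.
have hG : `|G s| <= bG by apply: HG; rewrite s0.
have hP : `|P s| <= bP by apply: HP; rewrite s0.
have mulb m1 m2 m3 (X : 'M[R]_(m1, m2)) (Y : 'M[R]_(m2, m3)) x y :
    `|X| <= x -> `|Y| <= y -> `|X *m Y| <= m2%:R * x * y.
  move=> hx hy; apply: le_trans (norm_mulmx_le X Y) _.
  by rewrite -!mulrA ler_wpM2l // ler_pM.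
have h1 := mulb _ _ _ (S s) (A s)^T _ bA (lexx _).
have h2 := mulb _ _ _ (A s) (S s) _ _ hA (lexx _).
have h3 := mulb _ _ _ (S s) _ _ _ (lexx _) (mulb _ _ _ (G s) (P s) _ _ hG hP).
have h4 := mulb _ _ _ (P s)^T _ bP _ _ (mulb _ _ _ (G s) (S s) _ _ hG (lexx _)).
rewrite norm_trmx in h1; rewrite norm_trmx in h4.
have {}h1 := h1 hA; have {}h4 := h4 hP.
have n1 := ler_normB (S s *m (A s)^T + A s *m S s - S s *m (G s *m P s)) ((P s)^T *m (G s *m S s)).
have n2 := ler_normB (S s *m (A s)^T + A s *m S s) (S s *m (G s *m P s)).
have n3 := ler_normD (S s *m (A s)^T) (A s *m S s).
rewrite /k mulrDl; nra.
Qed.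

(** The terms in A cancel for every control [w] of the dual system. This is applied with two
    controls: the feedback that yields the adjoint equation, and an open-loop control that bounds P
    from above. *)
Lemma riccati_energy_deriv D (x : R -> 'cV[R]_n) (w : 'cV[R]_p) t :
  0 <= t -> D `<=` `[0, +oo[ ->
  deriv_within D x t (- ((A t)^T *m x t) + (C t)^T *m w) ->
  let r := C t *m (P t *m x t) in
  deriv_within D (fun s => dot (x s) (P s *m x s)) t
    (dot (x t) (Qt t *m x t) + (2 * dot w r - dot r (invmx (Rt t) *m r))).
Proof.
move=> t0 D0 dx r.
have dPx := deriv_within_mulmx (deriv_within_sub D0 (dP t0)) dx.
have := deriv_within_dot dx dPx; congr (deriv_within D _ t _).
have PT := riccati_sym t0.
rewrite mulmxDl mulmxDr 2!mulmxDl !dotDr !dotDl !mulNmx !mulmxN !dotNr !dotNl.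
have e1 : dot (x t) (P t *m (A t)^T *m x t) = dot ((A t)^T *m x t) (P t *m x t).
  by rewrite -mulmxA dot_mulmx PT dotC.
have e2 : dot (x t) (A t *m P t *m x t) = dot ((A t)^T *m x t) (P t *m x t).
  by rewrite -mulmxA dot_mulmx.
have e3 : dot (x t) (P t *m ((A t)^T *m x t)) = dot ((A t)^T *m x t) (P t *m x t).
  by rewrite dot_mulmx PT dotC.
have e4 : dot ((C t)^T *m w) (P t *m x t) = dot w r by rewrite -dot_mulmx.
have e5 : dot (x t) (P t *m ((C t)^T *m w)) = dot w r.
  by rewrite dot_mulmx PT dotC e4.
have e6 : dot (x t) (P t *m (C t)^T *m invmx (Rt t) *m C t *m P t *m x t) =
    dot r (invmx (Rt t) *m r).
  by rewrite -!mulmxA -/r dot_mulmx PT dot_mulmx trmxK.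
rewrite e1 e2 e3 e4 e5 e6; ring.
Qed.

(** The gap between the two sides is the value of the form R at w - R^-1 r, whence equality for w =
    R^-1 r in the next lemma. *)
Lemma complete_square t (w r : 'cV[R]_p) : 0 <= t ->
  2 * dot w r - dot r (invmx (Rt t) *m r) <= dot w (Rt t *m w).
Proof.
move=> t0; set v := w - invmx (Rt t) *m r.
have : 0 <= dot v (Rt t *m v).
  have [->|v0] := eqVneq v 0; first by rewrite mulmx0 dot0r.
  by rewrite -qformE; apply/ltW/Rpos.
have -> : Rt t *m v = Rt t *m w - r.
  by rewrite mulmxBr mulmxA mulmxV ?uR // mul1mx.
rewrite /v dotDr !dotDl !dotNl !dotNr.
have e1 : dot (invmx (Rt t) *m r) (Rt t *m w) = dot w r.
  by rewrite dot_mulmx Rsym // mulmxA mulmxV ?uR // mul1mx dotC.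
have e2 : dot (invmx (Rt t) *m r) r = dot r (invmx (Rt t) *m r) by rewrite dotC.
rewrite e1 e2; lra.
Qed.

Lemma complete_square_eq t (r : 'cV[R]_p) : 0 <= t ->
  let w := invmx (Rt t) *m r in
  2 * dot w r - dot r (invmx (Rt t) *m r) = dot w (Rt t *m w).
Proof.
move=> t0 w; rewrite {3}/w mulmxA mulmxV ?uR // mul1mx -/w (dotC r); ring.
Qed.

(** The dual system x' = - A^T x + C^T w closed by the feedback w = R^-1 C P x, for which the square
    completed above vanishes. By symmetry of P and R it is x' = - (A - P C^T R^-1 C)^T x. *)
Definition adjoint_solution (a b : R) (x : R -> 'cV[R]_n) :=
  forall t, a <= t <= b -> deriv_within `[a, b] x t
    (- ((A t)^T *m x t) + (C t)^T *m (invmx (Rt t) *m (C t *m (P t *m x t)))).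

Lemma adjoint_energy_deriv a b x : 0 <= a -> adjoint_solution a b x ->
  forall t, a <= t <= b ->
  let w := invmx (Rt t) *m (C t *m (P t *m x t)) in
  deriv_within `[a, b] (fun s => dot (x s) (P s *m x s)) t
    (dot (x t) (Qt t *m x t) + dot w (Rt t *m w)).
Proof.
move=> a0 dx t abt w; have t0 : 0 <= t by case/andP: abt => /(le_trans a0).
rewrite -complete_square_eq //; apply: (riccati_energy_deriv _ _ (dx t abt)) => //.
move=> s /=; rewrite !in_itv /= andbT => /andP[as_ _]; exact: le_trans a0 as_.
Qed.

Let R_ge0 t (w : 'cV[R]_p) : 0 <= t -> 0 <= dot w (Rt t *m w).
Proof.
move=> t0; have [->|w0] := eqVneq w 0; first by rewrite mulmx0 dot0r.
by rewrite -qformE; apply/ltW/Rpos.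
Qed.

Let Q_ge0 t (x : 'cV[R]_n) : 0 <= t -> 0 <= dot x (Qt t *m x).
Proof. by move=> t0; have := (Qpsd t0).2 x; rewrite qform0 qformE. Qed.

Lemma adjoint_energy_mono a b x : 0 <= a -> a <= b -> adjoint_solution a b x ->
  dot (x a) (P a *m x a) <= dot (x b) (P b *m x b).
Proof.
move=> a0 ab dx; apply: (deriv_within_ge0_le ab (adjoint_energy_deriv a0 dx)) => t abt.
have t0 : 0 <= t by case/andP: abt => /(le_trans a0).
by rewrite addr_ge0 ?R_ge0 ?Q_ge0.
Qed.

(** [Z] inverts the fundamental matrix [Y] of the observation error equation. So Z^T v runs through
    the adjoint solutions while Z e is constant along errors; pairing the two gives the conservation
    of x . e. *)
Lemma closed_loop_fundamental : exists Y Z : R -> 'M[R]_n,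
  [/\ forall t : R, 0 <= t -> deriv_within `[0, +oo[ Y t
         ((A t - P t *m (C t)^T *m invmx (Rt t) *m C t) *m Y t),
      forall t : R, 0 <= t -> Y t *m Z t = 1%:M,
      forall t : R, 0 <= t -> Z t *m Y t = 1%:M,
      forall v a b, 0 <= a -> adjoint_solution a b (fun t => (Z t)^T *m v) &
      forall a b e, 0 <= a -> a <= b ->
        (forall t, a <= t <= b -> deriv_within `[a, b] e t
           ((A t - P t *m (C t)^T *m invmx (Rt t) *m C t) *m e t)) ->
        Z b *m e b = Z a *m e a :> 'cV_n].
Proof.
pose F t := A t - P t *m (C t)^T *m invmx (Rt t) *m C t.
have cF : continuous_from0 F.
  apply: continuous_from0B => //; do 3 apply: continuous_from0_mulmx => //.
  exact: continuous_from0_trmx.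
have [Y [Z [dY dZ Y0 ZY YZ]]] := fundamental_matrix cF.
exists Y, Z; split => //.
- move=> v a b a0 t /andP[at_ tb].
  have t0 := le_trans a0 at_.
  apply: (deriv_within_itvy_sub _ a0).
  have := @deriv_within_mulmxr R _ _ _ _ _ v _ _ (deriv_within_trmx (dZ t t0)).
  congr (deriv_within _ _ t _).
  rewrite linearN /= trmx_mul /F linearB /= !trmx_mul trmxK RVsym // riccati_sym //.
  by rewrite mulNmx mulmxBl mulmxBl opprB addrC -!mulmxA.
- move=> a b e a0 ab de.
  apply: (@deriv_within_eq0 _ _ _ a b (fun t => Z t *m e t) ab) => t abt.
  have t0 : 0 <= t by case/andP: abt => /(le_trans a0).
  have := deriv_within_mulmx (deriv_within_itvy_sub b a0 (dZ t t0)) (de t abt).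
  by rewrite mulNmx mulmxA addNr.
Qed.

(** The adjoint solution that reaches [v] at time [t] is followed back to time 0: x^T P x does not
    decrease along it and is nonnegative at the start. *)
Lemma riccati_ge0 t v : 0 <= t -> 0 <= dot v (P t *m v).
Proof.
move=> t0; have [Y [Z [_ YZ ZY HZ _]]] := closed_loop_fundamental.
have adj := HZ ((Y t)^T *m v) 0 t (lexx 0).
have := adjoint_energy_mono (lexx 0) t0 adj.
have -> : (Z t)^T *m ((Y t)^T *m v) = v.
  by rewrite mulmxA -trmx_mul YZ // trmx1 mul1mx.
by apply: le_trans; have := P0.2 ((Z 0)^T *m ((Y t)^T *m v)); rewrite qform0 qformE.
Qed.

End Riccati.

(** * Transition matrices, Gramians and the size of D *)

Section KalmanFilter.
Context {R : realType} {n p q : nat}.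

Lemma dot_mulmx_sq m (M : 'M[R]_(m, n)) u :
  dot (M *m u) (M *m u) <= (m%:R * n%:R ^+ 2) * `|M| ^+ 2 * dot u u.
Proof.
apply: le_trans (dot_le_norm _) _; rewrite -!mulrA ler_wpM2l //.
apply: (@le_trans _ _ ((n%:R * `|M| * `|u|) ^+ 2)).
  by rewrite lerXn2r ?nnegrE ?mulr_ge0 // norm_mulmx_le.
rewrite !exprMn -!mulrA; do 4 (apply: ler_wpM2l; first by []); exact: norm_le_dot.
Qed.

(** The trace is the sum of the squares of all entries. It is used because it is linear and so
    passes through the Gramian integral. *)
Lemma norm_le_tr m1 m2 (E : 'M[R]_(m1, m2)) : `|E| ^+ 2 <= \tr (E *m E^T).
Proof.
have trE : \tr (E *m E^T) = \sum_i \sum_j E i j ^+ 2.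
  rewrite /mxtrace; apply: eq_bigr => i _; rewrite mxE; apply: eq_bigr => j _.
  by rewrite mxE expr2.
have tr0 : 0 <= \tr (E *m E^T).
  by rewrite trE; apply: sumr_ge0 => i _; apply: sumr_ge0 => j _; exact: sqr_ge0.
rewrite -[leRHS]sqr_sqrtr // lerXn2r ?nnegrE ?sqrtr_ge0 //.
apply/mx_norm_leP => [|i j]; first exact: sqrtr_ge0.
rewrite -(@ler_sqr R) ?nnegrE ?sqrtr_ge0 // sqr_sqrtr // trE.
rewrite (bigD1 i) //= (bigD1 j) //= -normrX ger0_norm ?sqr_ge0 //.
rewrite -addrA lerDl addr_ge0 // sumr_ge0 // => [j' _|i' _]; first exact: sqr_ge0.
by apply: sumr_ge0 => j' _; exact: sqr_ge0.
Qed.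

Lemma tr_le_loewner (W : 'M[R]_n) a : loewner_le W a%:M -> \tr W <= n%:R * a.
Proof.
move=> H; rewrite mulr_natl -[X in _ *+ X]card_ord -sumr_const /mxtrace.
apply: ler_sum => i _; have := H (delta_mx i 0); rewrite qform_scalar.
have -> : dot (delta_mx i 0 : 'cV[R]_n) (delta_mx i 0) = 1.
  by rewrite /dot trmx_delta mul_delta_mx mxE !eqxx.
by rewrite /qform trmx_delta -rowE -colE !mxE mulr1.
Qed.

Lemma eq_mx_integral m1 m2 (F F' : R -> 'M[R]_(m1, m2)) a b :
  (forall t, a <= t <= b -> F t = F' t) -> mx_integral F a b = mx_integral F' a b.
Proof.
move=> H; apply/matrixP => i j; rewrite !mxE; apply: eq_Rintegral => t.
by rewrite inE /= in_itv /= => /H ->.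
Qed.

Context (A : R -> 'M[R]_n) (D : R -> 'M[R]_(n, q)) (Phi : R -> R -> 'M[R]_n).
Context (cA : continuous_from0 A) (cD : continuous_from0 D).
Context (HPhi : transition_matrix A Phi).
Context (bA : R) (HA : forall t : R, 0 <= t -> `|A t| <= bA).

Let bA0 : 0 <= bA.
Proof. by apply: le_trans (HA (lexx 0)). Qed.

Lemma transition_factor : exists Y Z : R -> 'M[R]_n,
  [/\ (forall t : R, 0 <= t -> deriv_within `[0, +oo[ Y t (A t *m Y t)) /\
      (forall t : R, 0 <= t -> deriv_within `[0, +oo[ Z t (- (Z t *m A t))),
      forall t : R, 0 <= t -> Z t *m Y t = 1%:M,
      forall t : R, 0 <= t -> Y t *m Z t = 1%:M,
      forall t s : R, 0 <= t -> 0 <= s -> Phi t s = Y t *m Z s &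
      forall T t s : R, 0 <= t -> t <= s -> s - t <= T ->
        `|Y s *m Z t| <= expR (n%:R * bA * T)].
Proof.
have [Y [Z [dY dZ Y0 ZY YZ]]] := fundamental_matrix cA.
exists Y, Z; split => //; first exact: (transition_matrixE dZ YZ HPhi).
move=> T t s t0 ts sT.
have k0 : 0 <= n%:R * bA by rewrite mulr_ge0.
have := @norm_growth_le R n n t s T (n%:R * bA) (fun s => Y s *m Z t)
  (fun s => A s *m (Y s *m Z t)) ts sT k0.
rewrite (YZ t) // => H; apply: le_trans (H _ _) _.
- move=> u /andP[tu us]; have u0 := le_trans t0 tu.
  apply: (deriv_within_itvy_sub _ t0); rewrite mulmxA.
  apply: deriv_within_mulmxr; exact: dY.
- move=> u /andP[tu us]; have u0 := le_trans t0 tu.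
  apply: le_trans (norm_mulmx_le _ _) _.
  by rewrite ler_wpM2r // ler_wpM2l // HA.
- by rewrite ler_piMr ?expR_ge0 // norm_scalar1_le.
Qed.

(** Writing the Gramian as an increment of a primitive lets its integrand be compared pointwise by
    [deriv_within_le]. *)
Lemma ctrl_gramian_primitive t s : 0 <= t -> 0 <= s ->
  exists G : R -> 'M[R]_n, [/\
    forall u : R, 0 <= u -> deriv_within `[0, +oo[ G u
      (Phi t u *m D u *m (Phi t u *m D u)^T) &
    ctrl_gramian Phi D t (t + s) = G (t + s) - G t].
Proof.
move=> t0 s0; have [Y [Z [[dY dZ] ZY YZ PhiE _]]] := transition_factor.
pose F u := Y t *m Z u *m D u *m (Y t *m Z u *m D u)^T.
have cF : continuous_from0 F.
  have c1 : continuous_from0 (fun u => Y t *m Z u *m D u).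
    apply: continuous_from0_mulmx => //; apply: continuous_from0_mulmx.
      exact: continuous_from0_cst.
    exact: deriv_within_from0 dZ.
  by apply: continuous_from0_mulmx => //; exact: continuous_from0_trmx.
have [G dG] := within_itvy_primitive_mx cF; exists G; split.
  by move=> u u0; rewrite PhiE //; exact: dG.
have ts : 0 <= t <= t + s by rewrite t0 lerDl.
rewrite -(mx_integral_primitive ts cF dG); apply: eq_mx_integral => u /andP[tu _].
by rewrite PhiE ?(le_trans t0 tu) // /F [in RHS]trmx_mul !mulmxA.
Qed.

Lemma obs_gramian_primitive (C : R -> 'M[R]_(p, n)) t s :
  continuous_from0 C -> 0 <= t -> 0 <= s ->
  exists G : R -> 'M[R]_n, [/\
    forall u : R, 0 <= u -> deriv_within `[0, +oo[ G u
      ((C u *m Phi u t)^T *m (C u *m Phi u t)) &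
    obs_gramian Phi C t (t + s) = G (t + s) - G t].
Proof.
move=> cC t0 s0; have [Y [Z [[dY dZ] ZY YZ PhiE _]]] := transition_factor.
pose F u := (C u *m (Y u *m Z t))^T *m (C u *m (Y u *m Z t)).
have cF : continuous_from0 F.
  have c1 : continuous_from0 (fun u => C u *m (Y u *m Z t)).
    apply: continuous_from0_mulmx => //; apply: continuous_from0_mulmx.
      exact: deriv_within_from0 dY.
    exact: continuous_from0_cst.
  by apply: continuous_from0_mulmx => //; exact: continuous_from0_trmx.
have [G dG] := within_itvy_primitive_mx cF; exists G; split.
  by move=> u u0; rewrite PhiE //; exact: dG.
have ts : 0 <= t <= t + s by rewrite t0 lerDl.
rewrite -(mx_integral_primitive ts cF dG); apply: eq_mx_integral => u /andP[tu _].
by rewrite PhiE ?(le_trans t0 tu) // /F [in RHS]trmx_mul !mulmxA.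
Qed.

Context (sc ac2 : R) (sc0 : 0 < sc).
Context (HW : forall t : R, 0 <= t -> loewner_le (ctrl_gramian Phi D t (t + sc)) ac2%:M).

(** Replaces a bound on D. The trace of the Gramian bounds the integral of |Phi(t, u) D(u)|^2 over a
    window, and since A is bounded, removing Phi costs only a constant. *)
Lemma noise_window_bound : exists S : R -> R,
  (forall t : R, 0 <= t -> deriv_within `[0, +oo[ S t (`|D t| ^+ 2)) /\
  forall T, exists2 s, 0 <= s & forall t u : R, 0 <= t -> t <= u -> u - t <= T ->
    S u - S t <= s.
Proof.
have [Y [Z [[dY dZ] ZY YZ PhiE HYZ]]] := transition_factor.
have cD2 : {within `[0, +oo[, continuous (fun t => `|D t| ^+ 2 : R)}.
  have cn := continuous_from0_norm cD.
  by move=> t; apply: cvgM; exact: cn.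
have [S dS] := within_itvy_primitive cD2.
exists S; split => // T.
have mono t u : 0 <= t -> t <= u -> S t <= S u.
  move=> t0 tu; apply: (@deriv_within_ge0_le _ t u S (fun t => `|D t| ^+ 2) tu).
    move=> v /andP[tv _]; apply: (deriv_within_itvy_sub _ t0); apply: dS.
    exact: le_trans t0 tv.
  by move=> v _; exact: exprn_ge0.
pose e := expR (n%:R * bA * sc).
pose s1 := (n%:R * e) ^+ 2 * (n%:R * ac2).
have win t : 0 <= t -> S (t + sc) - S t <= s1.
  move=> t0; have [G [dG GE]] := ctrl_gramian_primitive t0 (ltW sc0).
  have tsc : t <= t + sc by rewrite lerDl ltW.
  have trG : \tr (G (t + sc)) - \tr (G t) <= n%:R * ac2.
    by have := tr_le_loewner (HW t0); rewrite GE raddfB.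
  apply: le_trans (ler_wpM2l (sqr_ge0 (n%:R * e)) trG).
  have := @deriv_within_le R t (t + sc) S (fun u => `|D u| ^+ 2)
    (fun u => (n%:R * e) ^+ 2 * \tr (G u))
    (fun u => (n%:R * e) ^+ 2 * \tr (Phi t u *m D u *m (Phi t u *m D u)^T)) tsc.
  rewrite -mulrBr; apply => u /andP[tu us].
  - apply: (deriv_within_itvy_sub _ t0); apply: dS; exact: le_trans t0 tu.
  - apply: (deriv_within_itvy_sub _ t0).
    have u0 : 0 <= u := le_trans t0 tu.
    have dtr : deriv_within `[0, +oo[ (fun u => \tr (G u)) u
        (\tr (Phi t u *m D u *m (Phi t u *m D u)^T)).
      apply: deriv_within_sum => i; have := dG u u0.
      by move=> /deriv_within_mxP; apply.
    have := deriv_withinM (@deriv_within_cst _ R^o _ ((n%:R * e) ^+ 2) u) dtr.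
    by rewrite mul0r add0r.
  - have u0 : 0 <= u := le_trans t0 tu.
    set E := Phi t u *m D u.
    (* D(u) = Phi(u, t) (Phi(t, u) D(u)), where Phi(u, t) runs forward over at most one window and
       is bounded by [e]. *)
    have -> : D u = (Y u *m Z t) *m E.
      rewrite /E PhiE // !mulmxA -[Y u *m Z t *m Y t]mulmxA ZY // mulmx1.
      by rewrite YZ // mul1mx.
    apply: (@le_trans _ _ ((n%:R * e * `|E|) ^+ 2)); last first.
      by rewrite exprMn ler_wpM2l ?sqr_ge0 // norm_le_tr.
    rewrite lerXn2r ?nnegrE ?mulr_ge0 ?expR_ge0 //.
    apply: le_trans (norm_mulmx_le _ _) _.
    rewrite ler_wpM2r // ler_wpM2l // HYZ //; move: us; lra.
have s10 : 0 <= s1.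
  by apply: le_trans (win 0 (lexx 0)); rewrite subr_ge0 mono // add0r ltW.
have winN N t : 0 <= t -> S (t + N%:R * sc) - S t <= N%:R * s1.
  move=> t0; elim: N => [|N IH]; first by rewrite !mul0r addr0 subrr.
  have tN : 0 <= t + N%:R * sc by rewrite addr_ge0 // mulr_ge0 // ltW.
  have := win _ tN; rewrite -addrA -[X in _ + (_ + X)]mul1r -mulrDl -natr1.
  move: IH; rewrite [(_ + 1) * s1]mulrDl mul1r; lra.
(* An interval of length at most T is covered by floor (T / sc) + 1 controllability windows. *)
exists ((Num.truncn (T / sc)).+1%:R * s1); first by rewrite mulr_ge0.
move=> t u t0 tu uT; apply: le_trans (winN _ _ t0).
rewrite lerD2r mono ?(le_trans t0 tu) //.
have : T / sc < (Num.truncn (T / sc)).+1%:R by exact: truncnS_gt.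
rewrite ltr_pdivrMr //; lra.
Qed.

End KalmanFilter.

(** By Bernoulli's inequality. *)
Lemma expr_unbounded (R : realType) (r X : R) : 1 < r ->
  exists j0, forall j, (j0 <= j)%N -> X <= r ^+ j.
Proof.
move=> r1; have r10 : 0 < r - 1 by rewrite subr_gt0.
have bern j : 1 + j%:R * (r - 1) <= r ^+ j.
  elim: j => [|j IH]; first by rewrite mul0r addr0 expr0.
  rewrite exprS -natr1; have h : 0 <= j%:R :> R by [].
  apply: (@le_trans _ _ (r * (1 + j%:R * (r - 1)))); last first.
    by rewrite ler_wpM2l //; lra.
  have : 0 <= j%:R * (r - 1) * (r - 1) by rewrite !mulr_ge0 // ltW.
  nra.
exists (Num.truncn `|X / (r - 1)|).+1 => j hj; apply: le_trans (bern j).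
have : `|X / (r - 1)| <= j%:R.
  by apply: ltW; apply: lt_le_trans (truncnS_gt _) _; rewrite ler_nat.
move=> /(le_trans (ler_norm _)); rewrite ler_pdivrMr //; lra.
Qed.

(** * Bounds on P and contraction of the observation error *)

Section KalmanStability.
Context {R : realType} {n p q : nat}.
Context (A : R -> 'M[R]_n) (C : R -> 'M[R]_(p, n)) (Rt : R -> 'M[R]_p).
Context (Qt P : R -> 'M[R]_n) (D : R -> 'M[R]_(n, q)) (Qtilde : R -> 'M[R]_q).
Context (Phi : R -> R -> 'M[R]_n).
Context (cA : continuous_from0 A) (cC : continuous_from0 C) (cR : continuous_from0 Rt).
Context (cD : continuous_from0 D).
Context (Rsym : forall t : R, 0 <= t -> (Rt t)^T = Rt t).
Context (Rpos : forall t : R, 0 <= t -> posdef (Rt t)).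
Context (Qpsd : forall t : R, 0 <= t -> (Qt t)^T = Qt t /\ loewner_le 0 (Qt t)).
Context (P0 : (P 0)^T = P 0 /\ loewner_le 0 (P 0)).
Context (dP : forall t : R, 0 <= t -> deriv_within `[0, +oo[ P t
  (P t *m (A t)^T + A t *m P t
   - P t *m (C t)^T *m invmx (Rt t) *m C t *m P t + Qt t)).
Context (HPhi : transition_matrix A Phi).
Context (bA bC : R) (HA : forall t : R, 0 <= t -> `|A t| <= bA)
  (HC : forall t : R, 0 <= t -> `|C t| <= bC).
Context (Qfact : forall t : R, 0 <= t -> Qt t = D t *m Qtilde t *m (D t)^T).
Context (g1 g2 g3 g4 : R) (g10 : 0 < g1) (g20 : 0 < g2) (g30 : 0 < g3) (g40 : 0 < g4).
Context (HQ : forall t : R, 0 <= t -> loewner_le g1%:M (Qtilde t) /\ loewner_le (Qtilde t) g2%:M).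
Context (HR : forall t : R, 0 <= t -> loewner_le g3%:M (Rt t) /\ loewner_le (Rt t) g4%:M).
Context (HAC : unif_compl_observable Phi C) (HAD : unif_compl_controllable Phi D).

Let bA0 : 0 <= bA. Proof. by apply: le_trans (HA (lexx 0)). Qed.
Let bC0 : 0 <= bC. Proof. by apply: le_trans (HC (lexx 0)). Qed.

Let Psym := riccati_sym cA cC cR Rsym Rpos Qpsd P0 dP.
Let Pge0 := riccati_ge0 cA cC cR Rsym Rpos Qpsd P0 dP.

Lemma dot_Qt_bounds t x : 0 <= t ->
  g1 * dot ((D t)^T *m x) ((D t)^T *m x) <= dot x (Qt t *m x) <=
  g2 * dot ((D t)^T *m x) ((D t)^T *m x).
Proof.
move=> t0; rewrite Qfact // -!mulmxA [dot x _]dot_mulmx.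
have [h1 h2] := HQ t0.
have {h1} := h1 ((D t)^T *m x); have {h2} := h2 ((D t)^T *m x).
by rewrite !qform_scalar !qformE => h2 h1; rewrite h1 h2.
Qed.

Lemma dot_Rt_bounds t w : 0 <= t -> g3 * dot w w <= dot w (Rt t *m w) <= g4 * dot w w.
Proof.
move=> t0; have [h1 h2] := HR t0.
have {h1} := h1 w; have {h2} := h2 w.
by rewrite !qform_scalar !qformE => h2 h1; rewrite h1 h2.
Qed.

(* The estimate compares P with the cost of the control w steering the dual
   system x' = - A^T x + C^T w from 0 to a prescribed state in one observation
   window. *)
Lemma riccati_bounded : exists2 b, 0 < b & forall t v, 0 <= t ->
  dot v (P t *m v) <= b * dot v v.
Proof.
have [s [a1 [a2 [a3 [a4 [[s0 a10 _ _ _] HV]]]]]] := HAC.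
have [sc [c1 [c2 [c3 [c4 [[sc0 _ _ _ _] HW]]]]]] := HAD.
have HW2 t : 0 <= t -> loewner_le (ctrl_gramian Phi D t (t + sc)) c2%:M.
  by move=> t0; have [] := HW t t0.
have [S [dS HS]] := noise_window_bound cA cD HPhi HA sc0 HW2.
have [Y [Z [[dY dZ] ZY YZ PhiE HYZ]]] := transition_factor cA HPhi HA.
have [sS sS0 {}HS] := HS s.
pose e := expR (n%:R * bA * s).
have e0 : 0 < e by exact: expR_gt0.
(* Constants of the steering constructed below: |w| <= kw |z|, |x| <= kx |z| and |z| <= kz |v|,
   while b1 |z|^2 bounds the total cost over the window; D enters only through [sS]. *)
have [kw kwE] : exists r, r = n%:R * bC * (n%:R * e) by eexists.
have kw0 : 0 <= kw by rewrite kwE !mulr_ge0 // ltW.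
have [kx kxE] : exists r, r = e * (p%:R * bC * kw * s) by eexists.
have kx0 : 0 <= kx by rewrite kxE !mulr_ge0 // ltW.
have [kz kzE] : exists r, r = n%:R * (n%:R * e) / a1 by eexists.
have kz0 : 0 <= kz by rewrite kzE !mulr_ge0 ?invr_ge0 // ltW.
have [b1 b1E] : exists r, r = g2 * (q%:R * n%:R ^+ 2 * (n%:R * kx ^+ 2)) * sS + g4 * (p%:R * kw ^+ 2) * s by eexists.
have b10 : 0 <= b1.
  by rewrite b1E addr_ge0 // !mulr_ge0 ?exprn_ge0 // ltW.
have cP := deriv_within_from0 dP.
have [bP bP0 HP] := continuous_from0_bound s cP.
have nb0 : 0 <= n%:R ^+ 2 * bP by rewrite mulr_ge0 ?sqr_ge0.
have bk0 : 0 <= b1 * kz ^+ 2 by rewrite mulr_ge0 ?sqr_ge0.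
(* The first term serves t <= s, where P is bounded by continuity; the second serves t > s, where
   the window [t - s, t] is available; the 1 makes the sum positive. *)
exists (n%:R ^+ 2 * bP + b1 * kz ^+ 2 + 1) => [|t v t0].
  by rewrite ltr_wpDl // addr_ge0.
suff : dot v (P t *m v) <= n%:R ^+ 2 * bP * dot v v \/
    dot v (P t *m v) <= b1 * kz ^+ 2 * dot v v.
  have h0 := dot_ge0 v.
  have h1 : 0 <= n%:R ^+ 2 * bP * dot v v by rewrite mulr_ge0.
  have h2 : 0 <= b1 * kz ^+ 2 * dot v v by rewrite mulr_ge0.
  rewrite 2!mulrDl mul1r => -[h|h]; apply: le_trans h _.
    by rewrite -addrA lerDl addr_ge0.
  by rewrite addrAC lerDr addr_ge0.
have [ts|st] := leP t s; [left|right].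
  apply: le_trans (dot_mulmx_le _ _) _.
  by rewrite ler_wpM2r ?dot_ge0 // ler_wpM2l ?exprn_ge0 // HP // t0.
pose r := t - s.
have r0 : 0 <= r by rewrite subr_ge0 ltW.
have rt : r <= t by rewrite gerBl ltW.
have rsE : r + s = t by rewrite subrK.
have [G [dG GE]] := obs_gramian_primitive cA HPhi HA cC r0 (ltW s0).
rewrite rsE in GE.
pose Vg := G t - G r.
have HVg : loewner_le a1%:M Vg by have [+ _ _ _] := HV r r0; rewrite rsE GE.
have uV := loewner_unitmx a10 HVg.
(* Least-energy steering: w = C Phi(u, r) z, and by variation of constants x u = Phi(r, u)^T (G u -
   G r) z. The choice of [z] solves x t = v, the matrix Vg being the observability Gramian. *)
pose z := invmx Vg *m ((Y t *m Z r)^T *m v).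
pose w u := C u *m (Phi u r *m z).
pose x u := (Y r *m Z u)^T *m ((G u - G r) *m z).
have cancel u : 0 <= u -> (Y r *m Z u)^T *m (Y u *m Z r)^T = 1%:M.
  move=> u0; rewrite -trmx_mul -mulmxA [Z r *m _]mulmxA ZY // mul1mx YZ //.
  by rewrite trmx1.
have xt : x t = v.
  by rewrite /x -/Vg /z [Vg *m _]mulmxA mulmxV // mul1mx mulmxA cancel // mul1mx.
have xr : x r = 0 by rewrite /x subrr mul0mx mulmx0.
have dx u : r <= u <= t -> deriv_within `[r, t] x u
    (- ((A u)^T *m x u) + (C u)^T *m w u).
  move=> /andP[ru ut]; have u0 := le_trans r0 ru.
  have dM := @deriv_within_mulmxl R _ _ _ _ (Y r) _ _ _ (deriv_within_itvy_sub t r0 (dZ u u0)).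
  have dGz : deriv_within `[r, t] (fun u => (G u - G r) *m z) u
      ((C u *m Phi u r)^T *m (C u *m Phi u r) *m z).
    rewrite -[(C u *m Phi u r)^T *m _]subr0.
    apply: deriv_within_mulmxr; apply: deriv_withinB; last exact: deriv_within_cst.
    exact: (deriv_within_itvy_sub t r0 (dG u u0)).
  have := deriv_within_mulmx (deriv_within_trmx dM) dGz.
  congr (deriv_within _ _ u _).
  congr (_ + _).
    by rewrite /x mulmxN linearN /= mulNmx [Y r *m (_ *m _)]mulmxA [(Y r *m _ *m _)^T]trmx_mul mulmxA.
  rewrite /w PhiE // -[_ *m (C u *m _) *m z]mulmxA -[C u *m _ *m z]mulmxA.
  by rewrite [(C u *m _)^T]trmx_mul -[_ *m (C u)^T *m _]mulmxA mulmxA cancel // mul1mx.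
have hz : `|z| <= kz * `|v|.
  have := loewner_inv_bound ((Y t *m Z r)^T *m v) a10 HVg; rewrite -/z => h.
  rewrite -(ler_pM2l a10) (le_trans h) //.
  have -> : a1 * (kz * `|v|) = n%:R * (n%:R * e * `|v|).
    by rewrite kzE; field; exact: lt0r_neq0.
  rewrite ler_wpM2l //; apply: le_trans (norm_mulmx_le _ _) _.
  by rewrite norm_trmx ler_wpM2r // ler_wpM2l // HYZ // -{1}rsE addrAC subrr add0r.
have eu u : r <= u <= t -> `|Phi u r| <= e.
  move=> /andP[ru ut]; rewrite PhiE ?(le_trans r0 ru) //; apply: HYZ => //.
  by move: ut; rewrite -rsE; lra.
have hw u : r <= u <= t -> `|w u| <= kw * `|z|.
  move=> rut; have u0 : 0 <= u by case/andP: rut => /(le_trans r0).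
  apply: le_trans (norm_mulmx_le _ _) _; rewrite kwE -[leRHS]mulrA -mulrA -[leRHS]mulrA.
  rewrite ler_wpM2l // ler_pM ?HC //.
  by apply: le_trans (norm_mulmx_le _ _) _; rewrite ler_wpM2r // ler_wpM2l // eu.
have hCw u : r <= u <= t -> `|(C u)^T *m w u| <= p%:R * bC * kw * `|z|.
  move=> rut; have u0 : 0 <= u by case/andP: rut => /(le_trans r0).
  apply: le_trans (norm_mulmx_le _ _) _; rewrite norm_trmx -[leRHS]mulrA.
  by rewrite ler_pM ?mulr_ge0 ?hw // ler_wpM2l // HC.
have hx u : r <= u <= t -> `|x u| <= kx * `|z|.
  move=> /andP[ru ut].
  have k0 : 0 <= n%:R * bA by rewrite mulr_ge0.
  have := @norm_deriv_within_bound R n 1 r u (n%:R * bA) x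
    (fun u => - ((A u)^T *m x u) + (C u)^T *m w u)
    (fun u => (u - r) *: (p%:R * bC * kw * `|z|))
    (fun u => 1 *: (p%:R * bC * kw * `|z|)) ru k0.
  rewrite xr normr0 add0r subrr scale0r subr0 => H; apply: le_trans (H _ _ _ _) _.
  - move=> y /andP[ry yu]; apply: (deriv_within_itv_sub (lexx r) ut).
    by apply: dx; rewrite ry (le_trans yu).
  - move=> y _; apply: deriv_withinZ; rewrite -[X in deriv_within _ _ _ X]subr0.
    by apply: deriv_withinB; [exact: deriv_within_id|exact: deriv_within_cst].
  - by move=> y _; rewrite scale1r !mulr_ge0.
  - move=> y /andP[ry yu]; have y0 := le_trans r0 ry; have yt := le_trans yu ut.
    apply: le_trans (ler_normD _ _) _; rewrite normrN scale1r lerD //; last first.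
      by rewrite hCw // ry.
    apply: le_trans (norm_mulmx_le _ _) _.
    by rewrite norm_trmx ler_wpM2r // ler_wpM2l // HA.
  have us : u - r <= s by move: ut; rewrite -rsE; lra.
  have ur0 : 0 <= u - r by rewrite subr_ge0.
  rewrite kxE -[leRHS]mulrA ler_pM ?expR_ge0 //.
  - by rewrite mulr_ge0 // !mulr_ge0.
  - by rewrite ler_expR ler_wpM2l.
  - rewrite [p%:R * bC * kw * s]mulrC -[leRHS]mulrA; apply: ler_wpM2r => //.
    by rewrite !mulr_ge0.
have hz2 : `|z| ^+ 2 <= kz ^+ 2 * dot v v.
  apply: (@le_trans _ _ ((kz * `|v|) ^+ 2)).
    by rewrite lerXn2r ?nnegrE ?mulr_ge0.
  by rewrite exprMn ler_wpM2l ?exprn_ge0 // norm_le_dot.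
rewrite -mulrA; apply: le_trans (ler_wpM2l b10 hz2).
(* Rates of the two costs: x^T Q x is at most |D|^2 k1, and w^T R w is at most k2. *)
pose k1 := g2 * (q%:R * n%:R ^+ 2 * (n%:R * kx ^+ 2)) * `|z| ^+ 2.
pose k2 := g4 * (p%:R * kw ^+ 2) * `|z| ^+ 2.
have k10 : 0 <= k1 by rewrite !mulr_ge0 ?exprn_ge0 // ltW.
have k20 : 0 <= k2 by rewrite !mulr_ge0 ?exprn_ge0 // ltW.
have : dot (x t) (P t *m x t) - dot (x r) (P r *m x r) <=
    (S t *: k1 + (t - r) *: k2) - (S r *: k1 + (r - r) *: k2).
  apply: (@deriv_within_le _ r t (fun u => dot (x u) (P u *m x u))
    (fun u => dot (x u) (Qt u *m x u) + (2 * dot (w u) (C u *m (P u *m x u)) -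
        dot (C u *m (P u *m x u)) (invmx (Rt u) *m (C u *m (P u *m x u)))))
    (fun u => S u *: k1 + (u - r) *: k2) (fun u => `|D u| ^+ 2 *: k1 + 1 *: k2) rt).
  - move=> u rut; have u0 : 0 <= u by case/andP: rut => /(le_trans r0).
    apply: (riccati_energy_deriv cA cC cR Rsym Rpos Qpsd P0 dP u0 _ (dx u rut)).
    move=> y /=; rewrite !in_itv /= andbT => /andP[ry _]; exact: le_trans r0 ry.
  - move=> u rut; have u0 : 0 <= u by case/andP: rut => /(le_trans r0).
    apply: deriv_withinD; apply: deriv_withinZ.
      exact: (deriv_within_itvy_sub t r0 (dS u u0)).
    rewrite -[X in deriv_within _ _ _ X]subr0.
    by apply: deriv_withinB; [exact: deriv_within_id|exact: deriv_within_cst].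
  - move=> u rut; have u0 : 0 <= u by case/andP: rut => /(le_trans r0).
    rewrite scale1r lerD //.
      have /andP[_ h] := dot_Qt_bounds (x u) u0; apply: le_trans h _.
      have h := dot_mulmx_sq (D u)^T (x u); rewrite norm_trmx in h.
      have h1 : dot (x u) (x u) <= n%:R * (kx * `|z|) ^+ 2.
        apply: le_trans (dot_le_norm _) _; rewrite ler_wpM2l //.
        by rewrite lerXn2r ?nnegrE ?mulr_ge0 // hx.
      have h2 : `|D u| ^+ 2 *: k1 = g2 * (q%:R * n%:R ^+ 2 * `|D u| ^+ 2 *
          (n%:R * (kx * `|z|) ^+ 2)).
        by rewrite /k1 /GRing.scale /=; ring.
      rewrite h2 ler_wpM2l ?(ltW g20) //; apply: le_trans h _.
      by rewrite ler_wpM2l // !mulr_ge0 ?exprn_ge0.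
    apply: le_trans (complete_square Rsym Rpos _ _ u0) _.
    have /andP[_ h] := dot_Rt_bounds (w u) u0; apply: le_trans h _.
    rewrite /k2 -mulrA ler_wpM2l ?(ltW g40) //.
    apply: le_trans (dot_le_norm _) _; rewrite -mulrA ler_wpM2l // -exprMn.
    by rewrite lerXn2r ?nnegrE ?mulr_ge0 // hw.
rewrite xr mulmx0 dot0r subr0 xt subrr scale0r addr0 => h; apply: le_trans h _.
have hS : S t - S r <= sS by apply: HS => //; rewrite -rsE addrAC subrr add0r.
have trs : t - r = s by rewrite -rsE addrAC subrr add0r.
have -> : b1 * `|z| ^+ 2 = sS * k1 + s * k2 by rewrite b1E /k1 /k2; ring.
rewrite trs /GRing.scale /= addrAC -mulrBl lerD2r.
exact: ler_wpM2r.
Qed.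

(** The increase [dl] of x^T P x dominates the integrals of x^T Q x and of w^T R w. A small second
    integral keeps x close to the free solution [x0] of x' = - A^T x with the same initial value,
    the squared distance being at most K dl. Together they bound the integral of |D^T x0|^2, which
    is the controllability Gramian evaluated at x t: c1 |x t|^2 <= den dl. *)
Lemma adjoint_window : exists s k : R, [/\ 0 < s, 0 < k &
  forall t x, 0 <= t -> adjoint_solution A C Rt P t (t + s) x ->
  k * dot (x t) (x t) <=
    dot (x (t + s)) (P (t + s) *m x (t + s)) - dot (x t) (P t *m x t)].
Proof.
have [sc [c1 [c2 [c3 [c4 [[sc0 c10 _ _ _] HW]]]]]] := HAD.
have HW2 t : 0 <= t -> loewner_le (ctrl_gramian Phi D t (t + sc)) c2%:M.
  by move=> t0; have [] := HW t t0.
have [S [dS HS]] := noise_window_bound cA cD HPhi HA sc0 HW2.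
have [Y [Z [[dY dZ] ZY YZ PhiE HYZ]]] := transition_factor cA HPhi HA.
have [sS sS0 {}HS] := HS sc.
(* Gronwall constants for |x - x0|^2: the 1 comes from 2 r . C^T w <= |r|^2 + |C^T w|^2, where r = x
   - x0, and |C^T w|^2 is at most kw times w^T R w. *)
have [kr krE] : exists r, r = 2 * (n%:R ^+ 2 * bA) + 1 by eexists.
have kr0 : 0 <= kr by rewrite krE addr_ge0 // !mulr_ge0 ?sqr_ge0.
have [kw kwE] : exists r, r = n%:R * p%:R ^+ 2 * bC ^+ 2 / g3 by eexists.
have kw0 : 0 <= kw by rewrite kwE !mulr_ge0 ?sqr_ge0 ?invr_ge0 // ltW.
have [K KE] : exists r, r = expR (kr * sc) * kw by eexists.
have K0 : 0 <= K by rewrite KE mulr_ge0 ?expR_ge0.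
have [kd kdE] : exists r, r = q%:R * n%:R ^+ 2 * K by eexists.
have kd0 : 0 <= kd by rewrite kdE !mulr_ge0 ?sqr_ge0.
(* The first term comes from 2 |D^T x|^2 <= (2 / g1) x^T Q x, the second from integrating 2 |D^T (x
   - x0)|^2 <= 2 kd dl |D|^2 over the window. *)
have [den denE] : exists r, r = 2 / g1 + 2 * (kd * sS) by eexists.
have den0 : 0 < den.
  by rewrite denE ltr_wpDr ?divr_gt0 // !mulr_ge0.
exists sc, (c1 / den); split => //; first exact: divr_gt0.
move=> t x t0 dx.
pose W u := dot (x u) (P u *m x u).
pose w u := invmx (Rt u) *m (C u *m (P u *m x u)).
pose W' u := dot (x u) (Qt u *m x u) + dot (w u) (Rt u *m w u).
have tsc : t <= t + sc by rewrite lerDl ltW.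
have dW u : t <= u <= t + sc -> deriv_within `[t, t + sc] W u (W' u).
  exact: (adjoint_energy_deriv cA cC cR Rsym Rpos Qpsd P0 dP t0 dx).
have uge0 u : t <= u <= t + sc -> 0 <= u by move=> /andP[+ _]; exact: le_trans.
have Q0 u : t <= u <= t + sc -> 0 <= dot (x u) (Qt u *m x u).
  move=> tu; have /andP[+ _] := dot_Qt_bounds (x u) (uge0 u tu); apply: le_trans.
  by rewrite mulr_ge0 ?dot_ge0 // ltW.
have R0 u : t <= u <= t + sc -> 0 <= dot (w u) (Rt u *m w u).
  move=> tu; have /andP[+ _] := dot_Rt_bounds (w u) (uge0 u tu); apply: le_trans.
  by rewrite mulr_ge0 ?dot_ge0 // ltW.
have W'0 u : t <= u <= t + sc -> 0 <= W' u by move=> tu; rewrite addr_ge0 ?Q0 ?R0.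
have [dl dlE] : exists r, r = W (t + sc) - W t by eexists.
have Wle u : t <= u <= t + sc -> 0 <= W u - W t <= dl.
  move=> /[dup] tu /andP[h1 h2]; rewrite dlE lerD2r subr_ge0; apply/andP; split.
    apply: (@deriv_within_ge0_le _ t u W W' h1) => y /andP[ty yu].
      by apply: (deriv_within_itv_sub (lexx t) h2); apply: dW; rewrite ty (le_trans yu).
    by apply: W'0; rewrite ty (le_trans yu).
  apply: (@deriv_within_ge0_le _ u (t + sc) W W' h2) => y /andP[uy yt].
    by apply: (deriv_within_itv_sub h1 (lexx _)); apply: dW; rewrite yt (le_trans h1).
  by apply: W'0; rewrite yt (le_trans h1).
have dl0 : 0 <= dl by have /andP[h1 h2] := Wle t (introT andP (conj (lexx t) tsc)); exact: le_trans h2.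
rewrite -/(W (t + sc)) -/(W t) -dlE.
pose x0 u := (Y t *m Z u)^T *m x t.
pose r u := x u - x0 u.
have dx0 u : 0 <= u -> deriv_within `[t, t + sc] x0 u (- ((A u)^T *m x0 u)).
  move=> u0; have := deriv_within_itvy_sub (t + sc) t0 (dZ u u0).
  move=> /(@deriv_within_mulmxl R _ _ _ _ (Y t) _ _ _)/deriv_within_trmx.
  move=> /(@deriv_within_mulmxr R _ _ _ _ _ (x t) _ _).
  congr (deriv_within _ _ u _).
  by rewrite /x0 mulmxN linearN /= mulNmx [Y t *m (_ *m _)]mulmxA [(Y t *m _ *m _)^T]trmx_mul mulmxA.
have rt : r t = 0 by rewrite /r /x0 YZ // trmx1 mul1mx subrr.
have hr u : t <= u <= t + sc -> dot (r u) (r u) <= K * dl.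
  move=> /[dup] tu /andP[h1 h2].
  have := @gronwall R t u kr (fun u => dot (r u) (r u))
    (fun u => dot (- ((A u)^T *m r u) + (C u)^T *m w u) (r u) +
              dot (r u) (- ((A u)^T *m r u) + (C u)^T *m w u))
    (fun u => W u *: kw) (fun u => W' u *: kw) h1 kr0.
  have sub y : t <= y <= u -> t <= y <= t + sc.
    by move=> /andP[ty yu]; rewrite ty (le_trans yu h2).
  rewrite rt dot0r add0r => H; apply: le_trans (H _ _ _ _) _.
  - move=> y /sub ty; apply: (deriv_within_itv_sub (lexx t) h2).
    have dr : deriv_within `[t, t + sc] r y (- ((A y)^T *m r y) + (C y)^T *m w y).
      have := deriv_withinB (dx y ty) (dx0 y (uge0 y ty)).
      by congr (deriv_within _ _ y _); rewrite /r mulmxBr opprB opprK -/(w y) addrAC [x in _ = x + _]addrC.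
    exact: (deriv_within_dot dr dr).
  - move=> y /sub ty; apply: (deriv_within_itv_sub (lexx t) h2).
    by apply: (@deriv_withinZ _ _ _ R^o); exact: dW.
  - by move=> y /sub ty; rewrite mulr_ge0 // W'0.
  - move=> y /sub ty; have y0 := uge0 y ty.
    rewrite dotC -mulr2n -mulr_natl dotDr dotNr.
    have h3 := dot_AMGM (r y) ((C y)^T *m w y).
    have h4 : - dot (r y) ((A y)^T *m r y) <= n%:R ^+ 2 * bA * dot (r y) (r y).
      rewrite -dotNr -mulNmx; apply: le_trans (dot_mulmx_le _ _) _.
      by rewrite normrN norm_trmx ler_wpM2r ?dot_ge0 // ler_wpM2l ?sqr_ge0 // HA.
    have h5 : dot ((C y)^T *m w y) ((C y)^T *m w y) <= W' y *: kw.
      apply: le_trans (dot_mulmx_sq _ _) _; rewrite norm_trmx.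
      apply: (@le_trans _ _ (n%:R * p%:R ^+ 2 * bC ^+ 2 * dot (w y) (w y))).
        rewrite ler_wpM2r ?dot_ge0 // ler_wpM2l ?mulr_ge0 ?sqr_ge0 //.
        by rewrite lerXn2r ?nnegrE ?HC.
      have -> : W' y *: kw = n%:R * p%:R ^+ 2 * bC ^+ 2 * (W' y / g3).
        by rewrite kwE /GRing.scale /=; ring.
      rewrite ler_wpM2l ?mulr_ge0 ?sqr_ge0 // ler_pdivlMr // mulrC.
      have /andP[h _] := dot_Rt_bounds (w y) y0; apply: le_trans h _.
      by rewrite lerDr Q0.
    rewrite krE; move: h3 h4 h5.
    move: (dot (r y) (r y)) (dot (r y) _) (dot _ _) (dot (r y) _) (W' y *: kw) (n%:R ^+ 2 * bA) => X1 X2 X3 X4 X5 X6.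
    lra.
  have /andP[w1 w2] := Wle u tu.
  rewrite /GRing.scale /= -mulrBl KE -mulrA [kw * dl]mulrC.
  rewrite ler_pM ?expR_ge0 ?mulr_ge0 //.
    by rewrite ler_expR ler_wpM2l // lerBlDl.
  by rewrite ler_wpM2r.
have [G [dG GE]] := ctrl_gramian_primitive cA cD HPhi HA t0 (ltW sc0).
have HG : c1 * dot (x t) (x t) <=
    dot (x t) (G (t + sc) *m x t) - dot (x t) (G t *m x t).
  rewrite -dotNr -dotDr -mulNmx -mulmxDl -GE -qform_scalar -qformE.
  by have [+ _ _ _] := HW t t0; exact.
rewrite mulrAC ler_pdivrMr //; apply: le_trans HG _.
have HD : dot (x t) (G (t + sc) *m x t) - dot (x t) (G t *m x t) <=
   (W (t + sc) *: (2 / g1) + S (t + sc) *: (2 * (kd * dl))) -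
   (W t *: (2 / g1) + S t *: (2 * (kd * dl))).
  apply: (@deriv_within_le _ t (t + sc) (fun u => dot (x t) (G u *m x t))
    (fun u => dot (x t) (Phi t u *m D u *m (Phi t u *m D u)^T *m x t))
    (fun u => W u *: (2 / g1) + S u *: (2 * (kd * dl)))
    (fun u => W' u *: (2 / g1) + `|D u| ^+ 2 *: (2 * (kd * dl))) tsc).
  - move=> u tu; have u0 := uge0 u tu.
    have := deriv_within_dot (@deriv_within_cst _ _ `[t, t + sc] (x t) u)
      (@deriv_within_mulmxr R _ _ _ _ _ (x t) _ _ (deriv_within_itvy_sub (t + sc) t0 (dG u u0))).
    by rewrite dotC dot0r add0r.
  - move=> u tu; have u0 := uge0 u tu; apply: deriv_withinD.
      by apply: (@deriv_withinZ _ _ _ R^o); exact: dW.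
    apply: (@deriv_withinZ _ _ _ R^o).
    exact: (deriv_within_itvy_sub _ t0 (dS u u0)).
  - move=> u tu; have u0 := uge0 u tu.
    rewrite -mulmxA dot_mulmx trmx_mul -mulmxA PhiE // -/(x0 u).
    have -> : x0 u = x u - r u by rewrite /r opprB addrC subrK.
    rewrite mulmxBr -[_ - _]/(_ + - _); apply: le_trans (dotD_le _ _) _.
    rewrite dotNr dotNl opprK lerD //.
      have /andP[h _] := dot_Qt_bounds (x u) u0.
      rewrite /GRing.scale /= mulrA ler_pdivlMr // mulrC mulrA [g1 * 2]mulrC -mulrA.
      rewrite [W' u * 2]mulrC ler_wpM2l //; apply: le_trans h _.
      by rewrite lerDl R0.
    have h := dot_mulmx_sq (D u)^T (r u); rewrite norm_trmx in h.
    rewrite /GRing.scale /= mulrCA ler_wpM2l //; apply: le_trans h _.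
    have -> : `|D u| ^+ 2 * (kd * dl) = q%:R * n%:R ^+ 2 * `|D u| ^+ 2 * (K * dl).
      by rewrite kdE; ring.
    by rewrite ler_wpM2l ?mulr_ge0 ?sqr_ge0 // hr.
apply: le_trans HD _.
have hS : S (t + sc) - S t <= sS by apply: HS => //; rewrite addrAC subrr add0r.
rewrite denE dlE /GRing.scale /= in hS *.
have -> : W (t + sc) * (2 / g1) + S (t + sc) * (2 * (kd * (W (t + sc) - W t))) -
  (W t * (2 / g1) + S t * (2 * (kd * (W (t + sc) - W t)))) =
  (W (t + sc) - W t) * (2 / g1 + 2 * (kd * (S (t + sc) - S t))) by ring.
rewrite -dlE ler_wpM2l // lerD2l !ler_wpM2l //.
Qed.

(** By polarization: P is nonnegative at the sum and at the difference of two basis vectors, so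
    every entry is at most the mean of two diagonal ones. *)
Lemma riccati_norm_bounded : exists2 b, 0 <= b & forall t, 0 <= t -> `|P t| <= b.
Proof.
have [b b0 Hb] := riccati_bounded; exists b => [|t t0]; first exact: ltW.
apply/mx_norm_leP => [|i j]; first exact: ltW.
pose d k : 'cV[R]_n := delta_mx k 0.
have dd k : dot (d k) (d k) = 1.
  by rewrite /d /dot trmx_delta mul_delta_mx mxE !eqxx.
have PE k l : dot (d k) (P t *m d l) = P t k l.
  by rewrite /dot /d trmx_delta mulmxA -rowE -colE !mxE.
have hi := Hb t (d i) t0; have hj := Hb t (d j) t0.
rewrite dd mulr1 in hi; rewrite dd mulr1 in hj.
have sym := dot_sym (d i) (d j) (Psym t0).
have hp := Pge0 (d i + d j) t0; have hm := Pge0 (d i - d j) t0.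
rewrite mulmxDr !dotDl !dotDr -sym in hp.
rewrite mulmxDr mulmxN !dotDl !dotDr !dotNl !dotNr -sym in hm.
by rewrite -PE ler_norml; apply/andP; split; lra.
Qed.

Lemma kalman_contraction : exists2 s, 0 < s & forall eps, 0 < eps ->
  exists N0, forall N, (N0 <= N)%N -> forall t (e : R -> 'cV[R]_n), 0 <= t ->
    (forall u, t <= u <= t + N%:R * s -> deriv_within `[t, t + N%:R * s] e u
       ((A u - P u *m (C u)^T *m invmx (Rt u) *m C u) *m e u)) ->
    `|e (t + N%:R * s)| <= eps * `|e t|.
Proof.
have [s [k [s0 k0 Hw]]] := adjoint_window; have [b b0 Hb] := riccati_bounded.
exists s => // eps eps0.
have [Y [Z [_ YZ ZY HZ He]]] := closed_loop_fundamental cA cC cR Rsym Rpos Qpsd P0 dP.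
pose r := 1 + k / b.
have r1 : 1 < r by rewrite /r ltrDl divr_gt0.
have r0 : 0 < r by apply: lt_trans r1.
(* The first window is spent on reaching k |x t|^2, since P may be degenerate at [t]. Each further
   one gains the factor r = 1 + k / b, as P <= b turns the increase k |x|^2 into at least (k / b)
   x^T P x. *)
have chain j t x : 0 <= t -> adjoint_solution A C Rt P t (t + j.+1%:R * s) x ->
    k * r ^+ j * dot (x t) (x t) <=
    dot (x (t + j.+1%:R * s)) (P (t + j.+1%:R * s) *m x (t + j.+1%:R * s)).
  move=> t0; elim: j => [|j IH] dx.
    rewrite mul1r in dx *; rewrite expr0 mulr1; have := Hw t x t0 dx.
    by have := Pge0 (x t) t0; lra.
  pose t1 := t + j.+1%:R * s.
  have tt1 : t <= t1 by rewrite lerDl mulr_ge0 // ltW.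
  have t10 : 0 <= t1 by exact: le_trans t0 tt1.
  have E : t + j.+2%:R * s = t1 + s by rewrite -natr1 mulrDl mul1r addrA.
  rewrite E in dx *.
  have t1s : t1 <= t1 + s by rewrite lerDl ltW.
  have dx1 : adjoint_solution A C Rt P t t1 x.
    move=> u /andP[tu ut1]; apply: (deriv_within_itv_sub (lexx t) t1s).
    by apply: dx; rewrite tu (le_trans ut1).
  have dx2 : adjoint_solution A C Rt P t1 (t1 + s) x.
    move=> u /andP[tu ut1]; apply: (deriv_within_itv_sub tt1 (lexx _)).
    by apply: dx; rewrite ut1 (le_trans tt1).
  have h1 := IH dx1; rewrite -/t1 in h1.
  have h2 := Hw t1 x t10 dx2; have h3 := Hb t1 (x t1) t10.
  have h4 : r * dot (x t1) (P t1 *m x t1) <= dot (x (t1 + s)) (P (t1 + s) *m x (t1 + s)).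
    have : k / b * dot (x t1) (P t1 *m x t1) <= k * dot (x t1) (x t1).
      rewrite -mulrA ler_wpM2l ?(ltW k0) // mulrC ler_pdivrMr //.
      by rewrite mulrC.
    rewrite /r mulrDl mul1r; lra.
  apply: le_trans h4; rewrite exprS [r * _]mulrC mulrA [_ * r]mulrC -mulrA.
  by rewrite ler_wpM2l // ltW.
(* The threshold is what n |x t| <= eps |e t1| requires; the power n^3 comes from passing between
   scalar product and maximum norm. *)
have [j0 Hj0] := expr_unbounded (n%:R ^+ 3 * b / (k * eps ^+ 2)) r1.
exists j0.+1 => -[//|j] jj0 t e t0 de.
pose t1 := t + j.+1%:R * s; rewrite -/t1 in de *.
have tt1 : t <= t1 by rewrite lerDl mulr_ge0 // ltW.
have t10 : 0 <= t1 by exact: le_trans t0 tt1.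
(* The adjoint solution is chosen to end at e t1. Then |e t1|^2 = x t1 . e t1 = x t . e t in
   Euclidean terms, where x t is small compared with e t1. *)
pose v := (Y t1)^T *m e t1; pose x u := (Z u)^T *m v.
have xt1 : x t1 = e t1 by rewrite /x /v mulmxA -trmx_mul YZ // trmx1 mul1mx.
have hx : k * r ^+ j * dot (x t) (x t) <= b * dot (e t1) (e t1).
  apply: le_trans (chain j t x t0 (HZ v t _ t0)) _.
  by rewrite -/t1 xt1; exact: Hb.
have dual : dot (e t1) (e t1) = dot (x t) (e t).
  by rewrite -{1}xt1 /x -dot_mulmx (He t t1 e t0 tt1 de) dot_mulmx.
have hn : n%:R * `|x t| <= eps * `|e t1|.
  rewrite -(@ler_sqr R) ?nnegrE ?mulr_ge0 ?(ltW eps0) //.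
  have h1 : k * r ^+ j * `|x t| ^+ 2 <= b * (n%:R * `|e t1| ^+ 2).
    apply: le_trans (_ : k * r ^+ j * dot (x t) (x t) <= _).
      by rewrite ler_wpM2l ?norm_le_dot // mulr_ge0 ?exprn_ge0 // ltW.
    by apply: le_trans hx _; rewrite ler_wpM2l ?(ltW b0) // dot_le_norm.
  have h2 := Hj0 j jj0; rewrite ler_pdivrMr ?mulr_gt0 ?exprn_gt0 // in h2.
  have kr0 : 0 < k * r ^+ j by rewrite mulr_gt0 ?exprn_gt0.
  rewrite -(ler_pM2l kr0) !exprMn mulrCA.
  apply: (le_trans (ler_wpM2l (sqr_ge0 _) h1)).
  have -> : n%:R ^+ 2 * (b * (n%:R * `|e t1| ^+ 2)) = n%:R ^+ 3 * b * `|e t1| ^+ 2 by ring.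
  apply: (le_trans (ler_wpM2r (sqr_ge0 _) h2)).
  by rewrite le_eqVlt; apply/orP; left; apply/eqP; ring.
have h1 : `|e t1| ^+ 2 <= eps * `|e t1| * `|e t|.
  apply: le_trans (norm_le_dot _) _; rewrite dual.
  apply: le_trans (ler_norm _) _; apply: le_trans (dot_le _ _) _.
  by rewrite ler_wpM2r.
have [z0|z0] := eqVneq `|e t1| 0; first by rewrite z0 mulr_ge0 // ltW.
have zp : 0 < `|e t1| by rewrite lt_neqAle eq_sym z0 normr_ge0.
by rewrite -(ler_pM2l zp) -expr2 mulrCA mulrA.
Qed.

End KalmanStability.

(** * Exponential decay from windows *)

Section Decay.
Context {R : realType} {n : nat} (f : R -> 'cV[R]_n -> 'cV[R]_n).

Definition small_solution (r a b : R) (xi : R -> 'cV[R]_n) :=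
  (forall u, a <= u <= b -> deriv_within `[a, b] xi u (f u (xi u))) /\
  (forall u, a <= u <= b -> `|xi u| < r).

Lemma small_solution_sub r a b a' b' xi : a <= a' -> b' <= b ->
  small_solution r a b xi -> small_solution r a' b' xi.
Proof.
move=> aa bb [d1 d2]; split => u /andP[au ub].
  by apply: (deriv_within_itv_sub aa bb); apply: d1; rewrite (le_trans aa) // (le_trans ub).
by apply: d2; rewrite (le_trans aa) // (le_trans ub).
Qed.

(** While nu <= rho each window multiplies nu by at most 3/4, so the next window starts small again;
    the growth bound covers the incomplete window at the end. The estimate still supposes that the
    solution stays within radius [r]. *)
Lemma decay_of_window (nu : 'cV[R]_n -> R) (r k T m C : R) :
  0 <= k -> 0 < T -> 0 <= C ->
  (forall x, `|x| <= nu x <= m * `|x|) ->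
  (forall a b xi, 0 <= a -> a <= b -> small_solution r a b xi ->
     `|xi b| <= expR (k * (b - a)) * `|xi a|) ->
  (forall t xi, 0 <= t -> small_solution r t (t + T) xi ->
     nu (xi (t + T)) <= 2^-1 * nu (xi t) + C * nu (xi t) ^+ 2) ->
  exists c lambda delta : R, [/\ 1 <= c, 0 < lambda, 0 < delta &
    forall t0 t xi, 0 <= t0 -> t0 <= t -> small_solution r t0 t xi ->
      `|xi t0| < delta -> `|xi t| <= c * `|xi t0| * expR (- lambda * (t - t0))].
Proof.
move=> k0 T0 C0 Hnu Hgrow Hwin.
have nu_lo x : `|x| <= nu x by have /andP[] := Hnu x.
have nu0 x : 0 <= nu x by apply: le_trans (nu_lo x).
pose m1 := Num.max 1 m.
have m11 : 1 <= m1 by rewrite le_max lexx.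
have m10 : 0 < m1 by apply: lt_le_trans m11.
have nu_hi x : nu x <= m1 * `|x|.
  have /andP[_ h] := Hnu x; apply: le_trans h _; rewrite ler_wpM2r //.
  by rewrite le_max lexx orbT.
clearbody m1.
(* For nu <= rho the quadratic term is at most nu / 4, and 1/2 + 1/4 = 3/4. Using C + 1 instead of C
   allows C = 0. *)
pose rho := (4 * (C + 1))^-1.
have C10 : 0 < C + 1 by rewrite ltr_wpDl.
have rho0 : 0 < rho by rewrite invr_gt0 mulr_gt0.
have Crho : C * rho <= 4^-1.
  rewrite /rho ler_pdivrMr ?mulr_gt0 //; lra.
have [E EE] : exists E, E = expR (k * T) by eexists.
have E1 : 1 <= E by rewrite EE -expR0 ler_expR mulr_ge0 // ltW.
have E0 : 0 < E by apply: lt_le_trans E1.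
pose G := m1 * E.
have G1 : 1 <= G by rewrite /G mulr_ege1.
have G0 : 0 < G by apply: lt_le_trans G1.
have step j : forall t0 t xi, 0 <= t0 -> t0 + j%:R * T <= t <= t0 + j.+1%:R * T ->
    small_solution r t0 t xi -> nu (xi t0) <= rho ->
    nu (xi t) <= G * (3 / 4) ^+ j * nu (xi t0).
  elim: j => [|j IH] t0 t xi t00 /andP[h1 h2] sxi hrho.
    rewrite mul0r addr0 in h1; rewrite mul1r in h2.
    rewrite expr0 mulr1; apply: le_trans (nu_hi _) _.
    rewrite /G -mulrA ler_wpM2l ?(ltW m10) //.
    apply: le_trans (Hgrow _ _ _ t00 h1 sxi) _.
    rewrite EE ler_pM ?expR_ge0 // ler_expR ler_wpM2l //.
    by rewrite lerBlDl.
  pose t1 := t0 + T.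
  have t01 : t0 <= t1 by rewrite lerDl ltW.
  have t1t : t1 <= t.
    apply: le_trans h1; rewrite lerD2l ler_peMl ?(ltW T0) // ler1n //.
  have t10 : 0 <= t1 by exact: le_trans t01.
  have w := Hwin t0 xi t00 (small_solution_sub (lexx _) t1t sxi); rewrite -/t1 in w.
  have w2 : nu (xi t1) <= 3 / 4 * nu (xi t0).
    have : C * nu (xi t0) ^+ 2 <= 4^-1 * nu (xi t0).
      rewrite expr2 mulrA ler_wpM2r //; apply: le_trans Crho.
      by rewrite ler_wpM2l.
    lra.
  have := IH t1 t xi t10 _ (small_solution_sub t01 (lexx _) sxi) _.
  move=> H; apply: le_trans (H _ _) _.
  - by move: h1 h2; rewrite /t1 -!natr1 !mulrDl !mul1r => h1 h2; apply/andP; split; lra.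
  - by apply: le_trans w2 _; have := nu0 (xi t0); lra.
  - have -> : G * (3 / 4) ^+ j.+1 * nu (xi t0) = G * (3 / 4) ^+ j * (3 / 4 * nu (xi t0)).
      by rewrite exprSr; ring.
    by rewrite ler_wpM2l // mulr_ge0 ?exprn_ge0 // ltW.
(* The rate for which one window of length T has decay factor exactly 3/4. *)
pose lam := ln (4 / 3) / T.
have lam0 : 0 < lam by rewrite divr_gt0 // ln_gt0 //; lra.
have elam : expR (- (lam * T)) = 3 / 4.
  have p43 : (4 / 3 : R) \is Num.pos by rewrite posrE; lra.
  by rewrite /lam divfK ?gt_eqF // expRN lnK // invf_div.
exists (G * (4 / 3) * m1), lam, (rho / m1); split => //.
- by rewrite mulr_ege1 // mulr_ege1 //; lra.
- exact: divr_gt0.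
move=> t0 t xi t00 t0t sxi; rewrite ltr_pdivlMr // => hd.
pose j := Num.truncn ((t - t0) / T).
have /andP[j1 j2] : j%:R <= (t - t0) / T < j.+1%:R.
  by apply: truncn_itv; rewrite divr_ge0 ?subr_ge0 // ltW.
rewrite ler_pdivlMr // in j1; rewrite ltr_pdivrMr // in j2.
have hrho : nu (xi t0) <= rho by apply: le_trans (nu_hi _) _; rewrite mulrC ltW.
have tj : t0 + j%:R * T <= t <= t0 + j.+1%:R * T by apply/andP; split; lra.
apply: le_trans (nu_lo _) _; apply: le_trans (step j t0 t xi t00 tj sxi hrho) _.
(* Only (j + 1) T exceeds t - t0, so one factor 3/4 too many is spent and 4/3 compensates for it. *)
have ej : (3 / 4) ^+ j <= 4 / 3 * expR (- lam * (t - t0)).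
  have -> : (3 / 4 : R) ^+ j = 4 / 3 * expR (- (lam * T)) ^+ j.+1.
    by rewrite elam exprS mulrA; have -> : 4 / 3 * (3 / 4) = 1 :> R; [field|rewrite mul1r].
  rewrite -expRM_natl ler_wpM2l // ler_expR mulNr mulrN lerN2 mulrCA.
  by rewrite ler_wpM2l // ltW.
have -> : G * (4 / 3) * m1 * `|xi t0| * expR (- lam * (t - t0)) =
  G * (4 / 3 * expR (- lam * (t - t0))) * (m1 * `|xi t0|) by ring.
rewrite ler_pM //.
- by rewrite mulr_ge0 ?exprn_ge0 // ltW.
- by rewrite ler_wpM2l // ltW.
Qed.

(** Continuity method. At the supremum [tau] of the times up to which y < r, the improved bound r /
    2 just before [tau] gives y tau < r, and continuity then carries the inequality past [tau]
    unless the interval has ended. *)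
Lemma bootstrap (a b r : R) (y : R -> R) : 0 < r ->
  {within `[a, b], continuous y} -> y a < r ->
  (forall t, a <= t <= b -> (forall s, a <= s <= t -> y s < r) -> y t <= r / 2) ->
  forall t, a <= t <= b -> y t < r.
Proof.
move=> r0 /subspace_continuousP cy ya H t /andP[at_ tb].
have cyt s e : a <= s <= b -> 0 < e -> exists2 d, 0 < d & forall u, a <= u <= b ->
    `|s - u| < d -> `|y s - y u| < e.
  move=> sab e0; have Ds : `[a, b]%classic s by rewrite /= in_itv.
  have /cvgrPdist_lt/(_ e e0) := cy s Ds.
  have -> : (\forall u \near within `[a, b] (nbhs s), `|y s - y u| < e) =
    (\forall u \near nbhs s, `[a, b]%classic u -> `|y s - y u| < e) by [].
  move=> /nbhs_ballP[d /= d0 Hd]; exists d => // u uab su.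
  by apply: Hd; rewrite // /= in_itv.
pose S := [set u | a <= u <= b /\ forall s, a <= s <= u -> y s < r].
have ab : a <= b := le_trans at_ tb.
have Sa : S a.
  split; first by rewrite lexx ab.
  by move=> s /andP[h1 h2]; have -> : s = a by apply/eqP; rewrite eq_le h2 h1.
have Sub : has_sup S by split; [exists a|exists b => u [/andP[]]].
pose tau := sup S.
have atau : a <= tau by apply: ub_le_sup; [exact: Sub.2|].
have taub : tau <= b by apply: ge_sup; [exact: Sub.1|move=> u [/andP[]]].
have tauab : a <= tau <= b by rewrite atau.
have below s : a <= s -> s < tau -> y s < r.
  move=> as_ stau; have st0 : 0 < tau - s by rewrite subr_gt0.
  have [u [_ Hu] su] := sup_adherent st0 Sub.
  by apply: Hu; rewrite as_ /=; apply: ltW; move: su; rewrite -/tau subKr.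
have ytau : y tau < r.
  have [->//|atau'] := eqVneq tau a.
  have {}atau' : a < tau by rewrite lt_neqAle eq_sym atau' atau.
  have [d d0 Hd] := cyt tau (r / 2) tauab (divr_gt0 r0 (ltr0Sn _ 1)).
  pose u := Num.max a (tau - d / 2).
  have ua : a <= u by rewrite le_max lexx.
  have ut : u < tau by rewrite gt_max atau' ltrBlDr ltrDl divr_gt0.
  have uab : a <= u <= b by rewrite ua (le_trans (ltW ut)).
  have yu : y u <= r / 2.
    apply: H => // s /andP[h1 h2]; apply: below => //; exact: le_lt_trans ut.
  have dtu : `|tau - u| < d.
    rewrite gtr0_norm ?subr_gt0 //.
    have : tau - d / 2 <= u by rewrite le_max lexx orbT.
    lra.
  have := Hd u uab dtu; rewrite ltr_norml => /andP[]; lra.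
have Stau : S tau.
  by split => // s /andP[h1]; rewrite le_eqVlt => /predU1P[->//|]; exact: below.
apply: Stau.2; rewrite at_ /= leNgt; apply/negP => taut.
have ry0 : 0 < r - y tau by rewrite subr_gt0.
have [d d0 Hd] := cyt tau (r - y tau) tauab ry0.
pose u := Num.min t (tau + d / 2).
have tu : tau < u by rewrite lt_min taut ltrDl divr_gt0.
have ut : u <= t by rewrite ge_min lexx.
have ud : u <= tau + d / 2 by rewrite ge_min lexx orbT.
have ub : u <= b := le_trans ut tb.
suff Su : S u.
  have : u <= tau by apply: ub_le_sup; [exact: Sub.2|].
  by rewrite leNgt tu.
split; first by rewrite (le_trans atau (ltW tu)).
move=> s /andP[h1 h2]; have [st|ts] := leP s tau; first by apply: Stau.2; rewrite h1.
have sab : a <= s <= b by rewrite h1 (le_trans h2).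
have dst : `|tau - s| < d by rewrite ltr0_norm ?subr_lt0 // opprB; lra.
by have := Hd s sab dst; rewrite ltr_norml => /andP[]; lra.
Qed.

End Decay.

(** * One window of the perturbed block-triangular system *)

Section Cascade.
Context {R : realType} {n : nat}.

(** Stability only speaks of small initial values; rescaling by linearity removes the
    restriction. *)
Lemma exponentially_stable_linear (H : R -> 'M[R]_n) :
  exponentially_stable (fun t (z : 'cV[R]_n) => H t *m z) ->
  exists c lambda : R, [/\ 0 < c, 0 < lambda &
    forall t0 z0, 0 <= t0 -> exists z : R -> 'cV[R]_n,
      [/\ z t0 = z0,
          forall t, t0 <= t -> deriv_within `[t0, +oo[ z t (H t *m z t) &
          forall t, t0 <= t -> `|z t| <= c * expR (- lambda * (t - t0)) * `|z0|]].
Proof.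
move=> [_ [c [lam [dl [[c0 lam0 dl0] Hs]]]]]; exists c, lam; split => // t0 z0 t00.
have [->|z00] := eqVneq z0 0.
  exists (fun=> 0); split => // [t tt0|t _].
    by rewrite mulmx0; exact: deriv_within_cst.
  by rewrite normr0 mulr_ge0 // mulr_ge0 ?expR_ge0 // ltW.
have nz0 : 0 < `|z0| by rewrite normr_gt0.
pose k := dl / (2 * `|z0|).
have k0 : 0 < k by rewrite divr_gt0 // mulr_gt0.
have kz : `|k *: z0| < dl.
  rewrite normrZ gtr0_norm // /k invfM -mulrA divfK ?gt_eqF //.
  by rewrite ltr_pdivrMr // ltr_pMr // ltr1n.
have [[z [zt0 dz]] Hz] := Hs t0 (k *: z0) t00 kz.
exists (fun t => k^-1 *: z t); split.
- by rewrite zt0 scalerA mulVf ?gt_eqF // scale1r.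
- move=> t tt0; have Dt : `[t0, +oo[%classic t by rewrite /= in_itv /= andbT.
  rewrite -scalemxAr; have dzt := dz t Dt.
  have := @deriv_within_mulmxl R _ _ _ _ (k^-1)%:M _ _ _ dzt.
  rewrite mul_scalar_mx; congr (deriv_within _ _ t _).
  by apply/funext => s; rewrite mul_scalar_mx.
- move=> t tt0; rewrite normrZ gtr0_norm ?invr_gt0 // ler_pdivrMl //.
  have solz : is_solution (fun t (z : 'cV[R]_n) => H t *m z) `[t0, t + 1[ z.
    move=> s /=; rewrite in_itv /= => /andP[t0s _].
    apply: deriv_within_sub (dz s _); last by rewrite /= in_itv /= andbT.
    by move=> y /=; rewrite !in_itv /= => /andP[->].
  apply: le_trans (Hz (t + 1) z zt0 solz t _) _; first by rewrite tt0 ltrDl ltr01.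
  by rewrite normrZ gtr0_norm // le_eqVlt; apply/orP; left; apply/eqP; ring.
Qed.

Lemma linear_solution (F : R -> 'M[R]_n) t0 (z0 : 'cV[R]_n) :
  continuous_from0 F -> 0 <= t0 ->
  exists z : R -> 'cV[R]_n, z t0 = z0 /\
    forall t, t0 <= t -> deriv_within `[t0, +oo[ z t (F t *m z t).
Proof.
move=> cF t00; have [Y [Z [dY _ _ _ YZ]]] := fundamental_matrix cF.
exists (fun t => Y t *m (Z t0 *m z0)); split; first by rewrite mulmxA YZ // mul1mx.
move=> t tt0; rewrite mulmxA; apply: deriv_within_mulmxr.
apply: deriv_within_sub (dY t (le_trans t00 tt0)) => s /=.
by rewrite !in_itv /= !andbT; exact: le_trans.
Qed.

(** v - z starts at 0 and satisfies the linear equation up to a defect of size [w], which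
    accumulates to T w before exponential amplification. *)
Lemma forced_linear_bound (F : R -> 'M[R]_n) (v v' z : R -> 'cV[R]_n) t T h w :
  0 <= t -> 0 <= T -> 0 <= h -> 0 <= w ->
  (forall u, t <= u <= t + T -> `|F u| <= h) ->
  (forall u, t <= u <= t + T -> deriv_within `[t, t + T] v u (v' u)) ->
  (forall u, t <= u <= t + T -> `|v' u - F u *m v u| <= w) ->
  z t = v t ->
  (forall u, t <= u -> deriv_within `[t, +oo[ z u (F u *m z u)) ->
  `|v (t + T) - z (t + T)| <= expR (n%:R * h * T) * (T * w).
Proof.
move=> t0 T0 h0 w0 HF dv Hv zt dz.
have tT : t <= t + T by rewrite lerDl.
have k0 : 0 <= n%:R * h by rewrite mulr_ge0.
have := @norm_deriv_within_bound R n 1 t (t + T) (n%:R * h) (fun u => v u - z u)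
  (fun u => v' u - F u *m z u) (fun u => (u - t) *: (w : R^o))
  (fun u => 1 *: (w : R^o)) tT k0.
rewrite zt !subrr normr0 add0r scale0r subr0 [t + T - t]addrAC subrr add0r.
apply => u tu.
- apply: deriv_withinB; first exact: dv.
  by have /andP[h1 _] := tu; exact: (deriv_within_itvy_sub _ (lexx t) (dz u h1)).
- apply: deriv_withinZ; rewrite -[X in deriv_within _ _ _ X]subr0.
  by apply: deriv_withinB; [exact: deriv_within_id|exact: deriv_within_cst].
- by rewrite scale1r.
- have -> : v' u - F u *m z u = F u *m (v u - z u) + (v' u - F u *m v u).
    by rewrite mulmxBr [RHS]addrC subrKA.
  rewrite scale1r; apply: le_trans (ler_normD _ _) _; rewrite lerD ?Hv //.
  by apply: le_trans (norm_mulmx_le _ _) _; rewrite ler_wpM2r // ler_wpM2l // HF.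
Qed.

Context (H B F : R -> 'M[R]_n) (f : R -> 'cV[R]_(n + n) -> 'cV[R]_(n + n)).
Context (h c r T C4 : R) (h0 : 0 <= h) (c0 : 0 < c) (r0 : 0 < r) (T0 : 0 < T).
Context (hH : forall t : R, 0 <= t -> `|H t| <= h)
        (hB : forall t : R, 0 <= t -> `|B t| <= h)
        (hF : forall t : R, 0 <= t -> `|F t| <= h).
Context (f_lin : forall t xi, 0 <= t -> `|xi| < r ->
  `|f t xi - block_mx (H t) (B t) 0 (F t) *m xi|
    <= c * (`|usubmx xi| ^+ 2 + `|dsubmx xi| ^+ 2)).
Context (Hcontr : forall t z0, 0 <= t -> exists z : R -> 'cV[R]_n,
  [/\ z t = z0, forall u, t <= u -> deriv_within `[t, +oo[ z u (H u *m z u) &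
      `|z (t + T)| <= 4^-1 * `|z0|]).
Context (Fcontr : forall t z0, 0 <= t -> exists z : R -> 'cV[R]_n,
  [/\ z t = z0, forall u, t <= u -> deriv_within `[t, +oo[ z u (F u *m z u) &
      `|z (t + T)| <= 4^-1 * `|z0|]).

(** Growth rate inside the ball of radius r: the block matrix contributes the first term, and the
    remainder the second because 2 c |xi|^2 <= 2 c r |xi|. *)
Let k : R := (n + n)%:R * h + 2 * c * r.
Let k0 : 0 <= k.
Proof. by rewrite addr_ge0 ?mulr_ge0 // ltW. Qed.

Let sol a b xi := (forall u, a <= u <= b -> deriv_within `[a, b] xi u (f u (xi u))) /\
  (forall u, a <= u <= b -> `|xi u| < r).

Let sol_sub a b a' b' xi : a <= a' -> b' <= b -> sol a b xi -> sol a' b' xi.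
Proof.
move=> aa bb [d1 d2]; split => u /andP[au ub].
  by apply: (deriv_within_itv_sub aa bb); apply: d1; rewrite (le_trans aa) // (le_trans ub).
by apply: d2; rewrite (le_trans aa) // (le_trans ub).
Qed.

Lemma norm_usub_dsub (xi : 'cV[R]_(n + n)) :
  `|usubmx xi| ^+ 2 + `|dsubmx xi| ^+ 2 <= 2 * `|xi| ^+ 2.
Proof.
have h1 : `|usubmx xi| ^+ 2 <= `|xi| ^+ 2.
  by rewrite lerXn2r ?nnegrE ?norm_usubmx_le.
have h2 : `|dsubmx xi| ^+ 2 <= `|xi| ^+ 2.
  by rewrite lerXn2r ?nnegrE ?norm_dsubmx_le.
lra.
Qed.

Lemma cascade_growth a b xi : 0 <= a -> a <= b -> sol a b xi ->
  `|xi b| <= expR (k * (b - a)) * `|xi a|.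
Proof.
move=> a0 ab [dxi rxi]; apply: (norm_growth ab k0 dxi) => u au.
have u0 : 0 <= u by case/andP: au => /(le_trans a0).
have h1 := f_lin u0 (rxi u au).
have h2 : `|block_mx (H u) (B u) 0 (F u) *m xi u| <= (n + n)%:R * h * `|xi u|.
  apply: le_trans (norm_mulmx_le _ _) _; rewrite ler_wpM2r // ler_wpM2l //.
  apply/mx_norm_leP => // i j; rewrite !mxE.
  case: (fintype.split i) => i'; rewrite mxE; case: (fintype.split j) => j'.
  - by apply: le_trans (mx_entry_le_norm _ _ _) (hH u0).
  - by apply: le_trans (mx_entry_le_norm _ _ _) (hB u0).
  - by rewrite mxE normr0.
  - by apply: le_trans (mx_entry_le_norm _ _ _) (hF u0).
have h3 : c * (`|usubmx (xi u)| ^+ 2 + `|dsubmx (xi u)| ^+ 2) <= 2 * c * r * `|xi u|.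
  have -> : 2 * c * r * `|xi u| = c * (2 * (r * `|xi u|)) by ring.
  rewrite ler_wpM2l ?(ltW c0) //; apply: le_trans (norm_usub_dsub _) _.
  by rewrite ler_wpM2l // expr2 ler_wpM2r // ltW // rxi.
have h4 := ler_normD (f u (xi u) - block_mx (H u) (B u) 0 (F u) *m xi u)
  (block_mx (H u) (B u) 0 (F u) *m xi u).
rewrite subrK in h4; rewrite /k mulrDl.
lra.
Qed.

(** Over a window e shrinks to |e| / 4 + C1 |xi|^2 and dx to |dx| / 4 + C2 |e| + C3 |xi|^2. The
    weight mu on e absorbs the coupling C2 |e|, and C collects the quadratic terms. *)
Lemma cascade_window : exists mu C : R, [/\ 1 <= mu, 0 <= C &
  forall t xi, 0 <= t -> sol t (t + T) xi ->
  `|usubmx (xi (t + T))| + mu * `|dsubmx (xi (t + T))| <=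
    2^-1 * (`|usubmx (xi t)| + mu * `|dsubmx (xi t)|) +
    C * (`|usubmx (xi t)| + mu * `|dsubmx (xi t)|) ^+ 2].
Proof.
have [E EE] : exists E, E = expR (k * T) by eexists.
have E0 : 0 <= E by rewrite EE expR_ge0.
have [L LE] : exists L, L = expR (n%:R * h * T) by eexists.
have L0 : 0 <= L by rewrite LE expR_ge0.
have T0' : 0 <= T by exact: ltW.
have [C0 C0E] : exists C0, C0 = c * (2 * E ^+ 2) by eexists.
have C00 : 0 <= C0 by rewrite C0E !mulr_ge0 ?sqr_ge0 // ltW.
have [C1 C1E] : exists C1, C1 = L * (T * C0) by eexists.
have C10 : 0 <= C1 by rewrite C1E !mulr_ge0.
have [C2 C2E] : exists C2, C2 = L * (T * (n%:R * h * L)) by eexists.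
have C20 : 0 <= C2 by rewrite C2E !mulr_ge0.
have [C3 C3E] : exists C3, C3 = L * (T * (n%:R * h * (L * (T * C0)) + C0)) by eexists.
have C30 : 0 <= C3 by rewrite C3E !(mulr_ge0, addr_ge0).
(* mu = 1 + 4 C2 gives mu / 4 + C2 <= mu / 2: the coupling fits between the contraction factors 1/4
   and 1/2. *)
exists (1 + 4 * C2), (C3 + (1 + 4 * C2) * C1); split.
- by rewrite lerDl mulr_ge0.
- by rewrite addr_ge0 // mulr_ge0 // addr_ge0 // mulr_ge0.
move=> t xi t0 sxi.
pose N u := `|usubmx (xi u)| + (1 + 4 * C2) * `|dsubmx (xi u)|.
rewrite -/(N (t + T)) -/(N t).
pose dx u := usubmx (xi u); pose e u := dsubmx (xi u).
pose g u := f u (xi u) - block_mx (H u) (B u) 0 (F u) *m xi u.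
have tT : t <= t + T by rewrite lerDl.
have u0 u : t <= u <= t + T -> 0 <= u by move=> /andP[+ _]; exact: le_trans.
have grow u : t <= u <= t + T -> `|xi u| <= E * `|xi t|.
  move=> /[dup] tu /andP[h1 h2].
  apply: le_trans (cascade_growth t0 h1 (sol_sub (lexx t) h2 sxi)) _.
  by rewrite EE ler_wpM2r // ler_expR ler_wpM2l // lerBlDl.
have hg u : t <= u <= t + T -> `|g u| <= C0 * `|xi t| ^+ 2.
  move=> tu; apply: le_trans (f_lin (u0 u tu) (sxi.2 u tu)) _.
  have -> : C0 * `|xi t| ^+ 2 = c * (2 * (E * `|xi t|) ^+ 2) by rewrite C0E; ring.
  rewrite ler_wpM2l ?(ltW c0) //; apply: le_trans (norm_usub_dsub _) _.
  by rewrite ler_wpM2l // lerXn2r ?nnegrE ?mulr_ge0 // grow.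
have fu u : usubmx (f u (xi u)) = H u *m dx u + B u *m e u + usubmx (g u).
  have -> : H u *m dx u + B u *m e u = usubmx (block_mx (H u) (B u) 0 (F u) *m xi u).
    by rewrite -[in RHS](vsubmxK (xi u)) mul_block_col col_mxKu.
  by rewrite /g linearB /= addrC subrK.
have fd u : dsubmx (f u (xi u)) = F u *m e u + dsubmx (g u).
  have -> : F u *m e u = dsubmx (block_mx (H u) (B u) 0 (F u) *m xi u).
    by rewrite -[in RHS](vsubmxK (xi u)) mul_block_col col_mxKd mul0mx add0r.
  by rewrite /g linearB /= addrC subrK.
have de u : t <= u <= t + T -> deriv_within `[t, t + T] e u (dsubmx (f u (xi u))).
  by move=> tu; apply: deriv_within_dsubmx; exact: sxi.1.
have ddx u : t <= u <= t + T -> deriv_within `[t, t + T] dx u (usubmx (f u (xi u))).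
  by move=> tu; apply: deriv_within_usubmx; exact: sxi.1.
have w0 : 0 <= C0 * `|xi t| ^+ 2 by rewrite mulr_ge0 ?sqr_ge0.
have nh0 : 0 <= n%:R * h by rewrite mulr_ge0.
have he u : t <= u <= t + T -> `|e u| <= L * (`|e t| + T * (C0 * `|xi t| ^+ 2)).
  move=> /[dup] tu /andP[h1 h2].
  have := @norm_deriv_within_bound R n 1 t u (n%:R * h) e
    (fun u => dsubmx (f u (xi u))) (fun u => (u - t) *: (C0 * `|xi t| ^+ 2 : R^o))
    (fun u => 1 *: (C0 * `|xi t| ^+ 2 : R^o)) h1 nh0.
  rewrite subrr scale0r subr0 => HH; apply: le_trans (HH _ _ _ _) _.
  - move=> s /andP[ts su]; apply: (deriv_within_itv_sub (lexx t) h2).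
    by apply: de; rewrite ts (le_trans su).
  - move=> s _; apply: deriv_withinZ; rewrite -[X in deriv_within _ _ _ X]subr0.
    by apply: deriv_withinB; [exact: deriv_within_id|exact: deriv_within_cst].
  - by move=> s _; rewrite scale1r.
  - move=> s /andP[ts su]; have ts' : t <= s <= t + T by rewrite ts (le_trans su).
    rewrite fd scale1r; apply: le_trans (ler_normD _ _) _; rewrite lerD //.
      by apply: le_trans (norm_mulmx_le _ _) _; rewrite ler_wpM2r // ler_wpM2l // hF ?(u0 s).
    by apply: le_trans (norm_dsubmx_le _) _; exact: hg.
  have ut : 0 <= u - t <= T by rewrite subr_ge0 h1 lerBlDl.
  have /andP[ut0 utT] := ut.
  rewrite ler_pM ?expR_ge0 ?addr_ge0 //.
  - by rewrite /GRing.scale /= mulr_ge0.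
  - by rewrite LE ler_expR ler_wpM2l.
  - by rewrite lerD2l /GRing.scale /= ler_wpM2r.
have [ze [zet dze Hze]] := Fcontr (e t) t0.
have [zx [zxt dzx Hzx]] := Hcontr (dx t) t0.
have hFu u : t <= u <= t + T -> `|F u| <= h by move=> /u0; exact: hF.
have hHu u : t <= u <= t + T -> `|H u| <= h by move=> /u0; exact: hH.
have eT : `|e (t + T)| <= 4^-1 * `|e t| + C1 * `|xi t| ^+ 2.
  have := @forced_linear_bound F e _ ze t T h _ t0 T0' h0 w0 hFu de _ zet dze.
  move=> /(_ _)/le_trans HH.
  have h1 : `|e (t + T) - ze (t + T)| <= C1 * `|xi t| ^+ 2.
    apply: HH; last by rewrite C1E -LE -!mulrA.
    by move=> u tu; rewrite fd addrC addKr; apply: le_trans (norm_dsubmx_le _) _; exact: hg.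
  have := ler_normD (e (t + T) - ze (t + T)) (ze (t + T)).
  rewrite subrK; move: Hze h1; lra.
have wx0 : 0 <= n%:R * h * (L * (`|e t| + T * (C0 * `|xi t| ^+ 2))) + C0 * `|xi t| ^+ 2.
  by rewrite addr_ge0 // mulr_ge0 // mulr_ge0 // addr_ge0 // mulr_ge0.
have dxT : `|dx (t + T)| <= 4^-1 * `|dx t| + C2 * `|e t| + C3 * `|xi t| ^+ 2.
  have := @forced_linear_bound H dx _ zx t T h _ t0 T0' h0 wx0 hHu ddx _ zxt dzx.
  move=> /(_ _)/le_trans HH.
  have h1 : `|dx (t + T) - zx (t + T)| <= C2 * `|e t| + C3 * `|xi t| ^+ 2.
    apply: HH; last by rewrite C2E C3E -LE le_eqVlt; apply/orP; left; apply/eqP; ring.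
    move=> u tu; rewrite fu -[X in X - _]addrA [X in X - _]addrC addrK; apply: le_trans (ler_normD _ _) _.
    rewrite lerD //; last by apply: le_trans (norm_usubmx_le _) _; exact: hg.
    apply: le_trans (norm_mulmx_le _ _) _; rewrite ler_pM ?mulr_ge0 ?he //.
    by rewrite ler_wpM2l // hB ?(u0 u).
  have := ler_normD (dx (t + T) - zx (t + T)) (zx (t + T)).
  rewrite subrK; move: Hzx h1; lra.
have xiN : `|xi t| <= N t.
  rewrite -{1}[xi t]vsubmxK; apply: le_trans (norm_col_mx_le _ _) _.
  by rewrite /N lerD2l ler_peMl // lerDl mulr_ge0.
have xiN2 : `|xi t| ^+ 2 <= N t ^+ 2 by rewrite lerXn2r ?nnegrE // (le_trans _ xiN).
have CC : 0 <= C3 + (1 + 4 * C2) * C1 by rewrite addr_ge0 // mulr_ge0 // addr_ge0 // mulr_ge0.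
apply: (@le_trans _ _ (2^-1 * N t + (C3 + (1 + 4 * C2) * C1) * `|xi t| ^+ 2)); last first.
  by rewrite lerD2l ler_wpM2l.
have mu0 : 0 <= 1 + 4 * C2 by rewrite addr_ge0 // mulr_ge0.
have := ler_wpM2l mu0 eT; rewrite /N -/(dx _) -/(e _) -/(dx t) -/(e t).
have de0 : 0 <= `|dx t| by []. have ee0 : 0 <= `|e t| by [].
have Ce0 : 0 <= C2 * `|e t| by rewrite mulr_ge0.
move: dxT.
have -> : (1 + 4 * C2) * (4^-1 * `|e t| + C1 * `|xi t| ^+ 2) =
  4^-1 * `|e t| + C2 * `|e t| + (1 + 4 * C2) * C1 * `|xi t| ^+ 2 by field.
rewrite (mulrDl C3); move: ((1 + 4 * C2) * C1 * `|xi t| ^+ 2) (C3 * `|xi t| ^+ 2) => X1 X2.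
have -> : 2^-1 * (`|dx t| + (1 + 4 * C2) * `|e t|) = 2^-1 * `|dx t| + 2^-1 * `|e t| + 2 * (C2 * `|e t|) by field.
move: (C2 * `|e t|) Ce0 => X3; lra.
Qed.

End Cascade.

(** * From decay of small solutions to exponential stability *)

Section StableOfDecay.
Context {R : realType} {n : nat}.

(** The entrywise retraction onto a ball of the maximum norm. Being 1-Lipschitz, it turns a field
    that is Lipschitz on the ball into a globally Lipschitz one. *)
Definition clamp (r : R) (x : 'cV[R]_n) : 'cV[R]_n :=
  \col_i Num.min r (Num.max (- r) (x i 0)).

Lemma norm_clamp_le r x : 0 <= r -> `|clamp r x| <= r.
Proof.
move=> r0; apply/mx_norm_leP => // i j; rewrite mxE ler_norml ge_min lexx andbT.
by rewrite le_min le_max lexx /= andbT; lra.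
Qed.

Lemma clamp_id r x : `|x| <= r -> clamp r x = x.
Proof.
move=> xr; apply/matrixP => i j; rewrite mxE (ord1 j).
have := le_trans (mx_entry_le_norm x i 0) xr; rewrite ler_norml => /andP[h1 h2].
by rewrite max_r // min_r.
Qed.

Lemma clamp_scalar_lip (r a b : R) : 0 <= r ->
  `|Num.min r (Num.max (- r) a) - Num.min r (Num.max (- r) b)| <= `|a - b|.
Proof.
move=> r0; have := ler_norm (a - b); have := ler_norm (b - a); rewrite distrC => h1 h2.
rewrite ler_norml; apply/andP; split; move: h1 h2; move: `|a - b| => z;
have [h3|h3] := leP (- r) a; have [h4|h4] := leP (- r) b;
(have [h5|h5] := leP r a; have [h6|h6] := leP r b;
 have [h7|h7] := leP r (- r)); lra.
Qed.

Lemma clamp_lip r x y : 0 <= r -> `|clamp r x - clamp r y| <= `|x - y|.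
Proof.
move=> r0; apply/mx_norm_leP => // i j; rewrite !mxE.
apply: le_trans (clamp_scalar_lip _ _ r0) _.
by have := mx_entry_le_norm (x - y) i 0; rewrite !mxE.
Qed.

Lemma continuous_clamp_col r (D : set R) (x : R -> 'cV[R]_n) :
  {within D, continuous x} -> {within D, continuous (fun t => clamp r (x t))}.
Proof.
move=> cx t; apply/cvg_mxP => i j; rewrite mxE.
have h : x s i 0 @[s --> nbhs (t : subspace D)] --> x t i 0.
  exact: (cvg_comp _ _ (cx t) (@coord_continuous R n 1 i 0 (x t))).
have h2 := @continuous_clamp R (- r) r (x t i 0).
apply: (@cvg_eq _ _ _ (fun s => Num.min r (Num.max (- r) (x s i 0)))).
  by move=> s; rewrite mxE.
exact: (cvg_comp _ _ h h2).
Qed.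

(** Existence comes from Picard's theorem for the field composed with the clamp of radius r / 2: by
    the decay estimate its solution never leaves that ball, where the clamp is the identity. *)
Lemma exponentially_stable_of_decay (f : R -> 'cV[R]_n -> 'cV[R]_n) (r : R) :
  0 < r -> (forall t, 0 <= t -> f t 0 = 0) ->
  (forall (t0 : R) (x : R -> 'cV[R]_n), 0 <= t0 -> {within `[t0, +oo[, continuous x} ->
     {within `[t0, +oo[, continuous (fun t => f t (x t))}) ->
  (forall T rho, 0 <= T -> exists2 Lam, 0 <= Lam & forall t, 0 <= t <= T ->
     forall x y, `|x| <= rho -> `|y| <= rho -> `|f t x - f t y| <= Lam * `|x - y|) ->
  (exists c lambda delta : R, [/\ 1 <= c, 0 < lambda, 0 < delta &
    forall t0 t xi, 0 <= t0 -> t0 <= t -> small_solution f r t0 t xi ->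
      `|xi t0| < delta -> `|xi t| <= c * `|xi t0| * expR (- lambda * (t - t0))]) ->
  exponentially_stable f.
Proof.
move=> r0 f0 fc fL [c [lam [dl [c1 lam0 dl0 Hd]]]]; split => //.
have c0 : 0 < c by apply: lt_le_trans c1.
(* The second term makes c |xi t0| at most half of r / 2, the margin on which [bootstrap] relies. *)
pose dl' := Num.min dl (r / (4 * c)).
have dl'0 : 0 < dl' by rewrite lt_min dl0 divr_gt0 // mulr_gt0.
have r20 : 0 < r / 2 by rewrite divr_gt0.
(* The equation is required only while |xi u| < r / 2, so the claim covers both arbitrary solutions
   of [f] and the solution of the clamped equation. *)
have claim t0 b (xi : R -> 'cV[R]_n) : 0 <= t0 -> `|xi t0| < dl' ->
    {within `[t0, b], continuous xi} ->
    (forall u, t0 <= u <= b -> `|xi u| < r / 2 -> deriv_within `[t0, b] xi u (f u (xi u))) ->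
    forall t, t0 <= t <= b -> `|xi t| < r / 2 /\
      `|xi t| <= c * `|xi t0| * expR (- lam * (t - t0)).
  move=> t00; rewrite lt_min => /andP[h1 h2] cxi dxi.
  have dec t : t0 <= t <= b -> (forall s, t0 <= s <= t -> `|xi s| < r / 2) ->
      `|xi t| <= c * `|xi t0| * expR (- lam * (t - t0)).
    move=> /andP[t0t tb] Hs; apply: Hd => //; split => u tu; last first.
      by apply: lt_trans (Hs u tu) _; rewrite ltr_pdivrMr // ltr_pMr // ltr1n.
    apply: (deriv_within_itv_sub (lexx t0) tb); apply: dxi; last exact: Hs.
    by case/andP: tu => -> /le_trans; apply.
  have c4 : c * `|xi t0| <= r / 2 / 2.
    move: h2; rewrite ltr_pdivlMr ?mulr_gt0 //.
    have -> : `|xi t0| * (4 * c) = 4 * (c * `|xi t0|) by ring.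
    lra.
  have small : forall t, t0 <= t <= b -> `|xi t| < r / 2.
    apply: (@bootstrap _ t0 b (r / 2) (fun t => `|xi t|)) => //.
    - by move=> t; apply: cvg_norm; exact: cxi.
    - have : `|xi t0| <= c * `|xi t0| by rewrite ler_peMl.
      lra.
    - move=> t tt Hs; apply: le_trans (dec t tt Hs) _; apply: le_trans c4.
      rewrite ler_piMr ?mulr_ge0 ?(ltW c0) // -expR0 ler_expR mulNr oppr_le0.
      by rewrite mulr_ge0 ?(ltW lam0) // subr_ge0; case/andP: tt.
  move=> t tt; split; first exact: small.
  apply: dec => // s /andP[t0s st]; apply: small; rewrite t0s (le_trans st) //.
  by case/andP: tt.
exists c, lam, dl'; split => // t0 xi0 t00 hxi0; split.
  have [||xi [xit0 dxi]] := @picard R n 1 (fun t x => f t (clamp (r / 2) x)) t0 xi0.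
  - by move=> x cx; apply: fc => //; exact: continuous_clamp_col.
  - move=> T t0T; have [Lam L0 HL] := fL T (r / 2) (le_trans t00 t0T).
    exists Lam => // t /andP[t0t tT] x y.
    apply: (@le_trans _ _ (Lam * `|clamp (r / 2) x - clamp (r / 2) y|)).
      by apply: HL; rewrite ?norm_clamp_le ?(ltW r20) // (le_trans t00).
    by rewrite ler_wpM2l // clamp_lip // ltW.
  exists xi; split => // t; rewrite /= in_itv /= andbT => t0t.
  have Dt u : t0 <= u -> `[t0, +oo[%classic u by rewrite /= in_itv /= andbT.
  have dxib u : t0 <= u <= t -> deriv_within `[t0, t] xi u (f u (clamp (r / 2) (xi u))).
    by move=> /andP[t0u _]; exact: (deriv_within_itvy_sub t (lexx t0) (dxi u (Dt u t0u))).
  have tt : t0 <= t <= t by rewrite t0t lexx.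
  have xi0' : `|xi t0| < dl' by rewrite xit0.
  have [||h _] := claim t0 t xi t00 xi0' _ _ t tt.
  - by apply: (@deriv_within_continuous _ _ _ _ (fun u => f u (clamp (r / 2) (xi u)))) => u /=;
      rewrite in_itv; exact: dxib.
  - by move=> u tu hu; have := dxib u tu; rewrite clamp_id // ltW.
  by have := dxi t (Dt t t0t); rewrite clamp_id // ltW.
move=> T xi xit0 dxi t /andP[t0t tT].
have dxib u : t0 <= u <= t -> deriv_within `[t0, t] xi u (f u (xi u)).
  move=> /andP[t0u ut]; apply: deriv_within_sub (dxi u _); last first.
    by rewrite /= in_itv /= t0u (le_lt_trans ut).
  by move=> s /=; rewrite !in_itv /= => /andP[-> h]; exact: le_lt_trans tT.
have tt : t0 <= t <= t by rewrite t0t lexx.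
have xi0' : `|xi t0| < dl' by rewrite xit0.
have [||_] := claim t0 t xi t00 xi0' _ _ t tt.
- by apply: (@deriv_within_continuous _ _ _ _ (fun u => f u (xi u))) => u /=;
    rewrite in_itv; exact: dxib.
- by move=> u tu _; exact: dxib.
by rewrite xit0.
Qed.

End StableOfDecay.

(** * Continuously differentiable fields *)

Section ContinuouslyDifferentiable.
Context {R : realType}.

(** Transported by transposition from row vectors, the setting of [bounded_closed_compact]. *)
Lemma compact_cV_ball n (rho : R) : compact [set x : 'cV[R]_n | `|x| <= rho].
Proof.
have -> : [set x : 'cV[R]_n | `|x| <= rho] = trmx @` [set x : 'rV[R]_n | `|x| <= rho].
  apply/seteqP; split => [x xr|_ [x xr <-]]; last by rewrite /= norm_trmx.
  by exists x^T; rewrite ?trmxK //= norm_trmx.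
apply: continuous_compact.
  apply: continuous_subspaceT => x.
  exact: (@cvg_trmx _ _ (nbhs x) _ _ _ id x (@cvg_id _ _)).
apply: bounded_closed_compact.
  exists rho; split; first exact: num_real.
  by move=> M rM x /= xr; apply: le_trans xr (ltW rM).
have -> : [set x : 'rV[R]_n | `|x| <= rho] = (fun x => `|x| : R) @^-1` [set y | y <= rho] by [].
apply: (@closed_comp _ _ (fun x : 'rV[R]_n => `|x| : R)); last exact: closed_le.
by move=> x _; exact: norm_continuous.
Qed.

Lemma compact_pair_ball n k (rho : R) :
  compact [set xu : 'cV[R]_n * 'cV[R]_k | `|xu| <= rho].
Proof.
have -> : [set xu : 'cV[R]_n * 'cV[R]_k | `|xu| <= rho] =
    [set x : 'cV[R]_n | `|x| <= rho] `*` [set u : 'cV[R]_k | `|u| <= rho].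
  by apply/seteqP; split => -[x u] /=; rewrite prod_normE /= ge_max => /andP.
by apply: compact_setX; exact: compact_cV_ball.
Qed.

Lemma continuous_bounded_compact {T : topologicalType} {V : normedModType R}
    (K : set T) (g : T -> V) : compact K -> continuous g ->
  exists2 C, 0 <= C & forall x, K x -> `|g x| <= C.
Proof.
move=> cK cg; have /compact_bounded [M [_ HM]] : compact (g @` K).
  by apply: continuous_compact cK; exact: continuous_subspaceT.
exists (Num.max 0 (M + 1)) => [|x Kx]; first by rewrite le_max lexx.
apply: HM; last by exists x.
by rewrite lt_max ltrDl ltr01 orbT.
Qed.

Lemma is_derive_line {V W : normedModType R} (f : V -> W) (x v : V) (s : R) :
  differentiable f (x + s *: v) ->
  is_derive s 1 (fun s => f (x + s *: v)) ('D_v f (x + s *: v)).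
Proof.
move=> /(@diff_derivable _ _ _ _ _ v) df.
have E : (fun h : R => h^-1 *: (((fun s => f (x + s *: v)) \o shift s) (h *: (1 : R)) - f (x + s *: v))) =
    (fun h => h^-1 *: ((f \o shift (x + s *: v)) (h *: v) - f (x + s *: v))).
  apply/funext => h; rewrite /= /shift /=; congr (_ *: (f _ - _)).
  by rewrite scalerDl [h *: 1]mulr1 addrCA.
split; first by rewrite /derivable E; exact: df.
by rewrite /derive E.
Qed.

(** A finite family with coordinates bounded by the norm; it lets one Lipschitz argument serve both
    column vectors and state-control pairs. *)
Definition expansion {V : normedModType R} (I : finType) (b : I -> V) (a : I -> V -> R) :=
  forall v, v = \sum_i a i v *: b i /\ forall i, `|a i v| <= `|v|.

(** Mean value inequality along the segment from [y] to [x], which stays in the ball. Linearity of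
    the differential reduces the derivative along x - y to those along the [b i], which are bounded
    on the ball by compactness. *)
Lemma C1_lipschitz {V : normedModType R} m (I : finType) (b : I -> V) (a : I -> V -> R)
    (f : V -> 'cV[R]_m) (rho : R) :
  expansion b a -> compact [set x : V | `|x| <= rho] -> C1_on setT f ->
  exists2 L, 0 <= L & forall x y, `|x| <= rho -> `|y| <= rho ->
    `|f x - f y| <= L * `|x - y|.
Proof.
move=> ab cK f1.
have Hb i : exists C, 0 <= C /\ forall x, `|x| <= rho -> `|'D_(b i) f x| <= C.
  have [C C0 HC] := @continuous_bounded_compact _ _ _ (fun x => 'D_(b i) f x) cK
    (fun x => (f1 x Logic.I).2 (b i)).
  by exists C.
have [C HC] := choice Hb.
have L0 : 0 <= \sum_i C i by apply: sumr_ge0 => i _; exact: (HC i).1.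
exists (\sum_i C i) => // x y xr yr.
pose v := x - y.
have seg s : 0 <= s <= 1 -> `|y + s *: v| <= rho.
  move=> /andP[s0 s1].
  have -> : y + s *: v = (1 - s) *: y + s *: x.
    by rewrite /v scalerBr scalerBl scale1r addrCA addrC.
  apply: le_trans (ler_normD _ _) _; rewrite !normrZ ger0_norm ?subr_ge0 // ger0_norm //.
  have h1 : (1 - s) * `|y| <= (1 - s) * rho by rewrite ler_wpM2l // subr_ge0.
  have h2 : s * `|x| <= s * rho by rewrite ler_wpM2l.
  lra.
have dbound s : 0 <= s <= 1 -> `|'D_v f (y + s *: v)| <= (\sum_i C i) * `|v|.
  move=> s01; have [vE va] := ab v.
  have fd := (f1 (y + s *: v) Logic.I).1.
  have dE : 'D_v f (y + s *: v) = \sum_i a i v *: 'D_(b i) f (y + s *: v).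
    have -> : 'D_v f (y + s *: v) = 'd f (y + s *: v) (\sum_i a i v *: b i).
      by rewrite -vE deriveE.
    by rewrite linear_sum; apply: eq_bigr => i _; rewrite linearZ deriveE.
  rewrite dE; apply: le_trans (ler_norm_sum _ _ _) _.
  rewrite mulr_suml; apply: ler_sum => i _.
  by rewrite normrZ mulrC ler_pM //; exact: (HC i).2 (seg s s01).
have := @deriv_within_norm_le R m 1 0 1 (fun s => f (y + s *: v))
  (fun s => 'D_v f (y + s *: v)) (fun s => s *: ((\sum_i C i) * `|v| : R^o))
  (fun s => 1 *: ((\sum_i C i) * `|v| : R^o)) ler01.
have yv : y + v = x by rewrite /v addrC subrK.
rewrite !scale1r !scale0r addr0 subr0 yv; apply => s s01.
- by apply: is_derive_deriv_within; apply: is_derive_line; exact: (f1 _ Logic.I).1.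
- rewrite -[X in deriv_within _ _ _ X]scale1r.
  exact: (@deriv_withinZ _ _ id R^o _ _ _ (deriv_within_id _ _)).
- by rewrite dbound.
Qed.

Lemma expansion_cV n :
  expansion (fun j : 'I_n => delta_mx j 0 : 'cV[R]_n) (fun j v => v j 0).
Proof.
move=> v; split => [|i]; last exact: mx_entry_le_norm.
by rewrite {1}(matrix_sum_delta v); apply: eq_bigr => i _; rewrite big_ord1.
Qed.

Lemma expansion_pair n k :
  expansion (fun j : 'I_n + 'I_k => match j with
       | inl i => (delta_mx i 0, 0) | inr i => (0, delta_mx i 0) end
       : 'cV[R]_n * 'cV[R]_k)
    (fun j xu => match j with inl i => xu.1 i 0 | inr i => xu.2 i 0 end).
Proof.
move=> [x u]; split => [|j]; last first.
  rewrite prod_normE /= le_max.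
  by case: j => i; rewrite mx_entry_le_norm ?orbT.
rewrite big_sumType /=.
have [ex _] := expansion_cV x; have [eu _] := expansion_cV u.
pose p1 := @fst 'cV[R]_n 'cV[R]_k; pose p2 := @snd 'cV[R]_n 'cV[R]_k.
have m1 (I : finType) (g : I -> 'cV[R]_n * 'cV[R]_k) : (\sum_i g i).1 = \sum_i (g i).1.
  exact: (big_morph p1).
have m2 (I : finType) (g : I -> 'cV[R]_n * 'cV[R]_k) : (\sum_i g i).2 = \sum_i (g i).2.
  exact: (big_morph p2).
apply: injective_projections; rewrite /= ?m1 ?m2 /=.
  rewrite [X in _ + X]big1 ?addr0 // => i _; exact: scaler0.
by rewrite [X in X + _]big1 ?add0r // => i _; exact: scaler0.
Qed.

End ContinuouslyDifferentiable.

(** * Regularity of the linearization and of the error field *)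

Section ErrorField.
Context {R : realType}.

Lemma continuous_from0_eq (V : normedModType R) (f g : R -> V) :
  (forall t, 0 <= t -> f t = g t) -> continuous_from0 g -> continuous_from0 f.
Proof.
move=> fg /subspace_continuousP cg; apply/subspace_continuousP => t Dt.
have t0 : 0 <= t by move: Dt; rewrite /= in_itv /= andbT.
have gt : g s @[s --> within `[0, +oo[ (nbhs t)] --> g t := cg t Dt.
suff : f s @[s --> within `[0, +oo[ (nbhs t)] --> f t by [].
rewrite fg //; apply: (cvg_near_eq _ gt).
have : \forall s \near nbhs t, `[0, +oo[%classic s -> g s = f s.
  by apply: nearW => s; rewrite /= in_itv /= andbT => /fg.
exact.
Qed.

(** The Jacobians A and B are partial, while continuous differentiability is assumed of the joint
    map of state and control. *)
Lemma derive_partial1 {U V W : normedModType R} (F : U -> V -> W) x u v :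
  'D_v (fun x => F x u) x = 'D_((v, 0) : U * V) (fun xu => F xu.1 xu.2) (x, u).
Proof.
have E : (fun h : R => h^-1 *: (((fun x => F x u) \o shift x) (h *: v) - F x u)) =
    (fun h => h^-1 *: (((fun xu : U * V => F xu.1 xu.2) \o shift (x, u))
       (h *: ((v, 0) : U * V)) - F x u)).
  by apply/funext => h; rewrite /= /shift /= scaler0 add0r.
by rewrite /derive E.
Qed.

Lemma derive_partial2 {U V W : normedModType R} (F : U -> V -> W) x u v :
  'D_v (fun u => F x u) u = 'D_((0, v) : U * V) (fun xu => F xu.1 xu.2) (x, u).
Proof.
have E : (fun h : R => h^-1 *: ((F x \o shift u) (h *: v) - F x u)) =
    (fun h => h^-1 *: (((fun xu : U * V => F xu.1 xu.2) \o shift (x, u))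
       (h *: ((0, v) : U * V)) - F x u)).
  by apply/funext => h; rewrite /= /shift /= scaler0 add0r.
by rewrite /derive E.
Qed.

Lemma C1_on_fst {U V W : normedModType R} (g : U -> W) :
  C1_on setT g -> C1_on setT (fun xu : U * V => g xu.1).
Proof.
move=> g1 [x u] _; have [dg cg] := g1 x Logic.I; split.
  apply: (@differentiable_comp _ _ _ _ fst g) => //.
  by apply: linear_differentiable => -[a b]; exact: cvg_fst.
move=> [v w].
have -> : (fun y : U * V => 'D_(v, w) (fun xu : U * V => g xu.1) y) =
    (fun y => 'D_v g y.1) by apply/funext => -[y1 y2].
exact: (cvg_comp _ _ (@cvg_fst _ _ (nbhs x) (nbhs u) _) (cg v)).
Qed.

Lemma C1_onB {V W : normedModType R} (f g : V -> W) :
  C1_on setT f -> C1_on setT g -> C1_on setT (fun x => f x - g x).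
Proof.
move=> f1 g1 x _; have [df cf] := f1 x Logic.I; have [dg cg] := g1 x Logic.I.
split; first exact: differentiableB.
move=> v; have -> : (fun y => 'D_v (fun x => f x - g x) y) = (fun y => 'D_v f y - 'D_v g y).
  apply/funext => y; apply: (@deriveB _ _ _ f g).
    by apply: diff_derivable; exact: (f1 y Logic.I).1.
  by apply: diff_derivable; exact: (g1 y Logic.I).1.
exact: (cvgB (cf v) (cg v)).
Qed.

(** Gives the continuity of A, B and C and the bounds on A and C: the reference stays in a compact
    ball, on which the derivatives are bounded. *)
Lemma derivative_path {W : normedModType R} n m (F : W -> 'cV[R]_n) (b : 'I_m -> W)
    (w : R -> W) (rho : R) :
  C1_on setT F -> continuous_from0 w -> compact [set x : W | `|x| <= rho] ->
  (forall t, 0 <= t -> `|w t| <= rho) ->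
  let M t : 'M[R]_(n, m) := \matrix_(i, j) ('D_(b j) F (w t)) i 0 in
  continuous_from0 M /\ exists C, forall t, 0 <= t -> `|M t| <= C.
Proof.
move=> F1 cw cK wK M.
have cF j : continuous (fun x => 'D_(b j) F x) by move=> x; exact: (F1 x Logic.I).2.
split.
  move=> t; apply/cvg_mxP => i j; rewrite mxE.
  apply: (@cvg_eq _ _ _ (fun s => ('D_(b j) F (w s)) i 0)); first by move=> s; rewrite mxE.
  have h := cvg_comp _ _ (cw t) (cF j (w t)).
  exact: (cvg_comp _ _ h (@coord_continuous R n 1 i 0 _)).
have H j : exists C, 0 <= C /\ forall x, `|x| <= rho -> `|'D_(b j) F x| <= C.
  by have [C C0 HC] := continuous_bounded_compact cK (cF j); exists C.
have [C HC] := choice H.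
have C0 : 0 <= \sum_j C j by apply: sumr_ge0 => j _; exact: (HC j).1.
exists (\sum_j C j) => t t0; apply/mx_norm_leP => // i j; rewrite mxE.
apply: le_trans (mx_entry_le_norm _ _ _) _.
apply: le_trans ((HC j).2 _ (wK t t0)) _.
by rewrite (bigD1 j) //= lerDl sumr_ge0 // => l _; exact: (HC l).1.
Qed.

Context {n k p : nat}.
Context (h : 'cV[R]_n -> 'cV[R]_p) (h1 : C1_on setT h).
Context (X : 'cV[R]_n -> 'cV[R]_k -> 'cV[R]_n).
Context (X1 : C1_on setT (fun xu : 'cV[R]_n * 'cV[R]_k => X xu.1 xu.2)).
Context (x0 : R -> 'cV[R]_n) (u0 : R -> 'cV[R]_k).
Context (A : R -> 'M[R]_n) (B : R -> 'M[R]_(n, k)) (C : R -> 'M[R]_(p, n)).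
Context (L : R -> 'M[R]_(n, p)) (K : R -> 'M[R]_(k, n)).
Context (cx0 : continuous_from0 x0) (cu0 : continuous_from0 u0).
Context (cA : continuous_from0 A) (cB : continuous_from0 B) (cC : continuous_from0 C).
Context (cL : continuous_from0 L) (cK : continuous_from0 K).

Let ef := error_field h x0 u0 A B C L K X.

Lemma error_field0 t : ef t 0 = 0.
Proof.
have u00 : usubmx (0 : 'cV[R]_(n + n)) = 0 by apply/matrixP => i j; rewrite !mxE.
have d00 : dsubmx (0 : 'cV[R]_(n + n)) = 0 by apply/matrixP => i j; rewrite !mxE.
rewrite /ef /error_field u00 d00 subr0 addr0 /feedback mulmx0 subr0 subrr.
by rewrite /observer_field !subrr !mulmx0 !subr0 mulmx0 addr0 subr0 subrr col_mx0.
Qed.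

Lemma C1_continuous {V W : normedModType R} (f : V -> W) : C1_on setT f -> continuous f.
Proof. by move=> f1 x; apply: differentiable_continuous; exact: (f1 x Logic.I).1. Qed.

Lemma error_field_continuous t0 (xi : R -> 'cV[R]_(n + n)) : 0 <= t0 ->
  {within `[t0, +oo[, continuous xi} ->
  {within `[t0, +oo[, continuous (fun t => ef t (xi t))}.
Proof.
move=> t00 /subspace_continuousP cxi; apply/subspace_continuousP => t Dt.
have sub : `[t0, +oo[%classic `<=` `[0 : R, +oo[%classic.
  by move=> s /=; rewrite !in_itv /= !andbT; exact: le_trans.
pose F := within `[t0, +oo[ (nbhs t).
have FF : Filter F by exact: within_filter.
have w (V : normedModType R) (g : R -> V) : continuous_from0 g -> g s @[s --> F] --> g t.
  move=> /(continuous_subspaceW sub)/subspace_continuousP; exact.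
have hx := w _ _ cx0; have hu := w _ _ cu0; have hA := w _ _ cA; have hB := w _ _ cB.
have hC := w _ _ cC; have hL := w _ _ cL; have hK := w _ _ cK.
have hxi : xi s @[s --> F] --> xi t := cxi t Dt.
pose dx s := usubmx (xi s); pose z s := dx s - dsubmx (xi s).
have hdx : dx s @[s --> F] --> dx t by exact: cvg_usubmx.
have hz : z s @[s --> F] --> z t := cvgB (FF := FF) hdx (cvg_dsubmx (FF := FF) hxi).
have hxx : (x0 s + dx s) @[s --> F] --> x0 t + dx t := cvgD (FF := FF) hx hdx.
have huu : (u0 s - K s *m z s) @[s --> F] --> u0 t - K t *m z t :=
  cvgB (FF := FF) hu (cvg_mulmx (FF := FF) hK hz).
have hX (a : R -> 'cV[R]_n) (b : R -> 'cV[R]_k) : a s @[s --> F] --> a t -> b s @[s --> F] --> b t ->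
    X (a s) (b s) @[s --> F] --> X (a t) (b t).
  move=> ha hb; exact: (cvg_comp (fun s => (a s, b s)) (fun xu : 'cV[R]_n * 'cV[R]_k => X xu.1 xu.2)
    (cvg_pair (FF := FF) ha hb) (C1_continuous X1 (x := (a t, b t)))).
have hh (a : R -> 'cV[R]_n) : a s @[s --> F] --> a t -> h (a s) @[s --> F] --> h (a t).
  by move=> ha; exact: (cvg_comp a h ha (C1_continuous h1 (x := a t))).
have hdd := cvgB (FF := FF) (hX (fun s => x0 s + dx s) (fun s => u0 s - K s *m z s) hxx huu) (hX x0 u0 hx hu).
have huu0 : (u0 s - K s *m z s - u0 s) @[s --> F] --> u0 t - K t *m z t - u0 t :=
  cvgB (FF := FF) huu hu.
have hdy : (h (x0 s + dx s) - h (x0 s)) @[s --> F] --> h (x0 t + dx t) - h (x0 t) :=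
  cvgB (FF := FF) (hh (fun s => x0 s + dx s) hxx) (hh x0 hx).
have hobs := cvgB (FF := FF)
  (cvgD (FF := FF) (cvg_mulmx (FF := FF) hA hz) (cvg_mulmx (FF := FF) hB huu0))
  (cvg_mulmx (FF := FF) hL (cvgB (FF := FF) (cvg_mulmx (FF := FF) hC hz) hdy)).
exact: (cvg_col_mx (FF := FF) hdd (cvgB (FF := FF) hdd hobs)).
Qed.

Lemma error_field_lipschitz T rho : 0 <= T ->
  exists2 Lam, 0 <= Lam & forall t, 0 <= t <= T -> forall xi xi' : 'cV[R]_(n + n),
    `|xi| <= rho -> `|xi'| <= rho -> `|ef t xi - ef t xi'| <= Lam * `|xi - xi'|.
Proof.
move=> T0.
have [bx _ Hx] := continuous_from0_bound T cx0; have [bu _ Hu] := continuous_from0_bound T cu0.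
have [bA bA0 HA] := continuous_from0_bound T cA; have [bB bB0 HB] := continuous_from0_bound T cB.
have [bC bC0 HC] := continuous_from0_bound T cC; have [bL bL0 HL] := continuous_from0_bound T cL.
have [bK bK0 HK] := continuous_from0_bound T cK.
pose c1 : R := n%:R * bK * 2.
have c10 : 0 <= c1 by rewrite !mulr_ge0.
(* Radii of balls that contain the plant state and the control as long as |xi| <= rho and t <= T. *)
pose rx := bx + rho; pose ru := bu + c1 * rho.
have [LX LX0 HX] := C1_lipschitz (@expansion_pair R n k) (@compact_pair_ball R n k (Num.max rx ru)) X1.
have [Lh Lh0 Hh] := C1_lipschitz (@expansion_cV R n) (@compact_cV_ball R n rx) h1.
pose cX := LX * (1 + c1).
pose co := n%:R * bA * 2 + k%:R * bB * c1 + p%:R * bL * (n%:R * bC * 2 + Lh).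
exists (cX + (cX + co)).
  by rewrite !addr_ge0 // !mulr_ge0 ?addr_ge0 // !mulr_ge0 // addr_ge0.
move=> t tT xi xi' hxi hxi'; set d := `|xi - xi'|.
have d0 : 0 <= d by exact: normr_ge0.
have mulb m1 m2 m3 (Y : 'M[R]_(m1, m2)) (Z : 'M[R]_(m2, m3)) y z :
    `|Y| <= y -> `|Z| <= z -> `|Y *m Z| <= m2%:R * y * z.
  move=> hy hz; apply: le_trans (norm_mulmx_le Y Z) _.
  by rewrite -!mulrA ler_wpM2l // ler_pM.
pose dx (v : 'cV[R]_(n + n)) := usubmx v; pose z (v : 'cV[R]_(n + n)) := usubmx v - dsubmx v.
pose x v := x0 t + dx v; pose u v := u0 t - K t *m z v.
have nz v : `|z v| <= 2 * `|v|.
  apply: le_trans (ler_normB _ _) _.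
  by have := norm_usubmx_le v; have := norm_dsubmx_le v; lra.
have hz : `|z xi - z xi'| <= 2 * d.
  have -> : z xi - z xi' = z (xi - xi') by apply/matrixP => i j; rewrite !mxE; ring.
  exact: nz.
have hdx : `|x xi - x xi'| <= d.
  have -> : x xi - x xi' = dx (xi - xi') by rewrite /x opprD addrACA subrr add0r /dx linearB.
  exact: norm_usubmx_le.
have hdu : `|u xi - u xi'| <= c1 * d.
  have -> : u xi - u xi' = - (K t *m (z xi - z xi')).
    rewrite /u [in RHS]mulmxBr; move: (K t *m z xi) (K t *m z xi') => V1 V2.
    by apply/matrixP => i j; rewrite !mxE; ring.
  have -> : c1 * d = n%:R * bK * (2 * d) by rewrite /c1; ring.
  by rewrite normrN; exact: (mulb _ _ _ _ _ _ _ (HK t tT) hz).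
have rxv v : `|v| <= rho -> `|x v| <= rx.
  move=> hv; apply: le_trans (ler_normD _ _) _; rewrite lerD ?Hx //.
  exact: le_trans (norm_usubmx_le v) hv.
have ruv v : `|v| <= rho -> `|u v| <= ru.
  move=> hv; apply: le_trans (ler_normB _ _) _; rewrite lerD ?Hu //.
  apply: le_trans (mulb _ _ _ _ _ _ _ (HK t tT) (nz v)) _.
  have -> : c1 * rho = n%:R * bK * (2 * rho) by rewrite /c1; ring.
  by rewrite ler_wpM2l ?mulr_ge0 // ler_wpM2l.
have hXX : `|X (x xi) (u xi) - X (x xi') (u xi')| <= cX * d.
  have pn v : `|v| <= rho -> `|((x v, u v) : 'cV[R]_n * 'cV[R]_k)| <= Num.max rx ru.
    move=> hv; rewrite prod_normE /= ge_max !le_max rxv // ruv //= orbT //.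
  apply: le_trans (HX (x xi, u xi) (x xi', u xi') (pn _ hxi) (pn _ hxi')) _.
  rewrite /cX -mulrA ler_wpM2l // prod_normE /= ge_max mulrDl mul1r.
  have c1d : 0 <= c1 * d by rewrite mulr_ge0.
  by apply/andP; split; [apply: le_trans hdx _|apply: le_trans hdu _]; lra.
have hhh : `|h (x xi) - h (x xi')| <= Lh * d.
  by apply: le_trans (Hh _ _ (rxv _ hxi) (rxv _ hxi')) _; rewrite ler_wpM2l.
pose ob v := observer_field A B C L t (z v) (u v - u0 t) (h (x v) - h (x0 t)).
have hob : `|ob xi - ob xi'| <= co * d.
  have -> : ob xi - ob xi' = A t *m (z xi - z xi') + B t *m (u xi - u xi')
      - L t *m (C t *m (z xi - z xi') - (h (x xi) - h (x xi'))).
    rewrite /ob /observer_field; have [Y1 ->] : exists Y, u xi = Y by eexists.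
    have [Y2 ->] : exists Y, u xi' = Y by eexists.
    have [Y3 ->] : exists Y, h (x xi) = Y by eexists.
    have [Y4 ->] : exists Y, h (x xi') = Y by eexists.
    rewrite !mulmxBr.
    move: (A t *m z xi) (A t *m z xi') (B t *m Y1) (B t *m Y2) (B t *m u0 t) => V1 V2 V3 V4 V5.
    move: (L t *m (C t *m z xi)) (L t *m (C t *m z xi')) (L t *m Y3) (L t *m Y4) (L t *m h (x0 t)) => V6 V7 V8 V9 V10.
    by apply/matrixP => i j; rewrite !mxE; ring.
  have b1 := mulb _ _ _ _ _ _ _ (HA t tT) hz.
  have b2 := mulb _ _ _ _ _ _ _ (HB t tT) hdu.
  have b3 : `|C t *m (z xi - z xi') - (h (x xi) - h (x xi'))| <= n%:R * bC * (2 * d) + Lh * d.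
    apply: le_trans (ler_normB _ _) _; rewrite lerD //.
    exact: (mulb _ _ _ _ _ _ _ (HC t tT) hz).
  have b4 := mulb _ _ _ _ _ _ _ (HL t tT) b3.
  apply: le_trans (ler_normB _ _) _.
  have -> : co * d = (n%:R * bA * (2 * d) + k%:R * bB * (c1 * d)) +
    p%:R * bL * (n%:R * bC * (2 * d) + Lh * d) by rewrite /co; ring.
  by rewrite lerD //; apply: le_trans (ler_normD _ _) _; rewrite lerD.
have efE v : ef t v = col_mx (X (x v) (u v) - X (x0 t) (u0 t))
   (X (x v) (u v) - X (x0 t) (u0 t) - ob v) by [].
rewrite !efE opp_col_mx add_col_mx; apply: le_trans (norm_col_mx_le _ _) _.
have e1 : X (x xi) (u xi) - X (x0 t) (u0 t) - (X (x xi') (u xi') - X (x0 t) (u0 t)) =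
  X (x xi) (u xi) - X (x xi') (u xi') by rewrite opprB addrA subrK.
have e2 : X (x xi) (u xi) - X (x0 t) (u0 t) - ob xi - (X (x xi') (u xi') - X (x0 t) (u0 t) - ob xi') =
  (X (x xi) (u xi) - X (x xi') (u xi')) - (ob xi - ob xi').
  move: (X _ _) (X _ _) (X _ _) (ob _) (ob _) => V1 V2 V3 V4 V5.
  by apply/matrixP => i j; rewrite !mxE; ring.
have -> : (cX + (cX + co)) * d = cX * d + (cX * d + co * d) by ring.
rewrite e1 e2 lerD //; apply: le_trans (ler_normB _ _) _.
exact: lerD.
Qed.

End ErrorField.

(** * The function V along trajectories *)

Section Invariance.
Context {R : realType} {n : nat}.

Lemma grad_diff (V : 'cV[R]_n -> R) x v : differentiable V x ->
  'd V x v = dot (grad V x) v.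
Proof.
move=> dV; have [vE _] := expansion_cV v.
rewrite {1}vE linear_sum dotE; apply: eq_bigr => j _.
by rewrite linearZ mxE -deriveE // mulrC.
Qed.

(** The restriction of V to each coordinate line through [x] has an interior minimum there. Hence
    the damping term of the extended field vanishes on M. *)
Lemma grad_min (V : 'cV[R]_n -> R) x : (forall y, differentiable V y) ->
  (forall y, 0 <= V y) -> V x = 0 -> grad V x = 0.
Proof.
move=> dV V0 Vx; apply/matrixP => j i; rewrite !mxE.
have D s := @is_derive_line _ _ _ V x (delta_mx j 0) s (dV _).
have := @derive1_at_min R (fun s => V (x + s *: delta_mx j 0)) (-1) 1 0.
move=> H; have [] : is_derive (0 : R) 1 (fun s => V (x + s *: delta_mx j 0)) 0.
  apply: H.
  - by lra.
  - by move=> t _; case: (D t).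
  - by rewrite in_itv /= ltrN10 ltr01.
  - by move=> t _; rewrite scale0r addr0 Vx.
move=> _ <-; have [_] := D 0; rewrite scale0r addr0 => <-; by [].
Qed.

(** The chain rule is used at interior times only; at the endpoints continuity is enough for the
    mean value theorem. *)
Lemma lyapunov_nonincreasing (V : 'cV[R]_n -> R) (a b : R) (x x' : R -> 'cV[R]_n) :
  a <= b -> (forall y, differentiable V y) ->
  (forall t, a <= t <= b -> deriv_within `[a, b] x t (x' t)) ->
  (forall t, a <= t <= b -> dot (grad V (x t)) (x' t) <= 0) ->
  V (x b) <= V (x a).
Proof.
move=> ab dV dx H.
have dVx t : t \in `]a, b[ -> is_derive t 1 (V \o x) (dot (grad V (x t)) (x' t)).
  rewrite in_itv /= => /[dup] atb /andP[/ltW at_ /ltW tb].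
  have [dxt xE] := deriv_within_is_derive atb (dx t (introT andP (conj at_ tb))).
  have dfx : differentiable x t by apply/derivable1_diffP.
  have dc : differentiable (V \o x) t by exact: differentiable_comp.
  split; first exact: diff_derivable.
  by rewrite deriveE // diff_comp //= grad_diff // -deriveE // xE.
have [|c] := MVT_segment ab dVx.
  move=> t; have cx : {within `[a, b], continuous x}.
    by apply: (@deriv_within_continuous _ _ _ x x') => u; rewrite /= in_itv; exact: dx.
  exact: (cvg_comp _ _ (cx t) (differentiable_continuous (dV (x t)))).
rewrite in_itv /= => cab E; rewrite -subr_le0 E.
by rewrite mulr_le0_ge0 ?H // subr_ge0.
Qed.

End Invariance.

Theorem theorem3 (R : realType) (n k p q m : nat)
    (* the control system on M *)
    (M : set 'cV[R]_n) (M_manifold : regular_manifold m M)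
    (X : 'cV[R]_n -> 'cV[R]_k -> 'cV[R]_n)
    (X_tangent : forall x u, M x -> tangent M x (X x u))
    (h : 'cV[R]_n -> 'cV[R]_p) (h_C1 : C1_on setT h)
    (* its extension to R^n *)
    (Xe : 'cV[R]_n -> 'cV[R]_k -> 'cV[R]_n)
    (Xe_C1 : C1_on setT (fun xu : 'cV[R]_n * 'cV[R]_k => Xe xu.1 xu.2))
    (Xe_ext : forall x u, M x -> Xe x u = X x u)
    (V : 'cV[R]_n -> R)
    (V_diff : forall x, differentiable V x) (gradV_C1 : C1_on setT (grad V))
    (V_ge0 : forall x, 0 <= V x) (V_M : M = [set x | V x = 0])
    (V_Xe : forall x u, ((grad V x)^T *m Xe x u) 0 0 = 0)
    (* the reference trajectory on M *)
    (x0 : R -> 'cV[R]_n) (u0 : R -> 'cV[R]_k)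
    (x0_M : forall t, 0 <= t -> M (x0 t))
    (x0_bounded : bounded_from0 x0) (u0_bounded : bounded_from0 u0)
    (u0_cont : continuous_from0 u0)
    (x0_sol : is_solution (fun t x => X x (u0 t)) `[0, +oo[ x0)
    (* the linearization along the reference *)
    (A : R -> 'M[R]_n) (B : R -> 'M[R]_(n, k)) (C : R -> 'M[R]_(p, n))
    (A_def : forall t, 0 <= t ->
       A t = jac (fun x => ext_field Xe V x (u0 t)) (x0 t))
    (B_def : forall t, 0 <= t ->
       B t = jac (fun u => ext_field Xe V (x0 t) u) (u0 t))
    (C_def : forall t, 0 <= t -> C t = jac h (x0 t))
    (Phi : R -> R -> 'M[R]_n) (Phi_def : transition_matrix A Phi)
    (* the observer *)
    (Rt : R -> 'M[R]_p) (Qt : R -> 'M[R]_n)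
    (Rt_cont : continuous_from0 Rt) (Qt_cont : continuous_from0 Qt)
    (Rt_pos : forall t, 0 <= t -> (Rt t)^T = Rt t /\ posdef (Rt t))
    (Qt_nneg : forall t, 0 <= t -> (Qt t)^T = Qt t /\ loewner_le 0 (Qt t))
    (P : R -> 'M[R]_n)
    (P_init : (P 0)^T = P 0 /\ loewner_le 0 (P 0))
    (P_riccati : is_solution
       (fun t (Z : 'M[R]_n) =>
          Z *m (A t)^T + A t *m Z
          - Z *m (C t)^T *m invmx (Rt t) *m C t *m Z + Qt t)
       `[0, +oo[ P)
    (L : R -> 'M[R]_(n, p))
    (L_def : forall t, 0 <= t -> L t = P t *m (C t)^T *m invmx (Rt t))
    (* the feedback gain and the second-order remainder of the error dynamics *)
    (K : R -> 'M[R]_(k, n)) (K_cont : continuous_from0 K)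
    (error_dynamics :
       second_order_remainder h x0 u0 A B C L K (ext_field Xe V))
    (* (i) *)
    (K_stab : exponentially_stable (fun t z => (A t - B t *m K t) *m z))
    (* (ii) *)
    (BK_bounded : bounded_from0 (fun t => B t *m K t))
    (* (iii) *)
    (AC_observable : unif_compl_observable Phi C)
    (* (iv) *)
    (D : R -> 'M[R]_(n, q)) (D_cont : continuous_from0 D)
    (Qtilde : R -> 'M[R]_q)
    (Qtilde_sym : forall t, 0 <= t -> (Qtilde t)^T = Qtilde t)
    (Qt_fact : forall t, 0 <= t -> Qt t = D t *m Qtilde t *m (D t)^T)
    (AD_controllable : unif_compl_controllable Phi D)
    (Qtilde_bounds : exists g1 g2 : R, [/\ 0 < g1, 0 < g2 &
       forall t, 0 <= t ->
         loewner_le g1%:M (Qtilde t) /\ loewner_le (Qtilde t) g2%:M])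
    (* (v) *)
    (Rt_bounds : exists g3 g4 : R, [/\ 0 < g3, 0 < g4 &
       forall t, 0 <= t ->
         loewner_le g3%:M (Rt t) /\ loewner_le (Rt t) g4%:M]) :
  exponentially_stable
    (error_field h x0 u0 A B C L K (ext_field Xe V)) /\
  exponentially_tracks h x0 u0 A B C L K M X.
Proof.
pose Xt := ext_field Xe V.
have Mgrad x : M x -> grad V x = 0.
  by rewrite V_M => /= Vx; exact: grad_min.
have XtM x u : M x -> Xt x u = X x u.
  by move=> Mx; rewrite /Xt /ext_field Mgrad // subr0 Xe_ext.
have D0 (t : R) : 0 <= t -> `[0, +oo[%classic t by rewrite /= in_itv /= andbT.
have dx0 t : 0 <= t -> deriv_within `[0, +oo[ x0 t (X (x0 t) (u0 t)).
  by move=> t0; exact: (x0_sol t (D0 t t0)).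
have cx0 : continuous_from0 x0 := deriv_within_from0 dx0.
have Xt1 : C1_on setT (fun xu : 'cV[R]_n * 'cV[R]_k => Xt xu.1 xu.2).
  exact: (C1_onB Xe_C1 (C1_on_fst gradV_C1)).
have [bx Hbx] := x0_bounded; have [bu Hbu] := u0_bounded.
pose w t : 'cV[R]_n * 'cV[R]_k := (x0 t, u0 t).
have cw : continuous_from0 w.
  by move=> t; exact: (cvg_pair (cx0 t) (u0_cont t)).
have hw t : 0 <= t -> `|w t| <= Num.max bx bu.
  by move=> t0; rewrite prod_normE /= ge_max !le_max Hbx // Hbu // orbT.
have [cA' [bA HA']] := @derivative_path R _ n n _ (fun j => (delta_mx j 0, 0)) w _
  Xt1 cw (@compact_pair_ball R n k _) hw.
have [cB' _] := @derivative_path R _ n k _ (fun j => (0, delta_mx j 0)) w _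
  Xt1 cw (@compact_pair_ball R n k _) hw.
have [cC' [bC HC']] := @derivative_path R _ p n _ (fun j => delta_mx j 0) x0 _
  h_C1 cx0 (@compact_cV_ball R n _) Hbx.
have AE t : 0 <= t -> A t = \matrix_(i, j)
    ('D_((delta_mx j 0, 0) : 'cV[R]_n * 'cV[R]_k) (fun xu => Xt xu.1 xu.2) (w t)) i 0.
  move=> t0; rewrite (A_def t t0) /jac; apply/matrixP => i j.
  by rewrite [LHS]mxE [RHS]mxE (derive_partial1 Xt).
have BE t : 0 <= t -> B t = \matrix_(i, j)
    ('D_((0, delta_mx j 0) : 'cV[R]_n * 'cV[R]_k) (fun xu => Xt xu.1 xu.2) (w t)) i 0.
  move=> t0; rewrite (B_def t t0) /jac; apply/matrixP => i j.
  by rewrite [LHS]mxE [RHS]mxE (derive_partial2 Xt).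
have cA : continuous_from0 A := continuous_from0_eq AE cA'.
have cB : continuous_from0 B := continuous_from0_eq BE cB'.
have cC : continuous_from0 C := continuous_from0_eq C_def cC'.
have HA t : 0 <= t -> `|A t| <= bA by move=> t0; rewrite AE //; exact: HA'.
have HC t : 0 <= t -> `|C t| <= bC by move=> t0; rewrite C_def //; exact: HC'.
have bA0 : 0 <= bA by apply: le_trans (HA 0 (lexx 0)).
have bC0 : 0 <= bC by apply: le_trans (HC 0 (lexx 0)).
have [bBK HBK] := BK_bounded.
have bBK0 : 0 <= bBK by apply: le_trans (HBK 0 (lexx 0)).
have Rsym t : 0 <= t -> (Rt t)^T = Rt t by move=> /Rt_pos[].
have Rpos t : 0 <= t -> posdef (Rt t) by move=> /Rt_pos[].
have dP t : 0 <= t -> deriv_within `[0, +oo[ P t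
    (P t *m (A t)^T + A t *m P t
     - P t *m (C t)^T *m invmx (Rt t) *m C t *m P t + Qt t).
  by move=> t0; exact: (P_riccati t (D0 t t0)).
have cP := deriv_within_from0 dP.
have [g1 [g2 [g10 g20 HQ]]] := Qtilde_bounds.
have [g3 [g4 [g30 g40 HR]]] := Rt_bounds.
have uR t : 0 <= t -> Rt t \in unitmx by move=> t0; exact: posdef_unitmx (Rpos t t0).
have cL : continuous_from0 L.
  apply: (continuous_from0_eq L_def).
  apply: continuous_from0_mulmx; last exact: continuous_from0_invmx.
  by apply: continuous_from0_mulmx => //; exact: continuous_from0_trmx.
have [bP bP0 HP] := riccati_norm_bounded cA cC Rt_cont D_cont Rsym Rpos Qt_nneg P_init dP
  Phi_def HA HC Qt_fact g20 g40 HQ HR AC_observable AD_controllable.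
have [s s0 Hs] := kalman_contraction cA cC Rt_cont D_cont Rsym Rpos Qt_nneg P_init dP
  Phi_def HA HC Qt_fact g10 g20 g30 g40 HQ HR AC_observable AD_controllable.
pose H t := A t - B t *m K t; pose F t := A t - L t *m C t.
have FE t : 0 <= t -> F t = A t - P t *m (C t)^T *m invmx (Rt t) *m C t.
  by move=> t0; rewrite /F L_def.
have cF : continuous_from0 F.
  by apply: continuous_from0B => //; exact: continuous_from0_mulmx.
(* A column of the inverse is its value at a basis vector, so the lower bound g3 on R applies column
   by column. *)
have HRV t : 0 <= t -> `|invmx (Rt t)| <= p%:R / g3.
  move=> t0; apply/mx_norm_leP => [|i j]; first by rewrite divr_ge0 // ltW.
  have [h1 _] := HR t t0.
  have := loewner_inv_bound (delta_mx j 0 : 'cV[R]_p) g30 h1; rewrite -colE => h2.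
  have -> : invmx (Rt t) i j = col j (invmx (Rt t)) i 0 by rewrite mxE.
  apply: le_trans (mx_entry_le_norm _ _ _) _; rewrite ler_pdivlMr // mulrC.
  apply: le_trans h2 _; rewrite ler_piMr //.
  apply/mx_norm_leP => // i' j'; rewrite !mxE.
  by case: (_ && _); rewrite ?normr1 ?normr0.
have mulb m1 m2 m3 (Y : 'M[R]_(m1, m2)) (Z : 'M[R]_(m2, m3)) y z :
    `|Y| <= y -> `|Z| <= z -> `|Y *m Z| <= m2%:R * y * z.
  move=> hy hz; apply: le_trans (norm_mulmx_le Y Z) _.
  by rewrite -!mulrA ler_wpM2l // ler_pM.
pose bG := p%:R * (p%:R * (n%:R * bP * bC) * (p%:R / g3)) * bC.
have bG0 : 0 <= bG by rewrite !mulr_ge0 // invr_ge0 ltW.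
have hh0 : 0 <= bA + bBK + bG by rewrite !addr_ge0.
have hH t : 0 <= t -> `|H t| <= bA + bBK + bG.
  move=> t0; apply: le_trans (ler_normB _ _) _.
  by have := HA t t0; have := HBK t t0; lra.
have hB t : 0 <= t -> `|B t *m K t| <= bA + bBK + bG.
  by move=> t0; have := HBK t t0; lra.
have hF t : 0 <= t -> `|F t| <= bA + bBK + bG.
  move=> t0; rewrite FE //; apply: le_trans (ler_normB _ _) _.
  have HCT : `|(C t)^T| <= bC by rewrite norm_trmx HC.
  have := mulb _ _ _ _ _ _ _ (mulb _ _ _ _ _ _ _ (mulb _ _ _ _ _ _ _ (HP t t0) HCT)
    (HRV t t0)) (HC t t0).
  by have := HA t t0; rewrite -/bG; lra.
have [c [r [c0 r0 f_lin]]] := error_dynamics.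
have [cz [lz [cz0 lz0 Hz]]] := exponentially_stable_linear K_stab.
have quarter : 0 < 4^-1 :> R by rewrite invr_gt0.
have [N0 HN0] := Hs _ quarter.
(* One window length for both diagonal blocks: N >= N0 gives the factor 1/4 for the observer, and 4
   cz <= lz N s gives cz expR (- lz N s) <= 1/4 because expR y >= y. *)
pose N := (maxn N0 (Num.truncn (4 * cz / (lz * s)))).+1.
have NN0 : (N0 <= N)%N by rewrite leqW // leq_maxl.
have lzs0 : 0 < lz * s by exact: mulr_gt0.
have hN : 4 * cz <= lz * (N%:R * s).
  have : 4 * cz / (lz * s) <= N%:R.
    apply: ltW; apply: lt_le_trans (truncnS_gt _) _.
    by rewrite ler_nat ltnS leq_maxr.
  by rewrite ler_pdivrMr //; move=> h1; apply: le_trans h1 _; rewrite mulrCA.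
pose T := N%:R * s.
have T0 : 0 < T by rewrite mulr_gt0.
have Hcontr t z0 : 0 <= t -> exists z : R -> 'cV[R]_n,
    [/\ z t = z0, forall u, t <= u -> deriv_within `[t, +oo[ z u (H u *m z u) &
        `|z (t + T)| <= 4^-1 * `|z0|].
  move=> t0; have [z [zt dz bz]] := Hz t z0 t0; exists z; split => //.
  have tT : t <= t + T by rewrite lerDl ltW.
  apply: le_trans (bz _ tT) _; rewrite ler_wpM2r // addrAC subrr add0r.
  rewrite mulNr expRN ler_pdivrMr ?expR_gt0 // -ler_pdivrMl //.
  rewrite invrK; apply: le_trans hN _.
  by apply: le_trans (expR_ge1Dx _); rewrite lerDr.
have Fcontr t z0 : 0 <= t -> exists z : R -> 'cV[R]_n,
    [/\ z t = z0, forall u, t <= u -> deriv_within `[t, +oo[ z u (F u *m z u) &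
        `|z (t + T)| <= 4^-1 * `|z0|].
  move=> t0; have [z [zt dz]] := linear_solution z0 cF t0; exists z; split => //.
  rewrite -zt; apply: (HN0 N NN0 t z t0) => u /andP[tu _].
  by rewrite -FE ?(le_trans t0 tu) //; exact: (deriv_within_itvy_sub _ (lexx t) (dz u tu)).
pose ef := error_field h x0 u0 A B C L K Xt.
have [mu [Cw [mu1 Cw0 Hwin]]] := cascade_window hh0 c0 r0 T0 hH hB hF f_lin Hcontr Fcontr.
have Hgrow := cascade_growth hh0 c0 r0 hH hB hF f_lin.
have k0 : 0 <= (n + n)%:R * (bA + bBK + bG) + 2 * c * r.
  by rewrite addr_ge0 // !mulr_ge0 // ltW.
pose nu (x : 'cV[R]_(n + n)) := `|usubmx x| + mu * `|dsubmx x|.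
have mu0 : 0 <= mu by apply: le_trans mu1.
have Hnu x : `|x| <= nu x <= (1 + mu) * `|x|.
  apply/andP; split.
    rewrite -{1}[x]vsubmxK; apply: le_trans (norm_col_mx_le _ _) _.
    by rewrite /nu lerD2l ler_peMl.
  by rewrite mulrDl mul1r lerD ?norm_usubmx_le // ler_wpM2l // norm_dsubmx_le.
have es : exponentially_stable ef.
  apply: (exponentially_stable_of_decay r0).
  - by move=> t _; exact: error_field0.
  - move=> t0 xi; exact: (error_field_continuous h_C1 Xt1 cx0 u0_cont cA cB cC cL K_cont).
  - move=> T' rho; exact: (error_field_lipschitz h_C1 Xt1 cx0 u0_cont cA cB cC cL K_cont).
  exact: (@decay_of_window _ _ ef nu r _ T (1 + mu) Cw k0 T0 Cw0 Hnu Hgrow Hwin).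
split; first exact: es.
have [_ [ce [le [de [[ce0 le0 de0] Hes]]]]] := es.
(* Halved because |xi0| <= |q - x0 t0| + |z0| must stay below [de]. *)
exists ce, le, (de / 2); split; first by split => //; exact: divr_gt0.
move=> t0 qq z0 t00 Mq hq hz0.
pose xi0 := col_mx (qq - x0 t0) (qq - x0 t0 - z0).
have hxi0 : `|xi0| <= `|qq - x0 t0| + `|z0|.
  rewrite norm_col_mx ge_max lerDl normr_ge0 /=; exact: ler_normB.
have xi0d : `|xi0| < de by apply: le_lt_trans hxi0 _; lra.
have [[xi [xit0 dxi]] Hdec] := Hes t0 xi0 t00 xi0d.
have dx0D (E : set R) t : E `<=` `[0, +oo[ -> 0 <= t -> deriv_within E x0 t (Xt (x0 t) (u0 t)).
  by move=> D0s tt; rewrite (XtM _ _ (x0_M t tt)); exact: (deriv_within_sub D0s (dx0 t tt)).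
have subsub (a b : 'cV[R]_n) : a - (a - b) = b by rewrite opprB addrC subrK.
split.
  (* A solution of the extended error equation is read back as plant and observer states, with z =
     dx - e. *)
  pose x t := x0 t + usubmx (xi t); pose z t := usubmx (xi t) - dsubmx (xi t).
  have x0t : x t0 = qq by rewrite /x xit0 col_mxKu addrC subrK.
  have z0t : z t0 = z0 by rewrite /z xit0 col_mxKu col_mxKd subsub.
  have sub0 : `[t0, +oo[%classic `<=` `[0 : R, +oo[%classic.
    by move=> u /=; rewrite !in_itv /= !andbT; exact: le_trans.
  have dx t : t0 <= t -> deriv_within `[t0, +oo[ x t (Xt (x t) (u0 t - K t *m z t)).
    move=> t0t; have Dt : `[t0, +oo[%classic t by rewrite /= in_itv /= andbT.
    have := deriv_withinD (dx0D _ t sub0 (le_trans t00 t0t)) (deriv_within_usubmx (dxi t Dt)).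
    by rewrite col_mxKu addrC subrK.
  (* By [V_Xe] only the damping term contributes to the derivative of V along x, which is thus -
     |grad V|^2; V starts at 0 and is nonnegative. *)
  have Mx t : t0 <= t -> M (x t).
    move=> t0t; rewrite V_M /=.
    have Vq : V (x t0) = 0 by move: Mq; rewrite x0t V_M.
    have : V (x t) <= V (x t0).
      apply: (lyapunov_nonincreasing t0t V_diff (x' := fun u => Xt (x u) (u0 u - K u *m z u))).
        by move=> u /andP[t0u _]; exact: (deriv_within_itvy_sub _ (lexx t0) (dx u t0u)).
      move=> u _; rewrite /Xt /ext_field dotDr dotNr.
      have -> : dot (grad V (x u)) (Xe (x u) (u0 u - K u *m z u)) = 0 by exact: V_Xe.
      by rewrite add0r oppr_le0 dot_ge0.
    by rewrite Vq => Vle; apply/eqP; rewrite eq_le Vle V_ge0.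
  exists x, z; split => // t; rewrite /= in_itv /= andbT => t0t.
  have Dt : `[t0, +oo[%classic t by rewrite /= in_itv /= andbT.
  split; first exact: Mx.
    by have := dx t t0t; rewrite XtM //; exact: Mx.
  have := deriv_withinB (deriv_within_usubmx (dxi t Dt)) (deriv_within_dsubmx (dxi t Dt)).
  by rewrite col_mxKu col_mxKd subsub.
move=> T' x z xq zq Hcl t t0t.
(* On M the extended field is X, so every closed loop on M solves the extended error equation, and
   its decay estimate, valid for all solutions, applies. *)
pose xi' u := col_mx (x u - x0 u) (x u - x0 u - z u).
have xi't0 : xi' t0 = xi0 by rewrite /xi' xq zq.
have subT : `[t0, T'[%classic `<=` `[0 : R, +oo[%classic.
  by move=> u /=; rewrite !in_itv /= andbT => /andP[+ _]; exact: le_trans.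
have sol : is_solution ef `[t0, T'[ xi'.
  move=> u Du; have [Mu dxu dzu] := Hcl u Du.
  have u0' : 0 <= u by move: (subT u Du); rewrite /= in_itv /= andbT.
  have ddx := deriv_withinB dxu (dx0D _ u subT u0').
  have := deriv_within_col_mx ddx (deriv_withinB ddx dzu).
  congr (deriv_within _ _ u _).
  rewrite /ef /error_field /xi' col_mxKu col_mxKd [x0 u + _]addrC subrK.
  by rewrite subsub (XtM (x u) _ Mu).
have := Hdec T' xi' xi't0 sol t t0t.
have : `|x t - x0 t| <= `|xi' t|.
  by have := norm_usubmx_le (xi' t); rewrite col_mxKu.
move=> h1 h2; apply: le_trans h1 _; apply: le_trans h2 _.
by rewrite ler_wpM2r ?expR_ge0 // ler_wpM2l // ltW.
Qed.
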